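(* Let $f\colon\mathbb{C}\to\mathbb{C}$ be a transcendental entire (holomorphic) function. Then the classical Julia set of $f$, i.e. the set of all $z\in\mathbb{C}$ that have no neighbourhood on which the family of iterates $\{f^k:k\in\mathbb{N}\}$ is normal, coincides with the set $J(f)$ of all $x\in\mathbb{C}$ such that $$\operatorname{cap}\left(\mathbb{C}\setminus\bigcup_{k=1}^\infty f^k(U)\right)=0$$ for every neighbourhood $U$ of $x$.
   Context: Identify $\mathbb{C}$ with $\mathbb{R}^2$. $f^k$ denotes the $k$-th iterate of $f$; normality is with respect to locally uniform convergence in the spherical (chordal) metric, with the limit $\infty$ allowed. Neighbourhoods $U$ may be taken open. Capacity (with $n=2$): for an open set $A\subset\mathbb{R}^n$ and a non-empty compact $C\subset A$, $\operatorname{cap}(A,C)=\inf_u\int_A|\nabla u|^n\,dm$, the infimum over all non-negative $u\in C_0^\infty(A)$ with $u\ge1$ on $C$. A compact set $C$ has capacity zero, written $\operatorname{cap} C=0$, if $\operatorname{cap}(A,C)=0$ for some (equivalently every) bounded open $A\supset C$; an unbounded closed set has capacity zero if each of its compact subsets has capacity zero; the empty set has capacity zero. *)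

(* Defs.v *)
From HB Require Import structures.
From mathcomp Require Import all_boot all_order all_algebra.
From mathcomp Require Import complex.
From mathcomp Require Import all_classical all_reals all_analysis.

Set Implicit Arguments.
Unset Strict Implicit.
Unset Printing Implicit Defensive.

Import Order.TTheory GRing.Theory Num.Theory.
Import numFieldNormedType.Exports.

Local Open Scope classical_set_scope.
Local Open Scope ring_scope.

(* Packing R[i] as a numFieldType is what gives it its norm topology and its
   structure of normed module over itself. *)
Definition C (R : realType) : numFieldType := complex R.

(* [`|z|] lies in C R; [modulus z] is the same number as an element of R. *)
Definition modulus (R : realType) (z : C R) : R := ComplexField.Normc.normc z.

Definition toC (R : realType) (p : R * R) : C R := Complex p.1 p.2.

(* [derivable f z 1] is complex differentiability at z, since the scalar field
   of the normed module C R is C R. *)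
Definition entire (R : realType) (f : C R -> C R) : Prop :=
  forall z : C R, derivable f z 1.

Definition transcendental_entire (R : realType) (f : C R -> C R) : Prop :=
  entire f /\ ~ exists p : {poly C R}, forall z, f z = p.[z].

Definition sphere (R : realType) : Type := one_point_compactification (C R).

Definition chordal (R : realType) (z w : sphere R) : R :=
  match z, w with
  | Some z, Some w =>
      2 * modulus (z - w) /
        (Num.sqrt (1 + modulus z ^+ 2) * Num.sqrt (1 + modulus w ^+ 2))
  | Some z, None | None, Some z => 2 / Num.sqrt (1 + modulus z ^+ 2)
  | None, None => 0
  end.

Definition locally_uniform_cvg (R : realType) (U : set (C R))
    (s : nat -> C R -> C R) (g : C R -> sphere R) : Prop :=
  forall z, U z -> exists V, open_nbhs z V /\
    forall e : R, 0 < e -> \forall n \near \oo,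
      forall w, (U `&` V) w -> chordal (Some (s n w)) (g w) < e.

Definition normal_family (R : realType) (U : set (C R))
    (F : set (C R -> C R)) : Prop :=
  forall s : nat -> C R -> C R, (forall n, F (s n)) ->
  exists2 phi : nat -> nat, {homo phi : m n / (m < n)%N} &
  exists g : C R -> sphere R, locally_uniform_cvg U (s \o phi) g.

Definition iterates (R : realType) (f : C R -> C R) : set (C R -> C R) :=
  [set iter k f | k in [set k | (0 < k)%N]].

Definition classical_julia (R : realType) (f : C R -> C R) : set (C R) :=
  [set z | ~ exists U, open_nbhs z U /\ normal_family U (iterates f)].

Definition basis_vec (R : realType) (i : bool) : R * R :=
  if i then (0, 1) else (1, 0).

Definition partial (R : realType) (i : bool) (u : R * R -> R) : R * R -> R :=
  fun p => 'D_(basis_vec R i) u p.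

Definition smooth (R : realType) (u : R * R -> R) : Prop :=
  forall s : seq bool, let v := foldr (@partial R) u s in
    continuous v /\ forall p i, derivable v p (basis_vec R i).

(* C_0^oo(A), its elements being extended by 0 outside A. *)
Definition test_function (R : realType) (A : set (R * R)) (u : R * R -> R) :
    Prop :=
  [/\ smooth u, compact (closure [set p | u p != 0])
    & closure [set p | u p != 0] `<=` A].

Definition grad_norm (R : realType) (u : R * R -> R) (p : R * R) : R :=
  Num.sqrt (partial false u p ^+ 2 + partial true u p ^+ 2).

Definition capacity (R : realType) (A K : set (R * R)) : \bar R :=
  ereal_inf
    [set (\int[(@lebesgue_measure R \x @lebesgue_measure R)%E]_(p in A)
           (grad_norm u p ^+ 2)%:E)%E
    | u in [set u | [/\ test_function A u, (forall p, 0 <= u p)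
                      & (forall p, K p -> 1 <= u p)]]].

Definition compact_cap_zero (R : realType) (K : set (R * R)) : Prop :=
  K = set0 \/
  exists A, [/\ open A, bounded_set A, K `<=` A & capacity A K = 0%E].

(* By Heine-Borel the first clause is about compact sets. *)
Definition cap_zero (R : realType) (E : set (R * R)) : Prop :=
  [/\ closed E,
      (bounded_set E -> compact_cap_zero E)
    & (~ bounded_set E ->
       forall K, compact K -> K `<=` E -> compact_cap_zero K)].

Definition cap_julia (R : realType) (f : C R -> C R) : set (C R) :=
  [set x | forall U, open_nbhs x U ->
     cap_zero (@toC R @^-1`
       (~` \bigcup_(k in [set k | (0 < k)%N]) (iter k f @` U)))].

(* Main.v *)
(* If the iterates of f omit two values on a neighbourhood U of x, they form a normal family
   there by Montel's theorem.  Hence if x is in the Julia set, the union O of the f^k(U) misses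
   at most one point, and a point has capacity zero: averaging n bumps of dyadically decreasing
   widths gives a test function of energy O(1/n).

   Conversely, suppose that the iterates are normal on U and that C \ O has capacity zero.  A
   closed set of capacity zero has null projections to both axes, so O contains vertical and
   horizontal lines in every strip.  By normality and Harnack's inequality,
   log (2 + |f^k|) at two nearby points of O are comparable with a constant independent of k;
   chaining along the lines, this holds for any two points of O, in particular for p and f(p).
   So log (2 + |f^k|) grows at most geometrically in k at p, then on the boundary of a rectangle
   bounded by lines contained in O, and, by the maximum principle, on the whole rectangle.  But a
   transcendental f maps the disc of radius r onto a superset of a circle of radius at least r^N
   (Bohr), so that the maximum of log |f^k| over a fixed disc grows faster than every geometric
   sequence.

   Schottky's theorem, derived from Bloch's, yields Montel's theorem, Harnack's inequality, Bohr's
   theorem and the open mapping theorem. *)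

From HB Require Import structures.
From mathcomp Require Import all_boot all_order all_algebra.
From mathcomp Require Import complex.
From mathcomp Require Import all_classical all_reals all_analysis.
From mathcomp Require Import measurable_realfun ring lra.
Require Import Defs.

Set Implicit Arguments.
Unset Strict Implicit.
Unset Printing Implicit Defensive.

Import Order.TTheory GRing.Theory Num.Theory.
Import numFieldNormedType.Exports.

Local Open Scope classical_set_scope.
Local Open Scope ring_scope.

(** Normality controls an iterate only in two regimes: on a small disc it is either bounded by 20 or
    everywhere larger than 2. In the first regime [logsize] lies between two constants, in the
    second Harnack's inequality applies to the logarithm of the modulus; so one factor serves all
    iterates. Chaining multiplies such factors but never involves the index of the iterate, and
    since O is mapped into itself, p may be compared with f(p), which turns comparability into a
    recursion in the index. The lines serve twice, as paths between arbitrary points of O and as the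
    sides of a rectangle around a disc prescribed in advance. That disc must be fixed before the
    geometric rate is known, whereas the radius beyond which f exceeds r^N depends on N; the growth
    estimate therefore works with two exponents. Contour integrals are increments of primitives.
    Goursat's lemma supplies primitives of holomorphic functions, and Cauchy's formula is proved for
    such a primitive, whose derivative is already known to be continuous. *)

Local Notation "m| z |" := (modulus z) (at level 0, z at level 99, format "m| z |").
Local Notation Re := complex.Re.
Local Notation Im := complex.Im.

Local Ltac complex_ring := apply/eqP; rewrite eq_complex /=; apply/andP; split; apply/eqP; ring.

(** * Complex numbers and Caratheodory derivatives *)

Section Modulus.
Variable R : realType.
Implicit Types (z w : C R) (x : R).

Definition rc (x : R) : C R := Complex x 0.

Lemma modulus0 : m|(0 : C R)| = 0. Proof. exact: ComplexField.Normc.normc0. Qed.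
Lemma modulus1 : m|(1 : C R)| = 1. Proof. exact: ComplexField.Normc.normc1. Qed.
Lemma modulusM z w : m|z * w| = m|z| * m|w|.
Proof. exact: ComplexField.Normc.normcM. Qed.
Lemma modulusV z : m|z^-1| = m|z|^-1.
Proof. exact: ComplexField.Normc.normcV. Qed.
Lemma modulusN z : m|- z| = m|z|.
Proof. exact: normcN. Qed.
Lemma modulusB z w : m|z - w| = m|w - z|.
Proof. by rewrite -modulusN opprB. Qed.
Lemma modulusD z w : m|z + w| <= m|z| + m|w|.
Proof. exact: le_normcD. Qed.
Lemma modulus_ge0 z : 0 <= m|z|.
Proof. by case: z => a b; exact: sqrtr_ge0. Qed.
Lemma modulus_eq0 z : (m|z| == 0) = (z == 0).
Proof.
apply/eqP/eqP => [/ComplexField.Normc.eq0_normc//|->]; exact: modulus0.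
Qed.
Lemma modulus_gt0 z : (0 < m|z|) = (z != 0).
Proof. by rewrite lt_def modulus_eq0 modulus_ge0 andbT. Qed.
Lemma modulusX z n : m|z ^+ n| = m|z| ^+ n.
Proof.
by elim: n => [|n IH]; rewrite ?expr0 ?modulus1// !exprS modulusM IH.
Qed.
Lemma modulus_rc x : m|rc x| = `|x|.
Proof. by rewrite /modulus /= expr0n /= addr0 sqrtr_sqr. Qed.

Lemma normCE z : `|z| = rc m|z|. Proof. by []. Qed.

Lemma rcD x y : rc (x + y) = rc x + rc y.
Proof. by apply/eqP; rewrite eq_complex /= addr0 !eqxx. Qed.
Lemma rcM x y : rc (x * y) = rc x * rc y.
Proof. by complex_ring. Qed.
Lemma rcN x : rc (- x) = - rc x.
Proof. by apply/eqP; rewrite eq_complex /= oppr0 !eqxx. Qed.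
Lemma rcB x y : rc (x - y) = rc x - rc y.
Proof. by rewrite rcD rcN. Qed.
Lemma rc0 : rc 0 = 0. Proof. by []. Qed.
Lemma rc1 : rc 1 = 1. Proof. by []. Qed.
Lemma rc_eq0 x : (rc x == 0) = (x == 0).
Proof. by rewrite eq_complex /= eqxx andbT. Qed.
Lemma rcV x : rc x^-1 = (rc x)^-1.
Proof.
have [->|x0] := eqVneq x 0; first by rewrite invr0 rc0 invr0.
apply: (mulfI (_ : rc x != 0)); first by rewrite rc_eq0.
by rewrite -rcM !divff ?rc_eq0 ?rc1.
Qed.
Lemma rcX x n : rc (x ^+ n) = rc x ^+ n.
Proof. by elim: n => [|n IH]; rewrite ?expr0// !exprS rcM IH. Qed.
Lemma rc_nat n : rc n%:R = n%:R.
Proof. by elim: n => [|n IH]//; rewrite -!natr1 rcD IH. Qed.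

Lemma ler_Re z : `|Re z| <= m|z|.
Proof.
case: z => a b /=; rewrite -[leLHS]sqrtr_sqr; apply: ler_wsqrtr.
by rewrite lerDl sqr_ge0.
Qed.
Lemma ler_Im z : `|Im z| <= m|z|.
Proof.
case: z => a b /=; rewrite -[leLHS]sqrtr_sqr; apply: ler_wsqrtr.
by rewrite lerDr sqr_ge0.
Qed.
Lemma ReD z w : Re (z + w) = Re z + Re w. Proof. by case: z w => ? ? []. Qed.
Lemma ImD z w : Im (z + w) = Im z + Im w. Proof. by case: z w => ? ? []. Qed.
Lemma ReN z : Re (- z) = - Re z. Proof. by case: z. Qed.
Lemma ImN z : Im (- z) = - Im z. Proof. by case: z. Qed.
Lemma ReB z w : Re (z - w) = Re z - Re w. Proof. by rewrite ReD ReN. Qed.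
Lemma ImB z w : Im (z - w) = Im z - Im w. Proof. by rewrite ImD ImN. Qed.

Lemma modulus_le z : m|z| <= `|Re z| + `|Im z|.
Proof.
case: z => a b.
have -> : (Complex a b : C R) = rc a + rc b * Complex 0 1.
  by complex_ring.
apply: le_trans (modulusD _ _) _; rewrite modulusM !modulus_rc.
rewrite {1}/modulus /= expr0n add0r expr1n sqrtr1 mulr1.
by rewrite mulr0 mul0r subrr addr0 mulr1 mulr0 !addr0 add0r.
Qed.

Lemma modulus_sq z : m|z| ^+ 2 = Re z ^+ 2 + Im z ^+ 2.
Proof. by case: z => a b; rewrite sqr_sqrtr// addr_ge0// sqr_ge0. Qed.

Lemma ler_modulusB z w : m|z| - m|w| <= m|z - w|.
Proof. by rewrite lerBlDr -{1}(subrK w z); exact: modulusD. Qed.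

Lemma modulus_tri y z w : m|z - w| <= m|z - y| + m|y - w|.
Proof. by rewrite -{1}(subrK y z) -addrA; exact: modulusD. Qed.

Lemma modulus_nat n : m|(n%:R : C R)| = n%:R.
Proof. by rewrite -rc_nat modulus_rc ger0_norm. Qed.

(** The norm of [C R] takes values in [C R], where a positive element has imaginary part zero; hence
    real radii describe the topology and all later estimates stay in [R]. *)
Lemma nbhs_modulusP z (P : set (C R)) :
  nbhs z P <-> exists2 d : R, 0 < d & forall w, m|w - z| < d -> P w.
Proof.
split => [/nbhs_normP[e /= e0 H]|[d d0 H]].
- have e_re : e = rc (Re e).
    by move: e0; case: (e) => a b; rewrite ltcE /= => /andP[/eqP-> _].
  exists (Re e); first by move: e0; rewrite ltcE /= => /andP[_].
  move=> w wz; apply: H; rewrite /= distrC normCE e_re ltcE /= eqxx /=.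
  by [].
- apply/nbhs_normP; exists (rc d); first by rewrite /= ltcE /= eqxx.
  by move=> w /=; rewrite distrC normCE ltcE /= eqxx /= => /H.
Qed.

Lemma cvg_modulusP (T : Type) (F : set_system T) (FF : Filter F) (f : T -> C R) l :
  f @ F --> l <-> forall e : R, 0 < e -> \forall t \near F, m|f t - l| < e.
Proof.
split => [H e e0|H P].
  by apply: (H [set w | m|w - l| < e]); apply/nbhs_modulusP; exists e.
move=> /nbhs_modulusP[d d0 Hd].
by apply: filterS (H d d0) => t /Hd.
Qed.

Lemma cvg_realP (T : Type) (F : set_system T) (FF : Filter F) (f : T -> R) l :
  f @ F --> l <-> forall e : R, 0 < e -> \forall t \near F, `|f t - l| < e.
Proof.
split => [/cvgrPdist_lt H e e0|H]; last apply/cvgrPdist_lt => e e0.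
  by apply: filterS (H e e0) => t; rewrite distrC.
by apply: filterS (H e e0) => t; rewrite distrC.
Qed.

Lemma near_real (x e : R) : 0 < e -> \forall y \near x, `|y - x| < e.
Proof. by move=> e0; have /(cvg_realP (nbhs_filter x)) := @cvg_id _ (nbhs x); exact. Qed.

Lemma near_complex z (e : R) : 0 < e -> \forall w \near z, m|w - z| < e.
Proof. by move=> e0; apply/nbhs_modulusP; exists e. Qed.

Lemma continuous_modulus : continuous (@modulus R).
Proof.
move=> z; apply/(cvg_realP (nbhs_filter z)) => e e0.
apply: filterS (near_complex z e0) => w; apply: le_lt_trans.
by rewrite ler_norml lerNl opprB {1}modulusB !ler_modulusB.
Qed.

Lemma continuous_rc : continuous rc.
Proof.
move=> x; apply/(cvg_modulusP (nbhs_filter x)) => e e0.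
by apply: filterS (near_real x e0) => y; rewrite -rcB modulus_rc.
Qed.

Lemma continuous_Re : continuous (@complex.Re R : C R -> R).
Proof.
move=> z; apply/(cvg_realP (nbhs_filter z)) => e e0.
by apply: filterS (near_complex z e0) => w; apply: le_lt_trans; rewrite -ReB ler_Re.
Qed.

Lemma continuous_Im : continuous (@complex.Im R : C R -> R).
Proof.
move=> z; apply/(cvg_realP (nbhs_filter z)) => e e0.
by apply: filterS (near_complex z e0) => w; apply: le_lt_trans; rewrite -ImB ler_Im.
Qed.

Lemma cvg_toC (T : Type) (F : set_system T) (FF : Filter F) (f g : T -> R) a b :
  f @ F --> a -> g @ F --> b -> (fun t => Complex (f t) (g t) : C R) @ F --> (Complex a b : C R).
Proof.
move=> /(cvg_realP FF) fa /(cvg_realP FF) gb; apply/(cvg_modulusP FF) => e e0.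
have e20 : 0 < e / 2 by rewrite divr_gt0.
apply: filterS2 (fa _ e20) (gb _ e20) => t ft gt.
apply: le_lt_trans (modulus_le _) _.
by rewrite ReB ImB /= (splitr e) ltrD.
Qed.

Lemma continuous_toC : continuous (@toC R : R * R -> C R).
Proof.
move=> p; apply: (cvg_toC (nbhs_filter p)); [exact: cvg_fst|exact: cvg_snd].
Qed.

End Modulus.

Arguments rc {R} x.

Section Compactness.
Variable R : realType.
Implicit Types (z w : C R).

Lemma closed_bounded_compact (A : set (C R)) (M : R) :
  closed A -> (forall z, A z -> m|z| <= M) -> compact A.
Proof.
move=> clA bA.
pose Q := @toC R @` (`[- M, M]%classic `*` `[- M, M]%classic).
have cQ : compact Q.
  apply: continuous_compact.
    by apply: continuous_subspaceT; exact: continuous_toC.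
  by apply: compact_setX; exact: segment_compact.
apply: (subclosed_compact clA cQ) => z /bA zM.
exists (Re z, Im z); last by case: (z).
by split => /=; rewrite in_itv /= -ler_norml (le_trans _ zM)// (ler_Re, ler_Im).
Qed.

Lemma closed_disc_closed (c : C R) (r : R) : closed [set z | m|z - c| <= r].
Proof.
apply: (@preimage_closed _ _ (fun z => m|z - c|) [set x | x <= r]).
  move=> z _; apply: (@continuous_comp _ _ _ (fun z => z - c) (@modulus R)).
    by apply: continuousB; [exact: (fun U HU => HU)|exact: cst_continuous].
  exact: continuous_modulus.
exact: closed_le.
Qed.

Lemma closed_disc_compact (c : C R) (r : R) : compact [set z | m|z - c| <= r].
Proof.
apply: (closed_bounded_compact (M := r + m|c|)).
  exact: closed_disc_closed.
by move=> z /= zc; rewrite -(subrK c z) (le_trans (modulusD _ _)) // lerD2r.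
Qed.

Lemma compact_max (A : set (C R)) (f : C R -> R) :
  A !=set0 -> compact A -> (forall z, A z -> {for z, continuous f}) ->
  exists2 c, A c & forall z, A z -> f z <= f c.
Proof.
move=> A0 cA cf.
have [|c cA' H] := @compact_EVT_max _ R f A A0 cA.
  by apply: continuous_in_subspaceT => z; rewrite inE; exact: cf.
exists c; first by move: cA'; rewrite inE.
by move=> z Az; apply: H; rewrite inE.
Qed.

End Compactness.

Section CaratheodoryDerivative.
Variables (R : realType).

(* Caratheodory's form of the derivative of f with respect to the embedding iota: K is R for
   curves and C for holomorphic functions, so that both share one calculus. *)
Definition dif (K : topologicalType) (iota f : K -> C R) (t : K) (l : C R) :=
  exists g : K -> C R, [/\ {for t, continuous g}, g t = l &
    \forall s \near t, f s = f t + g s * (iota s - iota t)].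

Section Rules.
Variables (K : topologicalType) (iota : K -> C R).
Implicit Types (f h : K -> C R) (t : K) (l m : C R).

Lemma dif_near f h t l : f t = h t -> (\forall s \near t, f s = h s) ->
  dif iota f t l -> dif iota h t l.
Proof.
move=> ft fh [g [cg gt Hg]]; exists g; split => //.
by apply: filterS2 fh Hg => s <- ->; rewrite ft.
Qed.

Lemma dif_cst (a : C R) t : dif iota (fun=> a) t 0.
Proof.
exists (fun=> 0); split => //; first exact: cst_continuous.
by apply: nearW => s; rewrite mul0r addr0.
Qed.

Lemma dif_iota t : dif iota iota t 1.
Proof.
exists (fun=> 1); split => //; first exact: cst_continuous.
by apply: nearW => s; rewrite mul1r addrC subrK.
Qed.

Lemma difD f h t l m :
  dif iota f t l -> dif iota h t m -> dif iota (fun s => f s + h s) t (l + m).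
Proof.
move=> [g [cg <- Hg]] [k [ck <- Hk]]; exists (fun s => g s + k s); split; [|by []|].
  by apply: continuousD; [exact: cg|exact: ck].
by apply: filterS2 Hg Hk => s -> ->; ring.
Qed.

Lemma difZ (a : C R) f t l : dif iota f t l -> dif iota (fun s => a * f s) t (a * l).
Proof.
move=> [g [cg <- Hg]]; exists (fun s => a * g s); split; [|by []|].
  by apply: continuousM cg; exact: cst_continuous.
by apply: filterS Hg => s ->; ring.
Qed.

Lemma difN f t l : dif iota f t l -> dif iota (fun s => - f s) t (- l).
Proof.
move=> /(difZ (-1)); rewrite mulN1r; apply: dif_near; first by rewrite mulN1r.
by apply: nearW => s; rewrite mulN1r.
Qed.

Lemma difB f h t l m :
  dif iota f t l -> dif iota h t m -> dif iota (fun s => f s - h s) t (l - m).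
Proof. by move=> fl /difN; exact: difD. Qed.

Hypothesis iota_cont : continuous iota.

Lemma dif_cont f t l : dif iota f t l -> {for t, continuous f}.
Proof.
move=> [g [cg gt Hg]].
have H : {for t, continuous (fun s => f t + g s * (iota s - iota t))}.
  apply: continuousD; first exact: cst_continuous.
  apply: continuousM; first exact: cg.
  by apply: continuousB; [exact: iota_cont|exact: cst_continuous].
have : f t + g s * (iota s - iota t) @[s --> t] --> f t.
  by have := H; rewrite /prop_for /continuous_at subrr mulr0 addr0.
by apply: cvg_trans; apply: near_eq_cvg; apply: filterS Hg => s ->.
Qed.

Lemma difM f h t l m :
  dif iota f t l -> dif iota h t m ->
  dif iota (fun s => f s * h s) t (l * h t + f t * m).
Proof.
move=> fl hm; have cf := dif_cont fl.
case: fl => [g [cg <- Hg]]; case: hm => [k [ck <- Hk]].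
exists (fun s => g s * h t + f s * k s); split; [|by []|].
  apply: continuousD; apply: continuousM; [exact: cg|exact: cst_continuous|exact: cf|exact: ck].
by apply: filterS2 Hg Hk => s fs hs; rewrite mulrDl -[f s * h s]/(f s * h s) {1}hs {1}fs; rewrite fs; ring.
Qed.

Lemma difX f t l n :
  dif iota f t l -> dif iota (fun s => f s ^+ n) t (n%:R * f t ^+ n.-1 * l).
Proof.
move=> fl; elim: n => [|n IH].
  by rewrite !mul0r; exact: dif_cst.
have := difM fl IH; rewrite (_ : _ + _ = n.+1%:R * f t ^+ n.+1.-1 * l).
  by move=> H; apply: (dif_near _ _ H); [rewrite exprS|apply: nearW => s; rewrite exprS].
case: n {IH} => [|n]; first by rewrite !expr0; ring.
by rewrite /= exprS -natr1; ring.
Qed.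

Lemma difV f t l : f t != 0 ->
  dif iota f t l -> dif iota (fun s => (f s)^-1) t (- l / f t ^+ 2).
Proof.
move=> ft0 fl; have cf := dif_cont fl.
case: fl => [g [cg <- Hg]]; exists (fun s => - g s / (f s * f t)); split; [|by rewrite -expr2|].
- apply: continuousM; first by apply: continuousN; exact: cg.
  apply: continuousV; first by rewrite mulf_neq0.
  by apply: continuousM; [exact: cf|exact: cst_continuous].
- have nz : \forall s \near t, f s != 0 by exact: (cvgr_neq0 _ cf).
apply: filterS2 nz Hg => s fs0 Hs.
have -> : (f s)^-1 = (f t)^-1 + (f t - f s) / (f s * f t).
  by field; rewrite fs0 ft0.
have -> : f t - f s = - g s * (iota s - iota t) by rewrite Hs; ring.
by field; rewrite fs0 ft0.
Qed.

Lemma dif_comp (F : C R -> C R) f t l m :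
  dif id F (f t) m -> dif iota f t l -> dif iota (fun s => F (f s)) t (m * l).
Proof.
move=> [G [cG <- HG]] fl; have cf := dif_cont fl.
case: fl => [g [cg <- Hg]]; exists (fun s => G (f s) * g s); split; [|by []|].
  by apply: continuousM; [exact: (continuous_comp cf cG)|exact: cg].
have HG' : \forall s \near t, F (f s) = F (f t) + G (f s) * (f s - f t) by exact: cf HG.
apply: filterS2 HG' Hg => s -> Hs.
by rewrite {2}Hs; ring.
Qed.

Lemma dif_approx f t l : dif iota f t l -> forall e : R, 0 < e ->
  \forall s \near t, m|f s - f t - l * (iota s - iota t)| <= e * m|iota s - iota t|.
Proof.
move=> [g [cg <- Hg]] e e0; have /(cvg_modulusP (nbhs_filter t)) /(_ _ e0) cg' := cg.
apply: filterS2 cg' Hg => s gs ->.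
rewrite (_ : _ - _ - _ = (g s - g t) * (iota s - iota t)); last by ring.
by rewrite modulusM ler_wpM2r ?modulus_ge0 ?ltW.
Qed.

Lemma approx_dif f t l : injective iota -> (forall e : R, 0 < e ->
  \forall s \near t, m|f s - f t - l * (iota s - iota t)| <= e * m|iota s - iota t|) ->
  dif iota f t l.
Proof.
move=> inj H; pose g s := if s == t :> K then l else (f s - f t) / (iota s - iota t).
exists g; split; last 1 first.
- apply: nearW => s; rewrite /g; case: eqP => [->|/eqP st].
    by rewrite subrr mulr0 addr0.
  by rewrite divfK ?subr_eq0 ?(inj_eq inj)// addrC subrK.
- apply/(cvg_modulusP (nbhs_filter t)) => e e0.
  have e20 : 0 < e / 2 by rewrite divr_gt0.
  apply: filterS (H _ e20) => s Hs; rewrite /g eqxx; case: eqP => [_|/eqP st].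
    by rewrite subrr modulus0.
  have st0 : iota s - iota t != 0 by rewrite subr_eq0 (inj_eq inj).
  rewrite (_ : _ - _ = (f s - f t - l * (iota s - iota t)) / (iota s - iota t)); last by field.
  rewrite modulusM modulusV ltr_pdivrMr ?modulus_gt0//.
  apply: le_lt_trans Hs _; rewrite ltr_pM2r ?modulus_gt0//.
  by rewrite ltr_pdivrMr// ltr_pMr// ltr1n.
- by rewrite /g eqxx.
Qed.

End Rules.

(** Over an arbitrary field, because it turns both the complex derivability in [entire] and real
    derivatives into [dif]. *)
Lemma derivable_slope (K : numFieldType) (f : K -> K) (t : K) : derivable f t 1 ->
  exists g : K -> K, [/\ {for t, continuous g}, g t = 'D_1 f t &
    forall s, f s = f t + g s * (s - t)].
Proof.
move=> df; pose g s := if s == t then 'D_1 f t else (f s - f t) / (s - t).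
exists g; split; last 1 first.
- move=> s; rewrite /g; case: eqP => [->|/eqP st].
    by rewrite subrr mulr0 addr0.
  by rewrite divfK ?subr_eq0// addrC subrK.
- apply/(cvgrPdist_lt (FF:=nbhs_filter t)) => e e0.
  move: df; rewrite /derivable -/(derive f t 1) => /cvgrPdist_lt/(_ _ e0).
  rewrite near_withinE => /nbhs_normP[d /= d0 H].
  apply/nbhs_normP; exists d => //= s st; rewrite /g eqxx; case: eqP => [_|/eqP st'].
    by rewrite subrr normr0.
  have := H (s - t); rewrite /= sub0r normrN -normrN opprB => /(_ st).
  rewrite subr_eq0 => /(_ st').
  by rewrite /= [_%:A]mulr1 subrK mulrC.
- by rewrite /g eqxx.
Qed.

Lemma slope_derive (K : numFieldType) (f g : K -> K) (t : K) :
  {for t, continuous g} -> (\forall s \near t, f s = f t + g s * (s - t)) ->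
  is_derive t 1 f (g t).
Proof.
move=> cg Hg.
suff H : h^-1 *: ((f \o shift t) (h *: 1) - f t) @[h --> 0^'] --> g t.
  apply: DeriveDef; first by apply/cvg_ex; exists (g t).
  by apply/cvg_lim => //; exact: norm_hausdorff.
apply/cvgrPdist_lt => e e0.
have /cvgrPdist_lt/(_ _ e0) cg' := cg.
have [d /= d0 H] : exists2 d : K, 0 < d & forall s, `|t - s| < d ->
    `|g t - g s| < e /\ f s = f t + g s * (s - t).
  have [d /= d0 H] := (nbhs_normP _ _).1 (filterI cg' Hg).
  by exists d.
rewrite near_withinE; apply/nbhs_normP; exists d => // h; rewrite /ball_ /= sub0r normrN => hd h0.
have [] := H (h + t); first by rewrite opprD addrCA subrr addr0 normrN.
rewrite addrK [_%:A]mulr1 => gh ->.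
by rewrite addrAC subrr add0r -[_ *: _]/(_ * _) mulrCA mulVf// mulr1.
Qed.

Lemma derivable_dif (f : C R -> C R) z : derivable f z 1 -> exists l, dif id f z l.
Proof.
move=> /derivable_slope [g [cg gz Hg]]; exists (g z), g; split => //.
exact: (@filterE _ (nbhs z) _ _ Hg).
Qed.

Lemma dif_uniq (f : C R -> C R) z l m : dif id f z l -> dif id f z m -> l = m.
Proof.
move=> [g [cg <- /(slope_derive cg) dg]] [h [ch <- /(slope_derive ch) dh]].
by rewrite -(@derive_val _ _ _ _ _ _ _ dg) -(@derive_val _ _ _ _ _ _ _ dh).
Qed.

Lemma is_derive_dif (f : R -> R) (t d : R) : is_derive t 1 f d ->
  dif (@rc R) (fun s => rc (f s)) t (rc d).
Proof.
move=> [/derivable_slope [g [cg gt Hg]] <-]; exists (fun s => rc (g s)); split.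
- by apply: (continuous_comp cg); exact: continuous_rc.
- by rewrite gt.
- by apply: (@filterE _ (nbhs t)) => s; rewrite -rcB -rcM -rcD -Hg.
Qed.

Lemma dif_is_derive (f : R -> C R) t l (u : C R) : dif (@rc R) f t l ->
  is_derive t 1 (fun s => Re (u * f s)) (Re (u * l)).
Proof.
move=> [g [cg <- Hg]]; apply: (@slope_derive R _ (fun s => Re (u * g s))).
  have cug : {for t, continuous (fun s => u * g s)} by apply: continuousM cg; exact: cst_continuous.
  by apply: (continuous_comp cug); exact: continuous_Re.
apply: filterS Hg => s ->; rewrite mulrDr ReD; congr (_ + _).
rewrite -rcB mulrA; case: (u * g s) => a b /=; ring.
Qed.

End CaratheodoryDerivative.

(** * Cauchy's formula *)

Section PathIntegral.
Variable R : realType.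
Implicit Types (P phi psi : R -> C R) (v : C R).

Let I01 (t : R) := 0 <= t <= 1.

(** Multiplication by the unit number [u] turns the increment [D] into its modulus; the real mean
    value theorem for the real part of [u * P] then gives the bound. *)
Lemma dif_bound P phi (M : R) :
  (forall t, I01 t -> dif rc P t (phi t)) ->
  (forall t, I01 t -> m|phi t| <= M) -> m|P 1 - P 0| <= M.
Proof.
move=> dP bM; set D := P 1 - P 0.
have [->|D0] := eqVneq D 0.
  by rewrite modulus0; apply: le_trans (bM 0 _); rewrite ?modulus_ge0// /I01 lexx ler01.
pose u : C R := conjc D / rc m|D|.
have conjE (z : C R) : conjc z * z = rc (m|z| ^+ 2).
  rewrite modulus_sq; case: (z) => a b; apply/eqP.
  by rewrite eq_complex /=; apply/andP; split; apply/eqP; ring.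
have mJ (z : C R) : m|conjc z : C R| = m|z|.
  by case: (z) => a b; rewrite /modulus /= sqrrN.
have mD : m|D| != 0 by rewrite modulus_eq0.
have uD : u * D = rc m|D|.
  by rewrite /u mulrAC conjE -rcV -rcM; congr rc; field.
have mu : m|u| = 1.
  by rewrite /u modulusM modulusV mJ modulus_rc ger0_norm ?modulus_ge0// divff.
have [||c cI Hc] := @MVT_segment R (fun s => Re (u * P s)) (fun s => Re (u * phi s)) 0 1 ler01.
- move=> x; rewrite in_itv /= => /andP[x0 x1]; apply: dif_is_derive.
  by apply: dP; rewrite /I01 !ltW.
- apply: derivable_within_continuous => x; rewrite in_itv /= => xI.
  by have [] := dif_is_derive u (dP x xI).
move: Hc; rewrite subr0 mulr1 -ReB -mulrBr -/D uD /= => ->.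
apply: le_trans (ler_norm _) _; apply: le_trans (ler_Re _) _.
by rewrite modulusM mu mul1r; apply: bM; move: cI; rewrite in_itv.
Qed.

Lemma dif_reparam P (k c t : R) l : dif rc P (k + c * t) l ->
  dif rc (fun s => P (k + c * s)) t (l * rc c).
Proof.
have ck : {for t, continuous (fun s : R => k + c * s)}.
  apply: continuousD; first exact: cst_continuous.
  by apply: continuousM; [exact: cst_continuous|exact: (fun U HU => HU)].
move=> [g [cg <- Hg]]; exists (fun s => g (k + c * s) * rc c); split; [|by []|].
  apply: continuousM; last exact: cst_continuous.
  exact: (continuous_comp ck cg).
have Hg' : \forall s \near t, P (k + c * s) =
    P (k + c * t) + g (k + c * s) * (rc (k + c * s) - rc (k + c * t)) by exact: (ck _ Hg).
apply: filterS Hg' => s ->.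
by rewrite -mulrA -!rcB -rcM; congr (_ + _ * rc _); ring.
Qed.

(* v is the integral of phi over [0, 1], computed from a primitive. *)
Definition isint phi v := exists2 P, (forall t, I01 t -> dif rc P t (phi t)) &
  v = P 1 - P 0.

Lemma isint_bound phi v (M : R) : isint phi v ->
  (forall t, I01 t -> m|phi t| <= M) -> m|v| <= M.
Proof. by move=> [P dP ->]; exact: dif_bound. Qed.

Lemma isintB phi psi v w : isint phi v -> isint psi w ->
  isint (fun t => phi t - psi t) (v - w).
Proof.
move=> [P dP ->] [Q dQ ->]; exists (fun t => P t - Q t); last by ring.
by move=> t It; apply: difB; [exact: dP|exact: dQ].
Qed.

Lemma isintZ a phi v : isint phi v -> isint (fun t => a * phi t) (a * v).
Proof.
move=> [P dP ->]; exists (fun t => a * P t); last by ring.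
by move=> t It; apply: difZ; exact: dP.
Qed.

Lemma eq_isint phi psi v : (forall t, I01 t -> phi t = psi t) ->
  isint phi v -> isint psi v.
Proof. by move=> E [P dP ->]; exists P => // t It; rewrite -E//; exact: dP. Qed.

Lemma isint_uniq phi v w : isint phi v -> isint phi w -> v = w.
Proof.
move=> Hv Hw; apply/eqP; rewrite -subr_eq0 -modulus_eq0 eq_le modulus_ge0 andbT.
apply: (isint_bound (isintB Hv Hw)) => t It; by rewrite subrr modulus0.
Qed.

Lemma continuous_primitive (f : R -> R) (a b : R) : continuous f ->
  exists F : R -> R, forall t, a <= t <= b -> is_derive t 1 F (f t).
Proof.
(* Integration starts at [a - 1] so that every point of [a, b], the endpoint [a] included, is
   interior to the interval of the fundamental theorem of calculus. *)
move=> cf; exists (fun x => (\int[lebesgue_measure]_(t in `[a - 1, x]) f t)%R).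
move=> t /andP[t0 t1].
have [||||d1 d2] := @continuous_FTC1_closed R f (a - 1) t (b + 1).
- by rewrite (le_lt_trans t1)// ltrDl.
- apply: continuous_compact_integrable; first exact: segment_compact.
  exact: continuous_subspaceT.
- by rewrite (lt_le_trans _ t0)// gtrBl.
- exact: cf.
apply: DeriveDef; first exact: d1.
by rewrite -d2 derive1E.
Qed.

Lemma isint_exists phi : (forall t, I01 t -> {for t, continuous phi}) ->
  exists v, isint phi v.
Proof.
(* Continuity of [phi] is known only at the points of [0, 1]; composition with the retraction [cl]
   of the line onto [0, 1] makes it continuous everywhere. *)
move=> cphi; pose cl (t : R) := Num.max 0 (Num.min 1 t).
have clI t : I01 (cl t).
  by rewrite /I01 /cl le_max lexx /= ge_max ler01 /= ge_min lexx.
have clE t : I01 t -> cl t = t.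
  by move=> /andP[t0 t1]; rewrite /cl min_r// max_r.
have ccl : continuous cl.
  move=> t; apply: continuous_max; first exact: cst_continuous.
  by apply: continuous_min; [exact: cst_continuous|exact: (fun U HU => HU)].
have cpc : continuous (fun t => phi (cl t)).
  by move=> t; apply: (continuous_comp (ccl t)); exact: cphi.
have [F1 dF1] : exists F : R -> R, forall t, I01 t -> is_derive t 1 F (Re (phi (cl t))).
  apply: continuous_primitive => t; apply: (continuous_comp (cpc t)); exact: continuous_Re.
have [F2 dF2] : exists F : R -> R, forall t, I01 t -> is_derive t 1 F (Im (phi (cl t))).
  apply: continuous_primitive => t; apply: (continuous_comp (cpc t)); exact: continuous_Im.
pose P t : C R := rc (F1 t) + Complex 0 1 * rc (F2 t).
exists (P 1 - P 0), P => // t It.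
have -> : phi t = rc (Re (phi (cl t))) + Complex 0 1 * rc (Im (phi (cl t))).
  rewrite clE//; case: (phi t) => a b; apply/eqP.
  by rewrite eq_complex /=; apply/andP; split; apply/eqP; ring.
by apply: difD; [exact: (is_derive_dif (dF1 t It))|apply: difZ; exact: (is_derive_dif (dF2 t It))].
Qed.

End PathIntegral.

(** * Integrals along segments *)

Section Segments.
Variable R : realType.
Implicit Types (a b c z w p : C R) (f g A : C R -> C R).

Definition seg a b (t : R) : C R := a + rc t * (b - a).

Lemma seg0 a b : seg a b 0 = a.
Proof. by rewrite /seg rc0 mul0r addr0. Qed.

Lemma seg1 a b : seg a b 1 = b.
Proof. by rewrite /seg rc1 mul1r addrC subrK. Qed.

Lemma dif_seg a b t : dif rc (seg a b) t (b - a).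
Proof.
exists (fun=> b - a); split; [exact: cst_continuous|by []|].
by apply: (@filterE _ (nbhs t)) => s; rewrite /seg; ring.
Qed.

Lemma continuous_seg a b : continuous (seg a b).
Proof. by move=> t; exact: (dif_cont (@continuous_rc R) (dif_seg a b t)). Qed.

Lemma seg_half a b : seg a b 2^-1 = (a + b) / 2.
Proof. by rewrite /seg rcV rc_nat; field. Qed.

Definition convexC (D : set (C R)) :=
  forall a b (t : R), D a -> D b -> 0 <= t <= 1 -> D (seg a b t).

Lemma modulus_seg a b (t : R) c : 0 <= t <= 1 ->
  m|seg a b t - c| <= Num.max m|a - c| m|b - c|.
Proof.
move=> /andP[t0 t1]; have t1' : 0 <= 1 - t by rewrite subr_ge0.
have -> : seg a b t - c = rc (1 - t) * (a - c) + rc t * (b - c).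
  by rewrite /seg rcB rc1; ring.
apply: le_trans (modulusD _ _) _; rewrite !modulusM !modulus_rc !ger0_norm//.
apply: (@le_trans _ _ ((1 - t) * Num.max m|a - c| m|b - c| + t * Num.max m|a - c| m|b - c|)).
  by apply: lerD; apply: ler_wpM2l => //; rewrite le_max lexx ?orbT.
by rewrite -mulrDl subrK mul1r.
Qed.

Lemma convex_closed_disc c r : convexC [set z | m|z - c| <= r].
Proof.
move=> a b t /= ac bc It; apply: le_trans (modulus_seg _ _ _ It) _.
by rewrite ge_max ac.
Qed.

Lemma convex_disc c r : convexC [set z | m|z - c| < r].
Proof.
move=> a b t /= ac bc It; apply: le_lt_trans (modulus_seg _ _ _ It) _.
by rewrite gt_max ac.
Qed.

(** The default 0 stands for a missing integral; [sintP] shows that the integral exists when [f] is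
    continuous on a convex set containing both ends. *)
Definition sint f a b : C R :=
  xget 0 [set v | isint (fun t => f (seg a b t) * (b - a)) v].

Definition cont_on (D : set (C R)) f := forall z, D z -> {for z, continuous f}.

Section OnConvex.
Variables (D : set (C R)) (f : C R -> C R).
Hypotheses (cD : convexC D) (cf : cont_on D f).

Lemma sintP a b : D a -> D b -> isint (fun t => f (seg a b t) * (b - a)) (sint f a b).
Proof.
move=> Da Db; suff [v Hv] : exists v, isint (fun t => f (seg a b t) * (b - a)) v.
  by rewrite /sint; apply: xgetPex; exists v.
apply: isint_exists => t It; apply: continuousM; last exact: cst_continuous.
apply: (continuous_comp (@continuous_seg a b t)); apply: cf; exact: cD.
Qed.

Lemma sint_mid a b : D a -> D b ->
  sint f a b = sint f a ((a + b) / 2) + sint f ((a + b) / 2) b.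
Proof.
move=> Da Db; set m := (a + b) / 2.
have Dm : D m by rewrite /m -seg_half; apply: cD => //; rewrite invr_ge0 ler0n invf_le1 ?ler1n.
have [P dP ->] := sintP Da Db.
have dPh (k t : R) : (k = 0) \/ (k = 2^-1) -> 0 <= t <= 1 ->
    dif rc (fun s => P (k + 2^-1 * s)) t (f (seg a b (k + 2^-1 * t)) * (b - a) * rc 2^-1).
  move=> hk /andP[t0 t1]; apply: dif_reparam; apply: dP.
  by case: hk => ->; apply/andP; split; lra.
have H1 : isint (fun t => f (seg a m t) * (m - a)) (P 2^-1 - P 0).
  exists (fun s => P (0 + 2^-1 * s)); last by congr (P _ - P _); ring.
  move=> t It; suff -> : f (seg a m t) * (m - a) = f (seg a b (0 + 2^-1 * t)) * (b - a) * rc 2^-1.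
    by apply: dPh => //; left.
  have -> : seg a b (0 + 2^-1 * t) = seg a m t.
    by rewrite /seg add0r rcM rcV rc_nat /m; field.
  by rewrite rcV rc_nat /m; field.
have H2 : isint (fun t => f (seg m b t) * (b - m)) (P 1 - P 2^-1).
  exists (fun s => P (2^-1 + 2^-1 * s)); last by congr (P _ - P _); field.
  move=> t It; suff -> : f (seg m b t) * (b - m) = f (seg a b (2^-1 + 2^-1 * t)) * (b - a) * rc 2^-1.
    by apply: dPh => //; right.
  have -> : seg a b (2^-1 + 2^-1 * t) = seg m b t.
    by rewrite /seg rcD rcM rcV rc_nat /m; field.
  by rewrite rcV rc_nat /m; field.
rewrite -(isint_uniq H1 (sintP Da Dm)) -(isint_uniq H2 (sintP Dm Db)); ring.
Qed.

Lemma sint_rev a b : D a -> D b -> sint f b a = - sint f a b.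
Proof.
move=> Da Db; have [P dP ->] := sintP Da Db.
suff H : isint (fun t => f (seg b a t) * (a - b)) (- (P 1 - P 0)).
  exact: (isint_uniq (sintP Db Da) H).
exists (fun s => P (1 + -1 * s)); last first.
  have -> : 1 + -1 * 1 = 0 :> R by ring.
  have -> : 1 + -1 * 0 = 1 :> R by ring.
  by rewrite opprB.
move=> t /andP[t0 t1]; have : 0 <= 1 - t <= 1 by apply/andP; split; lra.
have -> : seg b a t = seg a b (1 - t) by rewrite /seg rcB rc1; ring.
have -> : 1 - t = 1 + -1 * t by ring.
move=> /dP /dif_reparam.
by rewrite rcN rc1 mulrN1 -mulrN opprB.
Qed.

(** [A] along the segment is a primitive of [g] times the velocity, so the difference is an integral
    of [f - g]. Goursat's lemma uses this with an affine [g], the construction of primitives with a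
    constant one. *)
Lemma sint_approx A g a b (M : R) : D a -> D b ->
  (forall t, 0 <= t <= 1 -> dif id A (seg a b t) (g (seg a b t))) ->
  (forall t, 0 <= t <= 1 -> m|f (seg a b t) - g (seg a b t)| <= M) ->
  m|sint f a b - (A b - A a)| <= M * m|b - a|.
Proof.
move=> Da Db dA bM; have -> : A b - A a = A (seg a b 1) - A (seg a b 0) by rewrite seg1 seg0.
have HA : isint (fun t => g (seg a b t) * (b - a)) (A (seg a b 1) - A (seg a b 0)).
  exists (fun t => A (seg a b t)) => // t It.
  by apply: (dif_comp (@continuous_rc R)) (dA t It) _; exact: dif_seg.
apply: (isint_bound (isintB (sintP Da Db) HA)) => t It.
by rewrite -mulrBl modulusM ler_wpM2r ?modulus_ge0// bM.
Qed.

End OnConvex.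

Lemma mean_value (F f : C R -> C R) a b (M : R) :
  (forall t, 0 <= t <= 1 -> dif id F (seg a b t) (f (seg a b t))) ->
  (forall t, 0 <= t <= 1 -> m|f (seg a b t)| <= M) ->
  m|F b - F a| <= M * m|b - a|.
Proof.
move=> dF bM; have -> : F b - F a = F (seg a b 1) - F (seg a b 0) by rewrite seg1 seg0.
apply: (@dif_bound R (fun t => F (seg a b t)) (fun t => f (seg a b t) * (b - a))) => t It.
  by apply: (dif_comp (@continuous_rc R)) (dF t It) _; exact: dif_seg.
by rewrite modulusM ler_wpM2r ?modulus_ge0// bM.
Qed.

End Segments.

(** * Goursat's lemma and primitives on discs *)

Section Goursat.
Variable R : realType.
Implicit Types (a b c z w p : C R) (f g A : C R -> C R).

Definition hol_on (D : set (C R)) f := forall z, D z -> exists l, dif id f z l.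

Lemma continuous_idC : continuous (id : C R -> C R).
Proof. by move=> z U HU. Qed.

Lemma hol_on_cont D f : hol_on D f -> cont_on D f.
Proof. by move=> hf z /hf[l]; exact: (dif_cont continuous_idC). Qed.

Section CompactConvex.
Variables (D : set (C R)) (f : C R -> C R).
Hypotheses (cD : convexC D) (kD : compact D) (hf : hol_on D f).

Let triangle := (C R * C R * C R)%type.
Let inD (t : triangle) := [/\ D t.1.1, D t.1.2 & D t.2].
Let T (t : triangle) := sint f t.1.1 t.1.2 + sint f t.1.2 t.2 + sint f t.2 t.1.1.
Let per (t : triangle) := m|t.1.1 - t.1.2| + m|t.1.2 - t.2| + m|t.2 - t.1.1|.

(** The midpoints cut the triangle into four whose inner sides cancel, so the largest of the four
    integrals is at least a quarter of the whole. Following only the first vertex is enough to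
    locate the triangles. *)
Let subtriangle (t : triangle) : inD t -> exists t',
  [/\ inD t', m|T t| <= 4 * m|T t'|, per t' = per t / 2 & m|t'.1.1 - t.1.1| <= per t].
Proof.
case: t => [[a b] c] [/= Da Db Dc].
have Dm x y : D x -> D y -> D ((x + y) / 2).
  by move=> Dx Dy; rewrite -seg_half; apply: cD => //; rewrite invr_ge0 ler0n invf_le1 ?ler1n.
have cf := hol_on_cont hf.
pose m1 := (a + b) / 2; pose m2 := (b + c) / 2; pose m3 := (c + a) / 2.
have [D1 D2 D3] : [/\ D m1, D m2 & D m3] by split; apply: Dm.
have E : T (a, b, c) = T (a, m1, m3) + T (m1, b, m2) + T (m3, m2, c) + T (m1, m2, m3).
  rewrite /T /= (sint_mid cD cf Da Db) (sint_mid cD cf Db Dc) (sint_mid cD cf Dc Da).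
  rewrite -/m1 -/m2 -/m3.
  rewrite (sint_rev cD cf D1 D3) (sint_rev cD cf D2 D3) (sint_rev cD cf D1 D2).
  by ring.
have half x y : m|(x - y) / 2| = m|x - y| / 2.
  by rewrite modulusM modulusV modulus_nat.
have P1 : per (a, m1, m3) = per (a, b, c) / 2.
  rewrite /per /= !mulrDl -!half; congr (_ + _ + _).
  - by congr modulus; rewrite /m1; field.
  - by congr modulus; rewrite /m1 /m3; field.
  - by congr modulus; rewrite /m3; field.
have P2 : per (m1, b, m2) = per (a, b, c) / 2.
  rewrite /per /= !mulrDl -!half; congr (_ + _ + _).
  - by congr modulus; rewrite /m1; field.
  - by congr modulus; rewrite /m2; field.
  - by congr modulus; rewrite /m1 /m2; field.
have P3 : per (m3, m2, c) = per (a, b, c) / 2.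
  rewrite /per /= !mulrDl -!half; congr (_ + _ + _).
  - by congr modulus; rewrite /m3 /m2; field.
  - by congr modulus; rewrite /m2; field.
  - by congr modulus; rewrite /m3; field.
have P4 : per (m1, m2, m3) = per (a, b, c) / 2.
  rewrite /per /= !mulrDl -!half [RHS]addrC addrA; congr (_ + _ + _).
  - by rewrite modulusB; congr modulus; rewrite /m1 /m2; field.
  - by rewrite modulusB; congr modulus; rewrite /m2 /m3; field.
  - by rewrite modulusB; congr modulus; rewrite /m1 /m3; field.
have bm1 : m|m1 - a| <= per (a, b, c).
  have -> : m1 - a = (b - a) / 2 by rewrite /m1; field.
  rewrite half modulusB /per /=.
  have := modulus_ge0 (a - b); have := modulus_ge0 (b - c); have := modulus_ge0 (c - a); lra.
have bm3 : m|m3 - a| <= per (a, b, c).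
  have -> : m3 - a = (c - a) / 2 by rewrite /m3; field.
  rewrite half /per /=.
  have := modulus_ge0 (a - b); have := modulus_ge0 (b - c); have := modulus_ge0 (c - a); lra.
have p0 : 0 <= per (a, b, c) by rewrite /per !addr_ge0 ?modulus_ge0.
have tri4 (x y z w : C R) : m|x + y + z + w| <= m|x| + m|y| + m|z| + m|w|.
  by do 3 (apply: le_trans (modulusD _ _) _; rewrite lerD2r).
have [H|H1] := leP m|T (a, b, c)| (4 * m|T (a, m1, m3)|).
  by exists (a, m1, m3); split => //=; rewrite subrr modulus0.
have [H|H2] := leP m|T (a, b, c)| (4 * m|T (m1, b, m2)|).
  by exists (m1, b, m2).
have [H|H3] := leP m|T (a, b, c)| (4 * m|T (m3, m2, c)|).
  by exists (m3, m2, c).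
exists (m1, m2, m3); split => //=.
have := tri4 (T (a, m1, m3)) (T (m1, b, m2)) (T (m3, m2, c)) (T (m1, m2, m3)).
rewrite -E; lra.
Qed.

(** At the limit point of the repeated subdivision [f] is affine up to a small multiple of the
    distance, and the affine part has a primitive. The n-th integral is thus small compared with the
    squared perimeter, whose factor 4^-n compensates the 4^n lost in n subdivisions. *)
Lemma goursat a b c : D a -> D b -> D c ->
  sint f a b + sint f b c + sint f c a = 0.
Proof.
move=> Da Db Dc.
have /choice [next Hnext] : forall t, exists t', inD t ->
    [/\ inD t', m|T t| <= 4 * m|T t'|, per t' = per t / 2 & m|t'.1.1 - t.1.1| <= per t].
  move=> t; have [/subtriangle[t' H]|H] := pselect (inD t); first by exists t'.
  by exists t.
pose tr n := iter n next (a, b, c).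
have trD n : inD (tr n).
  by elim: n => [|n IH] //=; have [] := Hnext _ IH.
have trT n : m|T (a, b, c)| <= 4 ^+ n * m|T (tr n)|.
  elim: n => [|n IH]; first by rewrite expr0 mul1r.
  apply: le_trans IH _; rewrite exprSr -mulrA ler_wpM2l ?exprn_ge0//.
  by have [] := Hnext _ (trD n).
pose p0 := per (a, b, c).
have trp n : per (tr n) = p0 / 2 ^+ n.
  elim: n => [|n IH]; first by rewrite expr0 divr1.
  rewrite /= -/(tr n); have [_ _ -> _] := Hnext _ (trD n).
  by rewrite IH exprSr invfM mulrA.
have p0_ge0 : 0 <= p0 by rewrite /p0 /per !addr_ge0 ?modulus_ge0.
(* Each displacement is at most the current perimeter, and perimeters halve, so the displacements
   sum like a geometric series. *)
have near_n n k : m|(tr (n + k)%N).1.1 - (tr n).1.1| <= 2 * per (tr n).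
  suff : m|(tr (n + k)%N).1.1 - (tr n).1.1| <= 2 * per (tr n) - 2 * per (tr (n + k)%N).
    have : 0 <= per (tr (n + k)%N) by rewrite trp divr_ge0// exprn_ge0.
    lra.
  elim: k => [|k IH]; first by rewrite addn0 !subrr modulus0.
  rewrite addnS; have [_ _ E H] := Hnext _ (trD (n + k)%N).
  apply: le_trans (modulus_tri (tr (n + k)%N).1.1 _ _) _.
  rewrite /= -/(tr _) E.
  apply: le_trans (lerD H IH) _; lra.
have [p [Dp clp]] := kD (F := (fun n => (tr n).1.1) @ \oo) _
   (filterS (fun n _ => let: And3 H _ _ := trD n in H) filterT).
have pn n : m|p - (tr n).1.1| <= 2 * per (tr n).
  apply/ler_addgt0Pr => e e0.
  have [|q [[k _ Hk] qp]] := clp [set (tr (n + k)%N).1.1 | k in setT] _ _ (near_complex p e0).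
    by exists n => // m /= nm; exists (m - n)%N => //; rewrite subnKC.
  apply: le_trans (modulus_tri q _ _) _; rewrite addrC lerD//; first by rewrite -Hk.
  by rewrite modulusB ltW.
have [l dl] := hf Dp.
suff : m|T (a, b, c)| <= 0.
  by move=> H; apply/eqP; rewrite -modulus_eq0 eq_le H modulus_ge0.
apply/ler_addgt0Pr => e e0; rewrite add0r.
(* The final bound is [3 * e1 * p0 ^+ 2]; the added 1 covers triangles of perimeter 0. *)
pose e1 := e / (3 * (p0 ^+ 2 + 1)).
have e10 : 0 < e1.
  by rewrite divr_gt0// mulr_gt0// ltr_wpDl// sqr_ge0.
have /nbhs_modulusP[d d0 Hd] := dif_approx dl e10.
have [n Hn] : exists n, 3 * per (tr n) < d.
  have [n Hn] : exists n : nat, 3 * p0 / d < n%:R.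
    exists (Num.truncn (3 * p0 / d)).+1; rewrite truncnS_gt//.
  exists n; rewrite trp mulrA ltr_pdivrMr ?exprn_gt0//.
  move: Hn; rewrite ltr_pdivrMr// => Hn; apply: lt_le_trans Hn _; rewrite mulrC ler_pM2l//.
  by rewrite -natrX ler_nat ltnW// ltn_expl.
have {trT} := trT n; move: (trD n) (trp n) (pn n) Hn.
case: (tr n) => [[x y] z] [/= Dx Dy Dz] pern px Hn.
move=> /le_trans; apply.
(* [g] is the affine approximation of [f] at [p], and the quadratic [A] is a primitive of it. *)
pose g w := f p + l * (w - p); pose A w := f p * w + l * (w ^+ 2 / 2 - p * w).
have dA w : dif id A w (g w).
  have Hid : dif id (id : C R -> C R) w 1 by exact: dif_iota.
  have := difD (difZ (f p) Hid) (difZ l (difB (difZ 2^-1 (difX continuous_idC 2 Hid)) (difZ p Hid))).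
  rewrite (_ : _ + _ = g w); last by rewrite /g /= expr1; field.
  by apply: dif_near; [rewrite /A mulrC; ring|apply: (@filterE _ (nbhs w)) => s; rewrite /A; ring].
have cf := hol_on_cont hf.
set q := per (x, y, z) in pern px Hn *.
have fg w : m|w - x| <= q -> m|f w - g w| <= e1 * (3 * q).
  move=> wx; have wp : m|w - p| <= 3 * q.
    apply: le_trans (modulus_tri x _ _) _; rewrite (modulusB x); lra.
  rewrite /g opprD addrA; apply: le_trans (Hd w _) _; first exact: le_lt_trans wp Hn.
  by rewrite ler_wpM2l// ltW.
have q0 : 0 <= q by rewrite /q /per !addr_ge0 ?modulus_ge0.
have fgs u v : m|u - x| <= q -> m|v - x| <= q -> forall t, 0 <= t <= 1 ->
    m|f (seg u v t) - g (seg u v t)| <= e1 * (3 * q).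
  move=> ux vx t It; apply: fg; apply: le_trans (modulus_seg _ _ _ It) _.
  by rewrite ge_max ux.
have xq : m|x - x| <= q by rewrite subrr modulus0.
have [yq zq] : m|y - x| <= q /\ m|z - x| <= q.
  rewrite /q /per /= (modulusB y x).
  have := modulus_ge0 (x - y); have := modulus_ge0 (y - z); have := modulus_ge0 (z - x).
  by split; lra.
have B1 := sint_approx cD cf Dx Dy (fun t _ => dA _) (fgs _ _ xq yq).
have B2 := sint_approx cD cf Dy Dz (fun t _ => dA _) (fgs _ _ yq zq).
have B3 := sint_approx cD cf Dz Dx (fun t _ => dA _) (fgs _ _ zq xq).
have BT : m|T (x, y, z)| <= e1 * (3 * q) * q.
  have -> : T (x, y, z) = (sint f x y - (A y - A x)) + (sint f y z - (A z - A y))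
     + (sint f z x - (A x - A z)) by rewrite /T /=; ring.
  apply: le_trans (modulusD _ _) _; rewrite {2}/q /per /= 2!mulrDr; apply: lerD.
    apply: le_trans (modulusD _ _) _; rewrite (modulusB x y) (modulusB y z).
    exact: lerD.
  by rewrite (modulusB z x).
apply: (@le_trans _ _ (4 ^+ n * (e1 * (3 * q) * q))).
  by rewrite ler_wpM2l ?exprn_ge0.
have -> : 4 ^+ n * (e1 * (3 * q) * q) = 3 * e1 * p0 ^+ 2.
  rewrite pern (_ : 4 = 2 * 2)%R; last by rewrite -natrM.
  rewrite exprMn; field; by rewrite expf_neq0.
rewrite /e1 (_ : _ * _ * _ = e * (p0 ^+ 2 / (p0 ^+ 2 + 1))); last first.
  by field; rewrite gt_eqF// ltr_wpDl// sqr_ge0.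
apply: ler_piMr; first exact: ltW.
rewrite ler_pdivrMr; last by rewrite ltr_wpDl// sqr_ge0.
by rewrite mul1r lerDl.
Qed.

End CompactConvex.

Definition disc (c : C R) (r : R) : set (C R) := [set z | m|z - c| < r].

Lemma open_disc c r : open (disc c r).
Proof.
rewrite openE => z zc; apply/nbhs_modulusP; exists (r - m|z - c|).
  by rewrite subr_gt0.
move=> w wz; rewrite /disc /=.
by apply: le_lt_trans (modulus_tri z _ _) _; rewrite -ltrBrDr.
Qed.

Lemma near_disc c r z : disc c r z -> \forall w \near z, disc c r w.
Proof. by move=> zr; apply: open_nbhs_nbhs; split => //; exact: open_disc. Qed.

(** The primitive is the integral along the radius from [c]; by Goursat's lemma for the triangle c,
    z, w its increment is the integral over the segment from z to w, and continuity of [f] at z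
    gives the derivative. *)
Lemma hol_primitive (c : C R) (r : R) f : hol_on (disc c r) f ->
  exists2 F, F c = 0 & forall z, disc c r z -> dif id F z (f z).
Proof.
move=> hf; have [r0|r0] := leP r 0.
  exists (fun=> 0) => // z /= zr; have := le_lt_trans (modulus_ge0 _) (lt_le_trans zr r0).
  by rewrite ltxx.
have hk s : s < r -> hol_on [set z | m|z - c| <= s] f.
  by move=> sr z /= zs; apply: hf; exact: le_lt_trans sr.
exists (sint f c).
  have c0 : [set z | m|z - c| <= 0] c by rewrite /= subrr modulus0.
  apply/eqP; rewrite -modulus_eq0 eq_le modulus_ge0 andbT.
  apply: (isint_bound (sintP (convex_closed_disc (c:=c) (r:=0)) (hol_on_cont (hk _ r0)) c0 c0)) => t _.
  by rewrite subrr mulr0 modulus0.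
move=> z zr; pose s := (m|z - c| + r) / 2.
have [zs sr] : m|z - c| < s /\ s < r by rewrite /s; move: zr; rewrite /disc /=; split; lra.
apply: approx_dif => [x y //|e e0].
have /(cvg_modulusP (nbhs_filter z)) /(_ _ e0) /nbhs_modulusP[d d0 Hd] := hol_on_cont hf zr.
apply: filterS2 (near_disc zs) (near_complex z d0) => w ws wd.
have Dz : [set z | m|z - c| <= s] z by rewrite /= ltW.
have Dw : [set z | m|z - c| <= s] w by rewrite /= ltW.
have Dc : [set z | m|z - c| <= s] c by rewrite /= subrr modulus0 (le_trans (modulus_ge0 (z - c)))// ltW.
have cD := convex_closed_disc (c:=c) (r:=s).
have cf := hol_on_cont (hk _ sr).
have := goursat cD (@closed_disc_compact R c s) (hk _ sr) Dc Dz Dw.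
rewrite (sint_rev cD cf Dc Dw) => /eqP; rewrite subr_eq0 => /eqP <-.
rewrite (addrC (sint f c z)) addrK.
have dA x : dif id (fun w => f z * w) x (f z).
  by rewrite -[X in dif _ _ _ X]mulr1; apply: difZ; exact: dif_iota.
have := sint_approx cD cf Dz Dw (A := fun w => f z * w) (g := fun=> f z) (fun t _ => dA _).
rewrite mulrBr; apply => t It; apply/ltW/Hd.
apply: le_lt_trans (modulus_seg _ _ _ It) _.
by rewrite gt_max subrr modulus0 d0.
Qed.

End Goursat.

(** * Integrals over circles and the Cauchy transform *)

Section CircleIntegral.
Variable R : realType.
Implicit Types (a b c z w p : C R) (f g F : C R -> C R) (phi psi : R -> C R).

Definition cont01 phi := forall t : R, 0 <= t <= 1 -> {for t, continuous phi}.

Definition cint phi : C R := xget 0 [set v | isint phi v].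

Lemma cintP phi : cont01 phi -> isint phi (cint phi).
Proof.
by move=> cphi; have [v Hv] := isint_exists cphi; rewrite /cint; apply: xgetPex; exists v.
Qed.

Lemma cint_eq phi v : isint phi v -> cint phi = v.
Proof.
move=> H; apply: (isint_uniq _ H); rewrite /cint.
by apply: (@xgetPex _ 0 [set v | isint phi v]); exists v.
Qed.

Definition cis (x : R) : C R := Complex (cos x) (sin x).
Definition ii : C R := Complex 0 1.

Lemma modulus_cis x : m|cis x| = 1.
Proof. by rewrite /modulus /= cos2Dsin2 sqrtr1. Qed.

Lemma modulus_ii : m|ii| = 1.
Proof. by rewrite /modulus /= expr0n add0r expr1n sqrtr1. Qed.

Lemma dif_cis (x : R) : dif rc cis x (ii * cis x).
Proof.
have H := difD (is_derive_dif (is_derive_cos x)) (difZ ii (is_derive_dif (is_derive_sin x))).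
have E (y z : R) : rc y + ii * rc z = Complex y z.
  by complex_ring.
move: H; rewrite E (_ : ii * cis x = Complex (- sin x) (cos x)); last first.
  by complex_ring.
by apply: dif_near; [rewrite E|apply: (@filterE _ (nbhs x)) => s; rewrite E].
Qed.

Definition circ c (r t : R) : C R := c + rc r * cis (2 * pi * t).
Definition circ' (r t : R) : C R := rc (2 * pi) * ii * (rc r * cis (2 * pi * t)).

Lemma dif_circ c r t : dif rc (circ c r) t (circ' r t).
Proof.
have H : dif rc (fun s => cis (0 + 2 * pi * s)) t (ii * cis (0 + 2 * pi * t) * rc (2 * pi)).
  by apply: dif_reparam; exact: dif_cis.
have := difD (dif_cst rc c t) (difZ (rc r) H); rewrite add0r.
rewrite (_ : rc r * _ = circ' r t); last by rewrite /circ' add0r; ring.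
by apply: dif_near; [rewrite add0r|apply: (@filterE _ (nbhs t)) => s; rewrite add0r].
Qed.

Lemma continuous_circ c r : continuous (circ c r).
Proof. by move=> t; exact: (dif_cont (@continuous_rc R) (dif_circ c r t)). Qed.

Lemma circ'E c r t : circ' r t = rc (2 * pi) * ii * (circ c r t - c).
Proof. by rewrite /circ' /circ; ring. Qed.

Lemma continuous_circ' r : continuous (circ' r).
Proof.
move=> t; rewrite (_ : circ' r = fun t => rc (2 * pi) * ii * (circ 0 r t - 0)); last first.
  by apply/funext => s; exact: circ'E.
have H : {for t, continuous (fun t => rc (2 * pi) * ii * (circ 0 r t - 0))}.
  apply: continuousM; first exact: cst_continuous.
  by apply: continuousB; [exact: continuous_circ|exact: cst_continuous].
exact: H.
Qed.

Lemma modulus_circ c r t : 0 <= r -> m|circ c r t - c| = r.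
Proof.
by move=> r0; rewrite /circ addrAC subrr add0r modulusM modulus_rc modulus_cis mulr1 ger0_norm.
Qed.

Lemma modulus_circ' r t : 0 <= r -> m|circ' r t| = 2 * pi * r.
Proof.
move=> r0; rewrite (circ'E 0) !modulusM modulus_circ// modulus_ii mulr1 modulus_rc.
by rewrite ger0_norm// mulr_ge0// pi_ge0.
Qed.

Lemma circ_closed c r : circ c r 1 = circ c r 0.
Proof. by rewrite /circ mulr1 mulr0 /cis cos0 sin0 mulr_natl cos2pi sin2pi. Qed.

Lemma closed_curve_isint0 F f c r :
  (forall t, 0 <= t <= 1 -> dif id F (circ c r t) (f (circ c r t))) ->
  isint (fun t => f (circ c r t) * circ' r t) 0.
Proof.
move=> dF; exists (fun t => F (circ c r t)); last by rewrite circ_closed subrr.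
move=> t It; apply: (dif_comp (@continuous_rc R)) (dF t It) _; exact: dif_circ.
Qed.

Section CauchyTransform.
Variables (c : C R) (r : R) (phi : R -> C R).
Hypotheses (r0 : 0 < r) (cphi : cont01 phi).

(** The exponent is a parameter because differentiation in [a] raises it. The velocity [circ'] is
    meant to be part of [phi], and the constant 2 pi i is not divided out. *)
Definition transform (n : nat) (a : C R) : C R :=
  cint (fun t => phi t * (circ c r t - a)^-1 ^+ n).

Lemma circ_neq a t : disc c r a -> circ c r t - a != 0.
Proof.
rewrite /disc /= => ar; apply/eqP => H; move: ar.
have -> : a = circ c r t by apply/esym/eqP; rewrite -subr_eq0 H.
by rewrite modulus_circ ?ltxx// ltW.
Qed.

Lemma transformP n a : disc c r a ->
  isint (fun t => phi t * (circ c r t - a)^-1 ^+ n) (transform n a).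
Proof.
move=> ar; apply: cintP => t It; apply: continuousM; first exact: cphi.
elim: n => [|n IH].
  rewrite (_ : (fun t => _) = fun=> 1); first exact: cst_continuous.
  by apply/funext => s; rewrite expr0.
rewrite (_ : (fun t => _) = fun t => (circ c r t - a)^-1 * (circ c r t - a)^-1 ^+ n); last first.
  by apply/funext => s; rewrite exprS.
apply: continuousM; last exact: IH.
apply: continuousV; first exact: circ_neq.
by apply: continuousB; [exact: continuous_circ|exact: cst_continuous].
Qed.

(** To be read with u = 1 / (z - b), v = 1 / (z - a) and h = b - a: a first-order expansion of the
    kernel with a quadratic remainder uniform in z, which permits differentiation under the
    integral. *)
Let power_approx (K : R) n : exists2 B : R, 0 <= B & forall u v h : C R,
  m|u| <= K -> m|v| <= K -> u - v = h * v * u ->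
  m|u ^+ n - v ^+ n - n%:R * v ^+ n.+1 * h| <= B * m|h| ^+ 2.
Proof.
have [K0|K0] := ltP K 0.
  by exists 0 => // u v h uK; have := le_lt_trans uK K0; rewrite ltNge modulus_ge0.
elim: n => [|n [B B0 IH]].
  by exists 0 => // u v h _ _ _; rewrite !expr0 subrr !mul0r subrr modulus0.
exists (K * B + K ^+ n * K ^+ 3 + n%:R * K ^+ n.+1 * K ^+ 2).
  by rewrite !addr_ge0 ?mulr_ge0 ?exprn_ge0.
move=> u v h uK vK uv.
have -> : u ^+ n.+1 - v ^+ n.+1 - n.+1%:R * v ^+ n.+2 * h =
   u * (u ^+ n - v ^+ n - n%:R * v ^+ n.+1 * h) + v ^+ n * (u - v - v ^+ 2 * h)
   + n%:R * v ^+ n.+1 * h * (u - v).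
  by rewrite !exprS -natr1; ring.
have -> : u - v - v ^+ 2 * h = h ^+ 2 * (v * v * u).
  rewrite {1}uv; transitivity (h * v * (u - v)); first by ring.
  by rewrite uv; ring.
rewrite uv !mulrDl.
have vnK k : m|v| ^+ k <= K ^+ k by rewrite lerXn2r ?nnegrE ?modulus_ge0.
apply: le_trans (modulusD _ _) (lerD (le_trans (modulusD _ _) (lerD _ _)) _).
- rewrite modulusM -(mulrA K); apply: ler_pM; rewrite ?modulus_ge0//; exact: IH.
- rewrite !modulusM !modulusX (mulrC (m|h| ^+ 2)) mulrA ler_wpM2r ?sqr_ge0//.
  apply: ler_pM; rewrite ?mulr_ge0 ?exprn_ge0 ?modulus_ge0//.
  by rewrite !exprS expr0 mulr1 mulrA !ler_pM ?mulr_ge0 ?modulus_ge0.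
- rewrite !modulusM modulusX modulus_nat.
  have -> : n%:R * m|v| ^+ n.+1 * m|h| * (m|h| * m|v| * m|u|) =
    n%:R * (m|v| ^+ n.+1 * (m|v| * m|u|)) * m|h| ^+ 2 by ring.
  rewrite ler_wpM2r ?sqr_ge0// -mulrA ler_wpM2l//.
  apply: ler_pM; rewrite ?mulr_ge0 ?exprn_ge0 ?modulus_ge0//.
  by rewrite expr2 ler_pM ?modulus_ge0.
Qed.

Lemma dif_transform n a : disc c r a ->
  dif id (transform n) a (n%:R * transform n.+1 a).
Proof.
(* [d] is half the distance from [a] to the circle, so every point within [d] of [a] stays at
   distance at least [d] from the circle and the kernels are bounded by [d^-1]. *)
move=> ar; pose d := (r - m|a - c|) / 2.
have d0 : 0 < d by rewrite divr_gt0// subr_gt0.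
have [B B0 HB] := power_approx d^-1 n.
have [M HM] : exists M : R, forall t, 0 <= t <= 1 -> m|phi t| <= M.
  have [//|t0 t01 H] := @EVT_max R (fun t => m|phi t|) 0 1 ler01.
    apply: continuous_in_subspaceT => t; rewrite inE /= in_itv /= => It.
    by apply: (continuous_comp (cphi It)); exact: continuous_modulus.
  by exists m|phi t0| => t It; apply: H; rewrite in_itv.
have M0 : 0 <= M by apply: le_trans (HM 0 _); rewrite ?modulus_ge0// lexx ler01.
apply: approx_dif => // e e0.
have [eta eta0 Heta] : exists2 eta : R, 0 < eta & M * B * eta <= e.
  exists (e / (M * B + 1)); first by rewrite divr_gt0// ltr_wpDl// mulr_ge0.
  by rewrite mulrA ler_pdivrMr ?ltr_wpDl ?mulr_ge0// mulrC ler_pM2l// lerDl.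
have br : \forall b \near a, disc c r b by exact: near_disc.
apply: filterS3 br (near_complex a d0) (near_complex a eta0) => b br bd be.
have H := isintB (isintB (transformP n br) (transformP n ar))
   (isintZ (n%:R * (b - a)) (transformP n.+1 ar)).
rewrite (_ : _ - _ - _ = transform n b - transform n a - n%:R * (b - a) * transform n.+1 a); last by ring.
apply: (isint_bound H) => t It; set u := (circ c r t - b)^-1; set v := (circ c r t - a)^-1.
have -> : phi t * u ^+ n - phi t * v ^+ n - n%:R * (b - a) * (phi t * v ^+ n.+1) =
   phi t * (u ^+ n - v ^+ n - n%:R * v ^+ n.+1 * (b - a)) by ring.
have dz x : m|x - a| < d -> d <= m|circ c r t - x|.
  move=> xa; have := modulus_tri x (circ c r t) c; have := modulus_tri a x c.
  rewrite modulus_circ ?(ltW r0)// => H1 H2; have : 2 * d = r - m|a - c| by rewrite /d; field.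
  move: (xa) H1 H2; clear; lra.
have uK x : m|x - a| < d -> m|(circ c r t - x)^-1| <= d^-1.
  by move=> /dz H'; rewrite modulusV lef_pV2 ?posrE// (lt_le_trans d0).
have vK : m|v| <= d^-1 by apply: uK; rewrite subrr modulus0.
rewrite modulusM; apply: le_trans (ler_pM (modulus_ge0 _) (modulus_ge0 _) (HM _ It) (HB u v (b - a) (uK _ bd) vK _)) _.
  by rewrite /u /v; field; rewrite !circ_neq.
rewrite mulrA expr2 mulrA ler_wpM2r ?modulus_ge0//.
apply: le_trans Heta; rewrite ler_wpM2l ?mulr_ge0// ltW//.
Qed.

End CauchyTransform.

(** The derivative in [a] is the integral of (z - a)^-2, which has a primitive along the closed
    circle and so vanishes. Hence the value is that at the centre, where the integrand is
    constant. *)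
Lemma winding_number c r a : 0 < r -> disc c r a ->
  transform c r (circ' r) 1 a = rc (2 * pi) * ii.
Proof.
move=> r0 ar; have cc : cont01 (circ' r) by move=> t _; exact: continuous_circ'.
have c0 : disc c r c by rewrite /disc /= subrr modulus0.
have -> : transform c r (circ' r) 1 a = transform c r (circ' r) 1 c.
  apply/eqP; rewrite -subr_eq0 -modulus_eq0 eq_le modulus_ge0 andbT -(mul0r m|a - c|).
  apply: (@mean_value _ _ (fun b => 1%:R * transform c r (circ' r) 2 b)) => t It.
    by apply: dif_transform => //; exact: convex_disc.
  have sr : disc c r (seg c a t) by exact: convex_disc.
  rewrite mul1r (_ : transform _ _ _ _ _ = 0) ?modulus0//.
  apply: cint_eq; apply: eq_isint (closed_curve_isint0 (F := fun z => - (z - seg c a t)^-1)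
      (f := fun z => (z - seg c a t)^-1 ^+ 2) (c := c) (r := r) _) => [s _|s _].
    by rewrite mulrC.
  have nz := circ_neq r0 s sr.
  have H1 : dif id (fun z => z - seg c a t) (circ c r s) (1 - 0).
    by apply: difB; [exact: dif_iota|exact: dif_cst].
  have H := difN (@difV R _ id (@continuous_idC R) (fun z => z - seg c a t) _ _ nz H1).
  by move: H; rewrite subr0 mulNr opprK mul1r exprVn.
apply: cint_eq; exists (fun t => rc (2 * pi) * ii * rc t); last by rewrite rc0 rc1; ring.
move=> t _; rewrite (_ : circ' r t * _ = rc (2 * pi) * ii * 1).
  by apply: difZ; exact: dif_iota.
by rewrite (circ'E c) expr1 -mulrA divff// circ_neq.
Qed.

(** Only [z] is confined to the disc: [f] is continuous at its points as a function on the plane, so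
    the covering argument also handles nearby points [w] outside. *)
Lemma uniformly_continuous_disc c r f (e : R) : 0 < e ->
  (forall z, m|z - c| <= r -> {for z, continuous f}) ->
  exists2 d : R, 0 < d & forall z w, m|z - c| <= r -> m|w - z| < d -> m|f w - f z| < e.
Proof.
move=> e0 cf.
pose P (d : R) z := forall w, m|w - z| < d -> m|f w - f z| < e.
have H : \forall d \near (0 : R)^'+, [set z | m|z - c| <= r] `<=` P d.
  apply: ((compact_near_coveringP _).1 (@closed_disc_compact R c r)) => x xr.
  have e20 : 0 < e / 2 by rewrite divr_gt0.
  have /(cvg_modulusP (nbhs_filter x)) /(_ _ e20) /nbhs_modulusP[d d0 Hd] := cf x xr.
  have d20 : 0 < d / 2 by rewrite divr_gt0.
  exists ([set z | m|z - x| < d / 2], [set s | s < d / 2]) => /=.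
    by split; [exact: near_complex|exact: nbhs_right_lt].
  move=> [z s] /= [zx sd] w wz.
  apply: le_lt_trans (modulus_tri (f x) _ _) _; rewrite (splitr e) ltrD//.
    apply: Hd; apply: le_lt_trans (modulus_tri z _ _) _.
    by rewrite (splitr d) ltrD// (lt_trans wz).
  by rewrite modulusB; apply: Hd; rewrite (lt_trans zx)// ltr_pdivrMr// ltr_pMr// ltr1n.
have [d [d0 Hd]] := filter_ex (filterI (nbhs_right_gt (0 : R)) H).
by exists d => // z w zr wz; exact: Hd zr _ wz.
Qed.

End CircleIntegral.

(** * Cauchy's formula and estimates for derivatives *)

Section CauchyFormula.
Variable R : realType.
Local Notation ii := (@ii R).
Local Notation circ' := (@circ' R).
Implicit Types (a b c z w p : C R) (f g F : C R -> C R).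

Lemma seg_seg a z (s t : R) : seg a z t - seg a z s = rc (t - s) * (z - a).
Proof. by rewrite /seg rcB; ring. Qed.

Lemma modulus_seg_le a b (t : R) : 0 <= t <= 1 -> m|seg a b t - a| <= m|b - a|.
Proof.
move=> It; apply: le_trans (modulus_seg _ _ _ It) _.
by rewrite subrr modulus0 ge_max lexx modulus_ge0.
Qed.

Lemma linear_approx_uniform c (r : R) F f (e : R) : 0 < e ->
  (forall z, m|z - c| <= r -> dif id F z (f z)) ->
  (forall z, m|z - c| <= r -> {for z, continuous f}) ->
  exists2 d : R, 0 < d & forall z w, m|z - c| <= r -> m|w - c| <= r ->
    m|w - z| < d -> m|F w - F z - f z * (w - z)| <= e * m|w - z|.
Proof.
move=> e0 dF cf; have [d d0 Hd] := uniformly_continuous_disc e0 cf.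
exists d => // z w zr wr wz.
have -> : F w - F z - f z * (w - z) = (F w - f z * w) - (F z - f z * z) by ring.
apply: (@mean_value _ (fun s => F s - f z * s) (fun s => f s - f z)) => t It.
  apply: difB; first by apply: dF; exact: convex_closed_disc.
  rewrite -[X in dif _ _ _ X]mulr1; apply: difZ; exact: dif_iota.
apply/ltW/Hd => //; exact: le_lt_trans (modulus_seg_le _ _ It) wz.
Qed.

(** The circle is contracted to [a]: [Phi l] replaces F(z) by its value at a + l (z - a). At l = 1
    its integral is the transform, at l = 0 it is F(a) times the winding integral, and in between it
    does not change. Continuity of the derivative [f] makes the increments uniformly small. *)
Lemma cauchy_formula c (r : R) F f a : 0 < r ->
  (forall z, m|z - c| <= r -> dif id F z (f z)) ->
  (forall z, m|z - c| <= r -> {for z, continuous f}) -> disc c r a ->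
  transform c r (fun t => F (circ c r t) * circ' r t) 1 a = rc (2 * pi) * ii * F a.
Proof.
move=> r0 dF cf ar; have r0' := ltW r0.
have Ka : m|a - c| <= r by apply: ltW.
have Kz t : m|circ c r t - c| <= r by rewrite modulus_circ.
have Ks l t : 0 <= l <= 1 -> m|seg a (circ c r t) l - c| <= r.
  by move=> Il; exact: (convex_closed_disc Ka (Kz t) Il).
have nz t : circ c r t - a != 0 by exact: circ_neq.
pose Phi l t := F (seg a (circ c r t) l) * circ' r t * (circ c r t - a)^-1.
have cseg l t : {for t, continuous (fun t => seg a (circ c r t) l)}.
  apply: continuousD; first exact: cst_continuous.
  apply: continuousM; first exact: cst_continuous.
  by apply: continuousB; [exact: continuous_circ|exact: cst_continuous].
have IP l : 0 <= l <= 1 -> isint (Phi l) (cint (Phi l)).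
  move=> Il; apply: cintP => t It; apply: continuousM.
    apply: continuousM; last exact: continuous_circ'.
    apply: (continuous_comp (cseg l t)).
    exact: (dif_cont (@continuous_idC R) (dF _ (Ks _ t Il))).
  apply: continuousV; first exact: nz.
  by apply: continuousB; [exact: continuous_circ|exact: cst_continuous].
(* The derivative of [Phi] in [l] is f(a + l (z - a)) times the velocity. It has a primitive in z,
   namely F(a + l (z - a)) / l, or a linear function when l = 0, so it integrates to 0. *)
have zero l m : 0 <= l <= 1 ->
    isint (fun t => rc m * (f (seg a (circ c r t) l) * circ' r t)) 0.
  move=> Il; rewrite -(mulr0 (rc m)); apply: isintZ.
  apply: (closed_curve_isint0 (f := fun z => f (seg a z l))
    (F := fun z => if l == 0 then f a * z else rc l^-1 * F (seg a z l))) => t It.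
  case: eqP => [->|/eqP l0].
    rewrite /seg rc0 mul0r addr0 -[X in dif _ _ _ X]mulr1.
    by apply: difZ; exact: dif_iota.
  have H : dif id (fun z => seg a z l) (circ c r t) (0 + rc l * (1 - 0)).
    apply: difD; first exact: dif_cst.
    by apply: difZ; apply: difB; [exact: dif_iota|exact: dif_cst].
  have := difZ (rc l^-1) (dif_comp (@continuous_idC R) (f := fun z => seg a z l) (dF _ (Ks _ t Il)) H).
  rewrite add0r subr0 mulr1 (_ : rc l^-1 * _ = f (seg a (circ c r t) l)) //.
  by rewrite rcV mulrCA mulVf ?mulr1// rc_eq0.
have p0 : 0 <= 2 * pi * r by rewrite !mulr_ge0// pi_ge0.
suff small (e : R) : 0 < e -> m|cint (Phi 1) - cint (Phi 0)| <= e.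
  have E : cint (Phi 1) = cint (Phi 0).
    apply/eqP; rewrite -subr_eq0 -modulus_eq0 eq_le modulus_ge0 andbT.
    by apply/ler_addgt0Pr => e e0; rewrite add0r; exact: small.
  have -> : transform c r (fun t => F (circ c r t) * circ' r t) 1 a = cint (Phi 1).
    by congr cint; apply/funext => t; rewrite /Phi seg1 expr1.
  rewrite E mulrC -(winding_number r0 ar) /transform; apply: cint_eq.
  apply: (@eq_isint _ (fun t => F a * (circ' r t * (circ c r t - a)^-1 ^+ 1))).
    by move=> t _; rewrite /Phi seg0 expr1 mulrA.
  by apply: isintZ; apply: transformP => // t _; exact: continuous_circ'.
move=> e0; pose e1 := e / (2 * pi * r + 1).
have e10 : 0 < e1 by rewrite divr_gt0// ltr_wpDl.
have [d d0 Hd] := linear_approx_uniform e10 dF cf.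
(* By [zero] the linear term in [m - l] integrates to 0 and only the remainder of [F] is left; the
   factor z - a in w' - w cancels the kernel. *)
have step l m : 0 <= l <= 1 -> 0 <= m <= 1 -> `|m - l| * (2 * r) < d ->
    m|cint (Phi m) - cint (Phi l)| <= `|m - l| * e.
  move=> Il Im lm; have := isintB (isintB (IP _ Im) (IP _ Il)) (zero l (m - l) Il).
  rewrite subr0 => H; apply: (isint_bound H) => t It.
  set z := circ c r t; set w := seg a z l; set w' := seg a z m.
  have ww : w' - w = rc (m - l) * (z - a) by exact: seg_seg.
  have -> : Phi m t - Phi l t - rc (m - l) * (f w * circ' r t) =
     (F w' - F w - f w * (w' - w)) * (z - a)^-1 * circ' r t.
    by rewrite ww /Phi -/z -/w -/w'; field; exact: nz.
  have za : m|z - a| <= 2 * r.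
    apply: le_trans (modulus_tri c _ _) _; rewrite modulus_circ// (modulusB c) mulr_natl mulr2n.
    by rewrite lerD2l.
  have wd : m|w' - w| < d.
    rewrite ww modulusM modulus_rc; apply: le_lt_trans lm.
    by rewrite ler_wpM2l.
  rewrite modulusM modulus_circ'// modulusM modulusV.
  have := Hd w w' (Ks _ t Il) (Ks _ t Im) wd.
  rewrite {2}ww modulusM modulus_rc => Hb.
  have za0 : 0 < m|z - a| by rewrite modulus_gt0; exact: nz.
  apply: (@le_trans _ _ (e1 * (`|m - l| * m|z - a|) / m|z - a| * (2 * pi * r))).
    by rewrite ler_wpM2r// ler_wpM2r// invr_ge0 ltW.
  have -> : e1 * (`|m - l| * m|z - a|) / m|z - a| * (2 * pi * r) =
    `|m - l| * (e1 * (2 * pi * r)) by field; rewrite gt_eqF.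
  rewrite ler_wpM2l// /e1 mulrAC ler_pdivrMr ?ltr_wpDl// ler_pM2l//.
  by rewrite lerDl.
have [N HN] : exists N : nat, 2 * r / d < N.+1%:R.
  by exists (Num.truncn (2 * r / d)); rewrite truncnS_gt.
have N0 : 0 < N.+1%:R :> R by [].
have tel k : (k <= N.+1)%N ->
    m|cint (Phi (k%:R / N.+1%:R)) - cint (Phi 0)| <= k%:R / N.+1%:R * e.
  elim: k => [_|k IH kN]; first by rewrite !mul0r subrr modulus0.
  apply: le_trans (modulus_tri (cint (Phi (k%:R / N.+1%:R))) _ _) _.
  have E : k.+1%:R / N.+1%:R - k%:R / N.+1%:R = N.+1%:R^-1 :> R.
    by rewrite -mulrBl -natrB// subSnn mul1r.
  have E' : k.+1%:R / N.+1%:R * e = `|k.+1%:R / N.+1%:R - k%:R / N.+1%:R| * e + k%:R / N.+1%:R * e.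
    rewrite E ger0_norm ?invr_ge0// -mulrDl -(addrC (k%:R / _)); congr (_ * e).
    by rewrite -E; ring.
  rewrite E'; apply: lerD; last by apply: IH; exact: ltnW.
  apply: step.
  - by rewrite divr_ge0// ler_pdivrMr// mul1r ler_nat ltnW.
  - by rewrite divr_ge0// ler_pdivrMr// mul1r ler_nat.
  - by rewrite E ger0_norm ?invr_ge0// ltr_pdivrMl// -ltr_pdivrMr.
have := tel N.+1 (leqnn _); rewrite divff ?mul1r//.
Qed.

Definition cder f z : C R := xget 0 [set l | dif id f z l].

Lemma cderP f z : (exists l, dif id f z l) -> dif id f z (cder f z).
Proof. by move=> [l Hl]; apply: (@xgetPex _ 0 [set l | dif id f z l]); exists l. Qed.

Lemma cder_eq f z l : dif id f z l -> cder f z = l.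
Proof. by move=> H; apply: (dif_uniq _ H); apply: cderP; exists l. Qed.

Lemma hol_cder_dif c (r : R) f z : hol_on (disc c r) f -> disc c r z -> dif id f z (cder f z).
Proof. by move=> hf zr; apply: cderP; exact: hf. Qed.

Let twopii : rc (2 * pi) * ii != 0.
Proof.
apply: mulf_neq0; first by rewrite rc_eq0 gt_eqF// mulr_gt0// pi_gt0.
by rewrite -modulus_gt0 modulus_ii.
Qed.

(* The primitive of f is represented by Cauchy's formula; two derivatives of the kernel recover f'. *)
Let repr c (r0 : R) f r : hol_on (disc c r0) f -> 0 < r -> r < r0 ->
  exists2 phi : R -> C R, cont01 phi & [/\
    (forall a, disc c r a -> f a = (rc (2 * pi) * ii)^-1 * transform c r phi 2 a),
    (forall a, disc c r a -> dif id f a ((rc (2 * pi) * ii)^-1 * (2 * transform c r phi 3 a))) &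
    forall M : R, (forall z, disc c r0 z -> m|f z| <= M) ->
       forall t, 0 <= t <= 1 -> m|phi t| <= M * r * (2 * pi * r)].
Proof.
move=> hf rp rr; have [F Fc dF] := hol_primitive hf.
have Kr z : m|z - c| <= r -> disc c r0 z by move=> zr; exact: le_lt_trans rr.
have dF' z : m|z - c| <= r -> dif id F z (f z) by move=> /Kr; exact: dF.
have cf z : m|z - c| <= r -> {for z, continuous f}.
  by move=> /Kr; exact: (hol_on_cont hf).
pose phi t := F (circ c r t) * circ' r t.
have cphi : cont01 phi.
  move=> t It; apply: continuousM; last exact: continuous_circ'.
  apply: (continuous_comp (continuous_circ (R:=R) (c:=c) (r:=r) (x:=t))).
  by apply: (dif_cont (@continuous_idC R) (dF' _ _)); rewrite modulus_circ// ltW.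
have EF a : disc c r a -> F a = (rc (2 * pi) * ii)^-1 * transform c r phi 1 a.
  by move=> ar; rewrite (cauchy_formula rp dF' cf ar) mulKf ?twopii.
have Ef a : disc c r a -> f a = (rc (2 * pi) * ii)^-1 * transform c r phi 2 a.
  move=> ar; apply: (@dif_uniq _ F a); first by apply: dF'; exact: ltW.
  have H := difZ (rc (2 * pi) * ii)^-1 (dif_transform rp cphi 1 ar).
  move: H; rewrite mul1r; apply: dif_near; first by rewrite EF.
  by apply: filterS (near_disc ar) => s sr; rewrite EF.
exists phi => //; split => // [a ar|M fM t It].
  have H := difZ (rc (2 * pi) * ii)^-1 (dif_transform rp cphi 2 ar).
  move: H; apply: dif_near; first by rewrite Ef.
  by apply: filterS (near_disc ar) => s sr; rewrite Ef.
rewrite modulusM modulus_circ'; last exact: ltW.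
apply: ler_wpM2r; first by rewrite !mulr_ge0// ?pi_ge0// ltW.
(* Since [F c = 0], the mean value inequality along a radius bounds [F] by [M * r] on the circle. *)
rewrite -[F _]subr0 -Fc -{2}(modulus_circ c t (ltW rp)).
have c0 : m|c - c| <= r by rewrite subrr modulus0 ltW.
have zr : m|circ c r t - c| <= r by rewrite modulus_circ// ltW.
apply: (@mean_value _ _ f) => s Is.
  by apply: dF'; exact: convex_closed_disc.
by apply: fM; apply: Kr; exact: convex_closed_disc.
Qed.

Lemma hol_cder c (r : R) f : hol_on (disc c r) f -> hol_on (disc c r) (cder f).
Proof.
move=> hf z zr; pose s := (m|z - c| + r) / 2.
have [zs sr] : m|z - c| < s /\ s < r by rewrite /s; move: zr; rewrite /disc /=; split; lra.
have s0 : 0 < s := le_lt_trans (modulus_ge0 _) zs.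
have [phi cphi [_ H _]] := repr hf s0 sr.
have := difZ (rc (2 * pi) * ii)^-1 (difZ 2 (dif_transform s0 cphi 3 zs)).
move=> H'; eexists; move: H'; apply: dif_near; first by rewrite (cder_eq (H z zs)).
by apply: filterS (near_disc zs) => w ws; rewrite (cder_eq (H w ws)).
Qed.

(** On the circle of radius s = r / 2, [phi] is at most 2 pi M s^2 and the kernel is s^-3; with the
    factor 2 / (2 pi) this gives 2 M / s = 4 M / r. The constant 4 instead of 1 is the price of
    passing through a primitive. *)
Lemma cauchy_estimate c (r M : R) f : 0 < r -> hol_on (disc c r) f ->
  (forall z, disc c r z -> m|f z| <= M) -> m|cder f c| <= 4 * M / r.
Proof.
move=> r0 hf fM; have s0 : 0 < r / 2 by rewrite divr_gt0.
have sr : r / 2 < r by rewrite ltr_pdivrMr// ltr_pMr// ltr1n.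
have [phi cphi [_ H /(_ M fM) bphi]] := repr hf s0 sr.
have c0 : disc c (r / 2) c by rewrite /disc /= subrr modulus0.
rewrite (cder_eq (H c c0)) !modulusM modulusV modulusM modulus_ii modulus_rc modulus_nat mulr1.
have p0 : 0 < 2 * pi :> R by rewrite mulr_gt0// pi_gt0.
rewrite ger0_norm; last exact: ltW.
rewrite ler_pdivrMl//.
set s := r / 2 in s0 sr c0 bphi *.
have := isint_bound (M := M * s * (2 * pi * s) * s^-1 ^+ 3) (transformP s0 cphi 3 c0).
have -> : (2 * pi) * (4 * M / r) = 2 * (M * s * (2 * pi * s) * s^-1 ^+ 3).
  by rewrite /s; field; rewrite gt_eqF.
move=> Hb; rewrite ler_wpM2l//; apply: Hb => t It.
rewrite modulusM modulusX modulusV modulus_circ; last exact: ltW.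
by apply: ler_wpM2r; [rewrite exprn_ge0// invr_ge0 ltW|exact: bphi].
Qed.

End CauchyFormula.

(** * Liouville's theorem for polynomial growth *)

Section Liouville.
Variable R : realType.
Implicit Types (z w : C R) (f : C R -> C R).

Lemma hol_const f (D : set (C R)) : convexC D -> (forall z, D z -> dif id f z 0) ->
  forall z w, D z -> D w -> f z = f w.
Proof.
move=> cD df z w Dz Dw; apply/eqP; rewrite -subr_eq0 -modulus_eq0 eq_le modulus_ge0 andbT.
rewrite -(mul0r m|z - w|); apply: (@mean_value _ _ (fun=> 0)) => t It.
  by apply: df; exact: cD.
by rewrite modulus0.
Qed.

Lemma dif_horner (p : {poly C R}) z : dif id (horner p) z p^`().[z].
Proof.
elim/poly_ind: p => [|p a IH].
  rewrite deriv0 horner0; apply: (dif_near _ _ (dif_cst id 0 z)); first by rewrite horner0.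
  by apply: (@filterE _ (nbhs z)) => s; rewrite horner0.
have H := difD (difM (@continuous_idC R) IH (dif_iota id z)) (dif_cst id a z).
rewrite derivD derivM derivX derivC !hornerE; move: H.
rewrite (_ : _ + 0 = p^`().[z] * z + p.[z]); last by rewrite addr0 mulr1.
apply: dif_near; first by rewrite !hornerE.
by apply: (@filterE _ (nbhs z)) => s; rewrite !hornerE.
Qed.

Lemma poly_primitive (p : {poly C R}) : exists P : {poly C R}, P^`() = p.
Proof.
exists (\poly_(i < (size p).+1) (p`_i.-1 / i%:R)).
apply/polyP => i; rewrite coef_deriv coef_poly ltnS.
have [ip|ip] := ltnP i (size p); last by rewrite mul0rn nth_default.
by rewrite /= -[LHS]mulr_natr mulfVK// pnatr_eq0.
Qed.

(** Cauchy's estimate lowers the exponent by one on passing to the derivative, down to the bounded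
    case. The bound is asked only for arbitrarily large radii, which is what the negation of
    [transcendental_growth] provides. *)
Lemma polynomial_growth (N : nat) f (K : R) : (forall z, exists l, dif id f z l) ->
  (forall r0 : R, exists2 r : R, r0 < r & forall z, m|z| <= r -> m|f z| <= K * r ^+ N) ->
  exists p : {poly C R}, forall z, f z = p.[z].
Proof.
elim: N f K => [|N IH] f K hf H.
  have df0 z : dif id f z 0.
    suff <- : cder f z = 0 by exact: cderP.
    apply/eqP; rewrite -modulus_eq0 eq_le modulus_ge0 andbT.
    apply/ler_addgt0Pr => e e0; rewrite add0r.
    have [r rz Hr] := H (m|z| + (4 * `|K| / e)).
    have r' : 0 <= 4 * `|K| / e by rewrite divr_ge0 ?mulr_ge0// ltW.
    have d0 : 0 < r - m|z| by rewrite subr_gt0 (le_lt_trans _ rz)// lerDl.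
    apply: le_trans (cauchy_estimate (M := `|K|) d0 (fun z _ => hf z) _) _.
      move=> w; rewrite /disc /= => wz; apply: le_trans (Hr w _) _.
        by rewrite -(subrK z w) (le_trans (modulusD _ _))// -lerBrDr ltW.
      by rewrite expr0 mulr1 ler_norm.
    by rewrite ler_pdivrMr// -ler_pdivrMl// lerBrDl [e^-1 * _]mulrC ltW.
  exists (f 0)%:P => z; rewrite hornerC.
  exact: (@hol_const f setT).
(* On the disc of radius r / 2 the estimate gives 4 K r^(N+1) / (r / 2) = 8 K r^N, which is 8 K 2^N
   times the N-th power of r / 2. *)
have [||p Hp] := IH (cder f) (8 * K * 2 ^+ N).
- by move=> z; apply: (@hol_cder _ z 1 f) => //; rewrite /disc /= subrr modulus0.
- move=> r0; have [r rr Hr] := H (2 * Num.max r0 0).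
  have r00 : 0 < r by apply: le_lt_trans rr; rewrite mulr_ge0// le_max lexx orbT.
  exists (r / 2).
    by rewrite ltr_pdivlMr// mulrC; apply: le_lt_trans rr; rewrite ler_pM2l// le_max lexx.
  move=> z zr; have d0 : 0 < r / 2 by rewrite divr_gt0.
  apply: le_trans (cauchy_estimate (M := K * r ^+ N.+1) d0 (fun z _ => hf z) _) _.
    move=> w; rewrite /disc /= => wz; apply: Hr.
    rewrite -(subrK z w) (le_trans (modulusD _ _))// (splitr r) lerD// ltW//.
  by rewrite expr_div_n exprS le_eqVlt; apply/orP; left; apply/eqP; field; rewrite expf_neq0//= gt_eqF.
have [P HP] := poly_primitive p.
exists (P + (f 0 - P.[0])%:P) => z; rewrite hornerD hornerC.
apply/eqP; rewrite -subr_eq0 opprD addrA subr_eq0; apply/eqP.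
apply: (@hol_const (fun z => f z - P.[z]) setT) => // w _.
rewrite -(subrr p.[w]); apply: difB; first by rewrite -Hp; exact: cderP.
by rewrite -HP; exact: dif_horner.
Qed.

Lemma transcendental_growth f (N : nat) : transcendental_entire f ->
  exists r0 : R, forall r, r0 < r -> exists2 z, m|z| <= r & r ^+ N < m|f z|.
Proof.
move=> [ef tf]; apply: contrapT => H; apply: tf.
apply: (@polynomial_growth N f 1) => [z|r0].
  by apply: derivable_dif; exact: ef.
apply: contrapT => H'; apply: H; exists r0 => r rr.
apply: contrapT => H; apply: H'; exists r => // z zr; rewrite mul1r leNgt.
by apply/negP => Hz; apply: H; exists z.
Qed.

End Liouville.

(** * The theorems of Bloch and Schottky *)

Section ComplexExponential.
Variable R : realType.
Local Notation ii := (@ii R).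
Local Notation cis := (@cis R).
Implicit Types (z w : C R) (f : C R -> C R).

Definition cexp z : C R := rc (expR (Re z)) * cis (Im z).

Lemma cisD (x y : R) : cis (x + y) = cis x * cis y.
Proof.
rewrite /cis cosD sinD; apply/eqP; rewrite eq_complex /=.
by apply/andP; split; apply/eqP; ring.
Qed.

Lemma cis0 : cis 0 = 1. Proof. by rewrite /cis cos0 sin0. Qed.

Lemma cexpD z w : cexp (z + w) = cexp z * cexp w.
Proof. by rewrite /cexp ReD ImD expRD rcM cisD; ring. Qed.

Lemma cexp0 : cexp 0 = 1.
Proof. by rewrite /cexp /= expR0 cis0 mulr1. Qed.

Lemma modulus_cexp z : m|cexp z| = expR (Re z).
Proof. by rewrite /cexp modulusM modulus_rc modulus_cis mulr1 ger0_norm// expR_ge0. Qed.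

Lemma cexp_neq0 z : cexp z != 0.
Proof. by rewrite -modulus_gt0 modulus_cexp expR_gt0. Qed.

Lemma cexpN z : cexp (- z) = (cexp z)^-1.
Proof.
by apply: (mulfI (cexp_neq0 z)); rewrite -cexpD subrr cexp0 divff// cexp_neq0.
Qed.

Lemma cexp_re_im z : z = rc (Re z) + ii * rc (Im z).
Proof.
by case: z => a b; apply/eqP; rewrite eq_complex /=; apply/andP; split; apply/eqP; ring.
Qed.

Lemma dif_cexp z : dif id cexp z (cexp z).
Proof.
(* The addition law reduces everything to the point 0, where the slopes [g] and [k] of the real
   exponential and of [cis] are combined. *)
suff H : dif id cexp 0 1.
  have H1 : dif id (fun w => w - z) z (1 - 0) by apply: difB; [exact: dif_iota|exact: dif_cst].
  have H2 : dif id cexp (z - z) 1 by rewrite subrr.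
  have := difZ (cexp z) (dif_comp (@continuous_idC R) (f := fun w => w - z) H2 H1).
  rewrite subr0 !mulr1; apply: dif_near; first by rewrite -cexpD subrr addr0.
  by apply: (@filterE _ (nbhs z)) => s; rewrite -cexpD addrC subrK.
have [g [cg g0 Hg]] : dif rc (fun s : R => rc (expR s)) 0 1.
  by have := is_derive_dif (is_derive_expR (0 : R)); rewrite expR0.
have [k [ck k0 Hk]] : dif rc cis 0 ii by have := dif_cis (0 : R); rewrite cis0 mulr1.
apply: approx_dif => // e e0.
have cRe : {for (0 : C R), continuous (fun z : C R => g (Re z))}.
  by apply: (continuous_comp (@continuous_Re R 0)); exact: cg.
have cIm : {for (0 : C R), continuous (fun z : C R => k (Im z))}.
  by apply: (continuous_comp (@continuous_Im R 0)); exact: ck.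
have e30 : 0 < e / 3 by rewrite divr_gt0.
have /(cvg_modulusP (nbhs_filter (0 : C R))) /(_ _ e30) N1 := cRe.
have /(cvg_modulusP (nbhs_filter (0 : C R))) /(_ _ e30) N2 := cIm.
have /(cvg_modulusP (nbhs_filter (0 : C R))) N3 : {for (0 : C R), continuous (fun z : C R => g (Re z) * k (Im z) * rc (Re z))}.
  apply: continuousM; first by apply: continuousM; [exact: cRe|exact: cIm].
  by apply: (continuous_comp (@continuous_Re R 0)); exact: continuous_rc.
have {N3} N3 := N3 _ e30.
have N4 : \forall w \near (0 : C R), rc (expR (Re w)) = 1 + g (Re w) * rc (Re w).
  have : \forall s \near (0 : R), rc (expR s) = 1 + g s * rc s.
    by apply: filterS Hg => s ->; rewrite expR0 rc0 subr0 rc1.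
  by move=> /(@continuous_Re R 0).
have N5 : \forall w \near (0 : C R), cis (Im w) = 1 + k (Im w) * rc (Im w).
  have : \forall s \near (0 : R), cis s = 1 + k s * rc s.
    by apply: filterS Hk => s ->; rewrite cis0 rc0 subr0.
  by move=> /(@continuous_Im R 0).
have N12 : \forall w \near (0 : C R), m|g (Re w) - g (Re (0 : C R))| < e / 3 /\
    m|k (Im w) - k (Im (0 : C R))| < e / 3 by apply: filterS2 N1 N2 => w.
have N45 : \forall w \near (0 : C R), rc (expR (Re w)) = 1 + g (Re w) * rc (Re w) /\
    cis (Im w) = 1 + k (Im w) * rc (Im w) by apply: filterS2 N4 N5 => w.
apply: filterS3 N12 N3 N45 => w [H1 H2] H3 [H4 H5].
have -> : cexp w - cexp 0 - 1 * (w - 0) = (g (Re w) - 1) * rc (Re w) + (k (Im w) - ii) * rc (Im w)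
    + (g (Re w) * k (Im w) * rc (Re w)) * rc (Im w).
  by rewrite cexp0 {1}/cexp H4 H5 {5}(cexp_re_im w); ring.
rewrite subr0; have re := ler_Re w; have im := ler_Im w.
move: H1 H2 H3; rewrite /= g0 k0 rc0 mulr0 subr0 => H1 H2 H3.
have E3 : e * m|w| = e / 3 * m|w| + e / 3 * m|w| + e / 3 * m|w| by field.
rewrite E3; apply: le_trans (modulusD _ _) (lerD (le_trans (modulusD _ _) (lerD _ _)) _).
- by rewrite modulusM modulus_rc; apply: ler_pM; rewrite ?modulus_ge0 ?normr_ge0// ltW.
- by rewrite modulusM modulus_rc; apply: ler_pM; rewrite ?modulus_ge0 ?normr_ge0// ltW.
- by rewrite modulusM modulus_rc; apply: ler_pM; rewrite ?modulus_ge0 ?normr_ge0// ltW.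
Qed.

Lemma unit_circle_angle (x y : R) : x ^+ 2 + y ^+ 2 = 1 ->
  exists2 t : R, `|t| <= pi & Complex x y = cis t.
Proof.
move=> xy; have x1 : -1 <= x <= 1.
  rewrite -ler_norml -sqrtr_sqr -[X in _ <= X]sqrtr1 ler_wsqrtr// -xy lerDl sqr_ge0//.
have sx : sin (acos x) = `|y|.
  by rewrite sin_acos// -(sqrtr_sqr y); congr Num.sqrt; rewrite -xy; ring.
have ap : `|acos x| <= pi by rewrite ger0_norm ?acos_ge0// acos_lepi.
have [y0|y0] := leP 0 y.
  by exists (acos x) => //; rewrite /cis acosK ?in_itv//= sx ger0_norm.
exists (- acos x); first by rewrite normrN.
by rewrite /cis cosN sinN acosK ?in_itv//= sx ltr0_norm// opprK.
Qed.

(** The bound on the argument is recorded because it limits the value at the centre of the branch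
    chosen in [hol_arccosh]. *)
Lemma clog_exists w : w != 0 -> exists2 z, cexp z = w & Re z = ln m|w| /\ `|Im z| <= pi.
Proof.
move=> w0; have mw : 0 < m|w| by rewrite modulus_gt0.
have [|t tp Ht] := @unit_circle_angle (Re w / m|w|) (Im w / m|w|).
  by rewrite !expr_div_n -mulrDl -modulus_sq divff// sqrf_eq0 gt_eqF.
exists (Complex (ln m|w|) t); last by split.
rewrite /cexp /= lnK ?posrE// -Ht; case: (w) mw => a b /= mw; apply/eqP.
by rewrite eq_complex /=; apply/andP; split; apply/eqP; field; rewrite gt_eqF.
Qed.

End ComplexExponential.

(** * Holomorphic logarithms and Bloch's theorem *)

Section LogarithmsBloch.
Variable R : realType.
Local Notation ii := (@ii R).
Local Notation cis := (@cis R).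
Implicit Types (c z w : C R) (f g h : C R -> C R).

Lemma continuous_distance (K : topologicalType) (u : K -> C R) (w : C R) x :
  {for x, continuous u} -> {for x, continuous (fun x => m|u x - w|)}.
Proof.
move=> cu; apply: (@continuous_comp _ _ _ (fun x => u x - w) (@modulus R)).
  by apply: continuousB; [exact: cu|exact: cst_continuous].
exact: continuous_modulus.
Qed.

Lemma compact_min (A : set (C R)) (f : C R -> R) :
  A !=set0 -> compact A -> (forall z, A z -> {for z, continuous f}) ->
  exists2 c, A c & forall z, A z -> f c <= f z.
Proof.
move=> A0 cA cf; have [|c Ac H] := compact_max (f := fun z => - f z) A0 cA.
  by move=> z Az; apply: continuousN; exact: cf.
by exists c => // z Az; rewrite -lerN2; exact: H.
Qed.

(** [phi] is the primitive of h' / h with the prescribed value at [c]; then h exp(- phi) has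
    derivative 0 and equals 1 at [c]. *)
Lemma hol_log c (r : R) h w : 0 < r -> hol_on (disc c r) h ->
  (forall z, disc c r z -> h z != 0) -> cexp w = h c ->
  exists phi, [/\ hol_on (disc c r) phi, phi c = w &
    forall z, disc c r z -> cexp (phi z) = h z].
Proof.
move=> r0 hh h0 hw; have h'P := hol_cder_dif hh; have hh' := hol_cder hh.
have [phi0 p0 dphi0] : exists2 F, F c = 0 & forall z, disc c r z -> dif id F z (cder h z * (h z)^-1).
  apply: hol_primitive => z zr; have [l Hl] := hh' z zr.
  eexists; apply: (difM (@continuous_idC R) Hl).
  exact: (difV (@continuous_idC R) (h0 z zr) (h'P z zr)).
pose phi z := phi0 z + w.
have dphi z : disc c r z -> dif id phi z (cder h z * (h z)^-1 + 0).
  by move=> zr; apply: difD; [exact: dphi0|exact: dif_cst].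
have c0 : disc c r c by rewrite /disc /= subrr modulus0.
exists phi; split.
- by move=> z zr; eexists; exact: dphi.
- by rewrite /phi p0 add0r.
move=> z zr; pose G z := h z * cexp (- phi z).
have dG s : disc c r s -> dif id G s 0.
  move=> sr; have d1 := difN (dphi s sr).
  have d2 := dif_comp (@continuous_idC R) (f := fun z => - phi z) (dif_cexp (- phi s)) d1.
  have := difM (@continuous_idC R) (h'P s sr) d2.
  by rewrite (_ : _ + _ = 0) //; field; exact: h0.
have : G z = G c by exact: (hol_const (@convex_disc R c r) dG zr c0).
rewrite /G /phi p0 add0r !cexpN hw divff; last exact: h0.
move=> /(congr1 (fun x => x * cexp (phi0 z + w))).
by rewrite mulfVK ?cexp_neq0// mul1r => ->.
Qed.

(** At a minimum of |g - w| over the closed disc, the value must be [w]. On the boundary circle g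
    has moved by at least s |m0| / 2, too far from [w] to beat the centre; at an interior point a
    short Newton step would decrease the distance. *)
Lemma local_onto g z0 (s : R) (m0 : C R) : 0 < s -> m0 != 0 ->
  (forall z, m|z - z0| <= s -> exists l, dif id g z l /\ m|l - m0| <= m|m0| / 2) ->
  forall w, m|w - g z0| < s * m|m0| / 4 -> exists2 z, m|z - z0| <= s & g z = w.
Proof.
move=> s0 m00 dg w ww; have mm0 : 0 < m|m0| by rewrite modulus_gt0.
have z00 : m|z0 - z0| <= s by rewrite subrr modulus0 ltW.
have cg z : m|z - z0| <= s -> {for z, continuous g}.
  by move=> /dg[l [dl _]]; exact: (dif_cont (@continuous_idC R) dl).
have [||z z1 zmin] := @compact_min [set z | m|z - z0| <= s] (fun z => m|g z - w|) _ (@closed_disc_compact R z0 s).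
- by exists z0.
- by move=> z zs; apply: continuous_distance; exact: cg.
exists z => //; apply: contrapT => /eqP gzw.
have gz0 : 0 < m|g z - w| by rewrite modulus_gt0 subr_eq0.
have zlt : m|z - z0| < s.
  rewrite lt_neqAle z1 andbT; apply/eqP => zs.
  have dgd x : m|x - z0| <= s -> dif id (fun x => g x - m0 * x) x (cder g x - m0).
    move=> /dg[l [dl _]]; apply: difB; first by apply: cderP; exists l.
    by rewrite -[X in dif _ _ _ X]mulr1; apply: difZ; exact: dif_iota.
  have : m|(g z - m0 * z) - (g z0 - m0 * z0)| <= m|m0| / 2 * m|z - z0|.
    apply: (@mean_value _ (fun x => g x - m0 * x) (fun x => cder g x - m0)) => t It.
      by apply: dgd; exact: (convex_closed_disc z00 z1 It).
    have [l [dl Hl]] := dg _ (convex_closed_disc z00 z1 It).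
    by rewrite (cder_eq dl).
  rewrite zs => H1; have H2 := zmin z0 z00.
  have E : m0 * (z - z0) = (g z - w) + (w - g z0) - ((g z - m0 * z) - (g z0 - m0 * z0)) by ring.
  have : m|m0| * s <= m|g z - w| + m|w - g z0| + m|m0| / 2 * s.
    rewrite -{1}zs -modulusM E; apply: le_trans (modulusD _ _) _; rewrite modulusN.
    by apply: lerD => //; exact: modulusD.
  move: ww H2; rewrite (modulusB (g z0)) => H3 H4.
  have := mulr_gt0 mm0 s0; move: H3 H4; rewrite (mulrC s).
  have -> : m|m0| / 2 * s = (m|m0| * s) / 2 by field.
  move: (m|m0| * s) => q; clear; lra.
have [l [dl Hl]] := dg z z1.
have l0 : 0 < m|l|.
  have := modulus_tri l m0 0; rewrite !subr0 (modulusB m0); move: Hl mm0; clear; lra.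
have l20 : 0 < m|l| / 2 by rewrite divr_gt0.
have := dif_approx dl l20.
have Hin : \forall x \near z, disc z0 s x by exact: near_disc.
move=> Happ; have [d d0 Hd] := (nbhs_modulusP _ _).1 (filterI Happ Hin).
(* [eps] damps the Newton step so that it stays within the range [d] of the linear approximation;
   the step removes the fraction [eps] of g z - w and its error restores at most half of that. *)
pose eps := Num.min (1 / 2) (d * m|l| / (2 * m|g z - w|)).
have eps0 : 0 < eps by rewrite /eps lt_min; apply/andP; split; rewrite divr_gt0// mulr_gt0.
have eps1 : eps <= 1 / 2 by rewrite /eps ge_min lexx.
have eps2 : eps <= d * m|l| / (2 * m|g z - w|) by rewrite /eps ge_min lexx orbT.
have l0' : l != 0 by rewrite -modulus_gt0.
pose x := z - rc eps * (g z - w) / l.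
have xz : x - z = - (rc eps * (g z - w) / l) by rewrite /x; ring.
have mxz : m|x - z| = eps * m|g z - w| / m|l|.
  by rewrite xz modulusN !modulusM modulusV modulus_rc ger0_norm// ltW.
have xd : m|x - z| < d.
  rewrite mxz ltr_pdivrMr//; apply: (@le_lt_trans _ _ (d * m|l| / 2)).
    by rewrite -ler_pdivlMr//; apply: le_trans eps2 _; rewrite invfM mulrA.
  by rewrite ltr_pdivrMr// ltr_pMr ?mulr_gt0// ltr1n.
have [H1 H2] := Hd x xd.
have /zmin : [set z | m|z - z0| <= s] x by apply: ltW.
have E : g x - w = (g x - g z - l * (x - z)) + rc (1 - eps) * (g z - w).
  by rewrite xz rcB rc1; field.
rewrite E => H3; have := le_trans H3 (modulusD _ _).
have eps1' : 0 <= 1 - eps by move: eps1; clear; lra.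
rewrite modulusM modulus_rc (ger0_norm eps1'); move: H1; rewrite mxz.
have -> : m|l| / 2 * (eps * m|g z - w| / m|l|) = eps * m|g z - w| / 2.
  by field; rewrite gt_eqF.
have := mulr_gt0 eps0 gz0; rewrite mulrBl mul1r; clear; lra.
Qed.

(** Bloch's theorem in contrapositive form: a large derivative would force the image to contain a
    disc of radius [rho]. The point [z0] maximises |g'| times the distance to the circle of radius
    s, so |g'| is at most 2 m on a disc of radius q about [z0]; that image contains a disc of radius
    q m / 128, whence |g'(c)| r <= 4 q m <= 512 rho. *)
Lemma bloch c (r rho : R) g : 0 < r -> hol_on (disc c r) g ->
  (forall w0, exists2 w, m|w - w0| < rho & forall z, disc c r z -> g z != w) ->
  m|cder g c| <= 512 * rho / r.
Proof.
move=> r0 hg omit; pose s := r / 2.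
have s0 : 0 < s by rewrite divr_gt0.
have sr : s < r by rewrite /s ltr_pdivrMr// ltr_pMr// ltr1n.
have rho0 : 0 < rho by have [w + _] := omit 0; apply: le_lt_trans; exact: modulus_ge0.
have hg' := hol_cder hg.
have cg' z : disc c r z -> {for z, continuous (cder g)} by exact: (hol_on_cont hg').
have cr z : m|z - c| <= s -> disc c r z by move=> zs; exact: le_lt_trans sr.
have [||z0 z0s zmax] := @compact_max R [set z | m|z - c| <= s] (fun z => m|cder g z| * (s - m|z - c|)) _ (@closed_disc_compact R c s).
- by exists c; rewrite /= subrr modulus0 ltW.
- move=> z /cr zs; apply: continuousM.
    by apply: (continuous_comp (cg' _ zs)); exact: continuous_modulus.
  apply: continuousB; first exact: cst_continuous.
  by apply: continuous_distance; exact: (fun U HU => HU).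
have := zmax c; rewrite /= subrr modulus0 subr0 => /(_ (ltW s0)) Hc.
have [g'c|g'c] := eqVneq (cder g c) 0.
  rewrite g'c modulus0; apply: divr_ge0; last exact: ltW.
  by apply: mulr_ge0; [exact: ler0n|exact: ltW].
have g'c0 : 0 < m|cder g c| by rewrite modulus_gt0.
pose m : R := m|cder g z0|; have mE : m|cder g z0| = m by [].
have {}Hc : m|cder g c| * s <= m * (s - m|z0 - c|) by exact: Hc.
have {}zmax z : m|z - c| <= s -> m|cder g z| * (s - m|z - c|) <= m * (s - m|z0 - c|) by exact: zmax.
have Hpos : 0 < m * (s - m|z0 - c|) by apply: lt_le_trans Hc; rewrite mulr_gt0.
have z0lt : 0 < s - m|z0 - c|.
  by rewrite ltNge; apply/negP => H; move: Hpos; rewrite ltNge mulr_ge0_le0 ?modulus_ge0.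
have m0 : 0 < m by rewrite -(pmulr_lgt0 _ z0lt).
pose q := (s - m|z0 - c|) / 2; have q0 : 0 < q by rewrite divr_gt0.
have qE : s - m|z0 - c| = 2 * q by rewrite /q; field.
have inq z : m|z - z0| <= q -> m|z - c| <= s - q.
  by move=> zq; have := modulus_tri z0 z c; move: zq qE; clear; lra.
have inr z : m|z - z0| <= q -> disc c r z.
  by move=> /inq zs; apply: cr; apply: le_trans zs _; rewrite gerBl ltW.
have g'2 z : m|z - z0| <= q -> m|cder g z| <= 2 * m.
  move=> zq; have zs := inq z zq.
  have := zmax z (le_trans zs _); rewrite gerBl (ltW q0) => /(_ isT).
  rewrite qE => H; rewrite -(ler_pM2r q0); apply: le_trans (_ : m * (2 * q) <= _); last first.
    by rewrite mulrCA mulrA.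
  apply: le_trans H; rewrite ler_wpM2l ?modulus_ge0//; move: zs; clear; lra.
have q20 : 0 < q / 2 by rewrite divr_gt0.
have g'' z : m|z - z0| <= q / 2 -> m|cder (cder g) z| <= 16 * m / q.
  move=> zq; have -> : 16 * m / q = 4 * (2 * m) / (q / 2) by field; rewrite gt_eqF.
  have sub w : disc z (q / 2) w -> m|w - z0| <= q.
    rewrite /disc /= => wz; apply: le_trans (modulus_tri z _ _) _.
    by rewrite (splitr q) lerD// ltW.
  apply: cauchy_estimate => // w /sub wq; last exact: g'2.
  by apply: hg'; exact: inr.
(* The second derivative is at most 16 m / q, so on the disc of radius q / 32 the derivative varies
   by at most m / 2, as [local_onto] requires; 128 is then 32 times 4. *)
have p32 : 0 < q / 32 by rewrite divr_gt0.
have p32q : q / 32 <= q / 2 by rewrite ler_pM2l// lef_pV2 ?posrE// ler_nat.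
have p32q' : q / 32 <= q by move: q0; clear; lra.
have g'0 : cder g z0 != 0 by rewrite -modulus_gt0 mE.
have z00 : m|z0 - z0| <= q / 32 by rewrite subrr modulus0 ltW.
have onto := @local_onto g z0 (q / 32) (cder g z0) p32 g'0.
have {}onto : forall w, m|w - g z0| < q / 32 * m / 4 -> exists2 z, m|z - z0| <= q / 32 & g z = w.
  apply: onto => z zq; exists (cder g z); split.
    by apply: (hol_cder_dif hg); apply: inr; exact: le_trans p32q'.
  apply: le_trans (@mean_value R (cder g) (cder (cder g)) z0 z (16 * m / q) _ _) _ => [t It|t It|].
  - apply: (hol_cder_dif hg'); apply: inr.
    by apply: le_trans (convex_closed_disc z00 zq It) _.
  - apply: g''; exact: le_trans (convex_closed_disc z00 zq It) _.
  - have -> : m|cder g z0| / 2 = 16 * m / q * (q / 32) by rewrite mE; field; rewrite gt_eqF.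
    apply: ler_wpM2l; last exact: zq.
    by apply: divr_ge0; [apply: mulr_ge0; [exact: ler0n|exact: ltW]|exact: ltW].
have qm : q * m <= 128 * rho.
  rewrite leNgt; apply/negP => H; have [w wg Hw] := omit (g z0).
  have [|z zq gz] := onto w.
    by apply: lt_le_trans wg _; move: H; clear; lra.
  by move: (Hw z (inr _ (le_trans zq p32q'))); rewrite gz eqxx.
rewrite ler_pdivlMr//; have -> : r = 2 * s by rewrite /s; field.
move: Hc; rewrite qE => Hc.
have -> : m|cder g c| * (2 * s) = 2 * (m|cder g c| * s) by ring.
apply: (@le_trans _ _ (2 * (m * (2 * q)))); first by rewrite ler_pM2l.
have -> : m * (2 * q) = 2 * (q * m) by ring.
by move: qm; clear; lra.
Qed.

End LogarithmsBloch.

(** * Schottky's theorem *)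

Section SchottkyTheorem.
Variable R : realType.
Local Notation ii := (@ii R).
Local Notation cis := (@cis R).
Implicit Types (c z w : C R) (f g h : C R -> C R).

Definition ccosh z : C R := (cexp z + cexp (- z)) / 2.

Lemma modulus_ccosh z : m|ccosh z| <= expR m|z|.
Proof.
have exz (x : C R) : m|x| = m|z| -> m|cexp x| <= expR m|z|.
  by move=> <-; rewrite modulus_cexp ler_expR (le_trans (ler_norm _))// ler_Re.
rewrite /ccosh modulusM modulusV modulus_nat ler_pdivrMr//.
apply: le_trans (modulusD _ _) _; rewrite mulr_natr mulr2n lerD// exz//.
by rewrite modulusN.
Qed.

(* sqrt (f^2 - 1) is holomorphic since f omits 1 and -1, and f + sqrt (f^2 - 1) omits 0; F is a
   logarithm of it, its branch being chosen to keep F c small. *)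
Lemma hol_arccosh c (r : R) f : 0 < r -> hol_on (disc c r) f ->
  (forall z, disc c r z -> f z != 1 /\ f z != -1) ->
  exists F, [/\ hol_on (disc c r) F, m|F c| <= 2 * m|f c| + 4 &
    forall z, disc c r z -> ccosh (F z) = f z].
Proof.
move=> r0 hf f1; have fP := hol_cder_dif hf.
have c0 : disc c r c by rewrite /disc /= subrr modulus0.
pose h z := f z ^+ 2 - 1.
have hh : hol_on (disc c r) h.
  move=> z zr; eexists; apply: difB; last exact: dif_cst.
  by apply: (difX (@continuous_idC R) 2); exact: fP.
have h0 z : disc c r z -> h z != 0.
  move=> /f1[f1' f2]; rewrite /h -[1](expr1n _ 2) subr_sqr mulf_neq0//.
    by rewrite subr_eq0.
  by rewrite addr_eq0.
have [w Hw _] := clog_exists (h0 c c0).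
have [psi [hpsi _ Hpsi]] := hol_log r0 hh h0 Hw.
pose s z := cexp (2^-1 * psi z).
have s2 z : disc c r z -> s z ^+ 2 = h z.
  by move=> zr; rewrite /s expr2 -cexpD -Hpsi//; congr cexp; field.
(* [E] is exp(arccosh f): its inverse is f - s, so it has no zero and (E + 1 / E) / 2 = f. *)
pose E z := f z + s z.
have Es z : disc c r z -> E z * (f z - s z) = 1.
  move=> zr; transitivity (f z ^+ 2 - s z ^+ 2); first by rewrite /E; ring.
  by rewrite s2// /h; ring.
have hE : hol_on (disc c r) E.
  move=> z zr; have [l Hl] := hpsi z zr.
  eexists; apply: difD; first exact: fP.
  by apply: (dif_comp (@continuous_idC R) (f := fun z => 2^-1 * psi z) (dif_cexp _)); apply: difZ; exact: Hl.
have E0 z : disc c r z -> E z != 0.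
  by move=> /Es H; apply/eqP => E0; move: H; rewrite E0 mul0r => /esym/eqP; rewrite oner_eq0.
have [v Hv [vRe vIm]] := clog_exists (E0 c c0).
have [F [hF Fc HF]] := hol_log r0 hE E0 Hv.
exists F; split => //; last first.
  move=> z zr; rewrite /ccosh cexpN HF//.
  have -> : (E z)^-1 = f z - s z.
    by apply: (mulfI (E0 z zr)); rewrite divff ?E0// Es.
  by rewrite /E; field.
rewrite Fc; apply: le_trans (modulus_le _) _; rewrite vRe.
have fc0 := modulus_ge0 (f c).
have sb : m|s c| <= m|f c| + 1.
  rewrite -(ler_pXn2r (_ : 0 < 2)%N) ?nnegrE ?modulus_ge0 ?addr_ge0//.
  rewrite -modulusX s2// /h; apply: le_trans (modulusD _ _) _.
  rewrite modulusN modulus1 modulusX sqrrD expr1n mulr1.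
  by rewrite lerD2r lerDl mulrn_wge0.
(* Bounding both [E c] and its inverse controls the logarithm of |E c| from both sides; the 4 in the
   statement comes from the argument, which is at most pi. *)
have Eb : m|E c| <= 1 + 2 * m|f c|.
  by apply: le_trans (modulusD _ _) _; move: sb; clear; lra.
have Eb' : m|E c|^-1 <= 1 + 2 * m|f c|.
  rewrite -modulusV (_ : (E c)^-1 = f c - s c); last first.
    by apply: (mulfI (E0 c c0)); rewrite divff ?E0// Es.
  by apply: le_trans (modulusD _ _) _; rewrite modulusN; move: sb; clear; lra.
have E1 : 0 < m|E c| by rewrite modulus_gt0 E0.
have l1 : ln m|E c| <= 2 * m|f c|.
  apply: (@le_trans _ _ (ln (1 + 2 * m|f c|))).
    by rewrite ler_ln ?posrE// (lt_le_trans E1).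
  by apply: le_ln1Dx; rewrite (lt_le_trans (_ : -1 < 0))// ?oppr_lt0// mulr_ge0.
have l2 : - ln m|E c| <= 2 * m|f c|.
  rewrite -lnV ?posrE//; apply: (@le_trans _ _ (ln (1 + 2 * m|f c|))).
    by rewrite ler_ln ?posrE ?invr_gt0// (lt_le_trans E1).
  by apply: le_ln1Dx; rewrite (lt_le_trans (_ : -1 < 0))// ?oppr_lt0// mulr_ge0.
apply: lerD; first by rewrite ler_norml lerNl l2.
apply: le_trans vIm _; have := @pihalf_lt2 R; clear; lra.
Qed.

Lemma cis_pi n : cis (pi * n%:R) = (-1) ^+ n.
Proof.
elim: n => [|n IH]; first by rewrite mulr0 cis0 expr0.
rewrite -natr1 mulrDr mulr1 cisD IH exprSr; congr (_ * _).
by rewrite /cis cospi sinpi; apply/eqP; rewrite eq_complex /= oppr0 !eqxx.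
Qed.

Lemma cexp_ii (t : R) : cexp (ii * rc t) = cis t.
Proof.
rewrite /cexp; have -> : ii * rc t = Complex 0 t.
  by complex_ring.
by rewrite /= expR0 mul1r.
Qed.

Let cis_piN n : cis (- (pi * n%:R)) = (-1) ^+ n.
Proof.
have H : cis (pi * n%:R) * cis (- (pi * n%:R)) = 1 by rewrite -cisD subrr cis0.
move: H; rewrite cis_pi => /(congr1 (fun x => (-1) ^+ n * x)).
by rewrite mulrA -expr2 sqrr_sign mul1r mulr1.
Qed.

Lemma ccosh_pi n (sg : bool) :
  ccosh (rc pi * ii * ((-1) ^+ sg * n%:R)) = (-1) ^+ n.
Proof.
have E (b : bool) : rc pi * ii * ((-1) ^+ b * n%:R) = ii * rc ((-1) ^+ b * (pi * n%:R)).
  by rewrite rcM rcX rcN rc1 rcM rc_nat; ring.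
have E' : - (rc pi * ii * ((-1) ^+ sg * n%:R)) = rc pi * ii * ((-1) ^+ (~~ sg) * n%:R).
  by case: sg; rewrite /= !expr0 !expr1; ring.
rewrite /ccosh E' !E !cexp_ii.
have H (b : bool) : cis ((-1) ^+ b * (pi * n%:R)) = (-1) ^+ n.
  by case: b; rewrite ?expr1 ?expr0 ?mulN1r ?mul1r (cis_piN, cis_pi).
by rewrite !H; field.
Qed.

(** cosh maps the points (+ or -) arccosh n + i pi k to (-1)^k n. Some such point has real part
    within 1 and imaginary part within 4 of those of [w0], hence the 6. *)
Lemma ccosh_integer_dense w0 : exists2 a, m|a - w0| < 6 &
  exists (n : nat) (sg : bool), ccosh a = (-1) ^+ sg * n%:R.
Proof.
pose x := `|Re w0|; pose y := `|Im w0|.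
(* For n the integer part of e^x, the number n + sqrt(n^2 - 1), of which arccosh n is the logarithm,
   differs from e^x by a factor at most 2 <= e; so arccosh n is within 1 of x. *)
pose n := Num.truncn (expR x).
have e1 : 1 <= expR x by rewrite -expR0 ler_expR normr_ge0.
have n1 : 1 <= n%:R :> R by rewrite ler1n truncn_gt0.
have nx : n%:R <= expR x by rewrite truncn_le expR_ge0.
have xn : expR x < n%:R + 1 by rewrite natr1 truncnS_gt.
pose q : R := Num.sqrt (n%:R ^+ 2 - 1).
have n21 : 0 <= n%:R ^+ 2 - 1 :> R by rewrite subr_ge0 expr_ge1// (le_trans _ n1).
have q2 : q ^+ 2 = n%:R ^+ 2 - 1 by rewrite sqr_sqrtr.
have q0 : 0 <= q by rewrite sqrtr_ge0.
have qn : q <= n%:R.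
  by rewrite -(ler_pXn2r (_ : 0 < 2)%N)// ?nnegrE// q2 gerBl.
have nq0 : 0 < n%:R + q by rewrite ltr_wpDr// (lt_le_trans ltr01).
pose L : R := ln (n%:R + q).
have eL : expR L = n%:R + q by rewrite lnK.
have eNL : expR (- L) = n%:R - q.
  rewrite expRN eL; apply: (mulfI (_ : n%:R + q != 0)); first by rewrite gt_eqF.
  rewrite divff ?gt_eqF//; transitivity (n%:R ^+ 2 - q ^+ 2); last by ring.
  by rewrite q2; ring.
have xL : `|L - x| <= 1.
  have e2 : 2 <= expR 1 :> R by have := @expR_ge1Dx R 1; rewrite -natr1 addrC.
  rewrite ler_norml; apply/andP; split.
    rewrite lerBrDr addrC lerBlDr -ler_expR expRD eL.
    apply: (@le_trans _ _ ((n%:R + q) * 2)); last by rewrite ler_pM2l.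
    by apply/ltW/(lt_le_trans xn); move: n1 q0; clear; lra.
  rewrite lerBlDr -ler_expR expRD eL mulrC.
  apply: (@le_trans _ _ (expR x * 2)); last by rewrite ler_pM2l ?expR_gt0.
  by move: nx qn; clear; lra.
pose k := Num.truncn (y / pi).
have p0 := @pi_gt0 R.
have ky : `|pi * k%:R - y| <= 4.
  have yp0 : 0 <= y / pi by rewrite divr_ge0 ?normr_ge0// ltW.
  have k1 : pi * k%:R <= y by rewrite mulrC -ler_pdivlMr// truncn_le.
  have k2 : y <= pi * k%:R + pi.
    rewrite -[X in _ + X]mulr1 -mulrDr mulrC -ler_pdivrMr// natr1 ltW// truncnS_gt//.
  have := @pihalf_lt2 R; rewrite ler_norml; move: k1 k2; clear => k1 k2 k3.
  by apply/andP; split; lra.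
pose sx : R := if 0 <= Re w0 then 1 else -1.
pose sy : R := if 0 <= Im w0 then 1 else -1.
have sxE : sx * x = Re w0.
  rewrite /sx /x; have [H|H] := leP 0 (Re w0); first by rewrite mul1r ger0_norm.
  by rewrite ltr0_norm//; ring.
have syE : sy * y = Im w0.
  rewrite /sy /y; have [H|H] := leP 0 (Im w0); first by rewrite mul1r ger0_norm.
  by rewrite ltr0_norm//; ring.
have sx1 : `|sx| = 1 by rewrite /sx; case: ifP; rewrite ?normrN normr1.
have sy1 : `|sy| = 1 by rewrite /sy; case: ifP; rewrite ?normrN normr1.
exists (Complex (sx * L) (sy * (pi * k%:R))).
  apply: le_lt_trans (modulus_le _) _; rewrite ReB ImB /= -sxE -syE -!mulrBr !normrM sx1 sy1.
  by rewrite !mul1r; move: xL ky; clear; lra.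
exists n, (odd k); rewrite signr_odd.
have cE (s : R) : s = 1 \/ s = -1 -> cis (s * (pi * k%:R)) = (-1) ^+ k.
  by case=> ->; rewrite ?mul1r ?mulN1r (cis_pi, cis_piN).
have sy' : sy = 1 \/ sy = -1 by rewrite /sy; case: ifP; [left|right].
have sx' : sx = 1 \/ sx = -1 by rewrite /sx; case: ifP; [left|right].
have Nsy' : - sy = 1 \/ - sy = -1 by case: sy' => ->; rewrite ?opprK; [right|left].
rewrite /ccosh {1}/cexp /= cE// /cexp /= -!mulNr cE//.
rewrite -mulrDl -rcD.
have -> : expR (sx * L) + expR (- sx * L) = n%:R *+ 2.
  by case: sx' => ->; rewrite ?opprK ?mul1r ?mulN1r eL eNL mulr2n; ring.
by rewrite -mulr_natr rcM !rc_nat; field.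
Qed.

(** Obtained by composing the bounds in [schottky]: |f c| <= 2 M + 1, two applications of x -> 2 x +
    4 by [hol_arccosh], an increment at most 512 times 6 by Bloch's theorem, then two exponentials
    with the factor 4 > pi between them. The number 100 is generous. *)
Definition schottky_bound (M : R) : R := expR (4 * expR (8 * M + (512 * 6 + 100))).

Lemma schottky_bound_ge1 M : 1 <= schottky_bound M.
Proof.
rewrite /schottky_bound; move: (8 * M + _) => x.
by rewrite -{1}expR0 ler_expR mulr_ge0// expR_ge0.
Qed.

Theorem schottky c (r M : R) h : 0 < r -> hol_on (disc c r) h ->
  (forall z, disc c r z -> h z != 0 /\ h z != 1) -> m|h c| <= M ->
  forall z, m|z - c| < r / 2 -> m|h z| <= schottky_bound M.
Proof.
move=> r0 hh h01 hM z zr.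
have c0 : disc c r c by rewrite /disc /= subrr modulus0.
have r20 : 0 < r / 2 by rewrite divr_gt0.
have r2r : r / 2 < r by rewrite ltr_pdivrMr// ltr_pMr// ltr1n.
have zr' : disc c r z by exact: lt_trans r2r.
(* h = (1 + cosh (pi i cosh G)) / 2, where cosh G omits the integers, so that the values of G
   omit a 6-dense set and Bloch's theorem bounds G'. *)
pose f z := 2 * h z - 1.
have hf : hol_on (disc c r) f.
  by move=> x /hh[l Hl]; eexists; apply: difB; [apply: difZ; exact: Hl|exact: dif_cst].
have n2 : (2 : C R) != 0 by rewrite pnatr_eq0.
have f1 x : disc c r x -> f x != 1 /\ f x != -1.
  move=> /h01[h0 h1]; rewrite /f subr_eq; split.
    apply: contraNneq h1 => H; apply/eqP/(mulfI n2); rewrite H mulr1.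
    by rewrite -(natrD _ 1 1).
  by rewrite -subr_eq0 opprK subrK mulf_neq0.
have [F [hF Fc HF]] := hol_arccosh r0 hf f1.
have pi0 : rc pi * ii != 0.
  apply: mulf_neq0; first by rewrite rc_eq0 gt_eqF// pi_gt0.
  by rewrite -modulus_gt0 modulus_ii.
pose F2 z := (rc pi * ii)^-1 * F z.
have hF2 : hol_on (disc c r) F2.
  by move=> x /hF[l Hl]; eexists; apply: difZ; exact: Hl.
(* If [F2 x] were an integer n, then [f x] = cosh(i pi n) = (-1)^n would be an omitted value. *)
have Fn x n (sg : bool) : disc c r x -> F2 x != (-1) ^+ sg * n%:R.
  move=> xr; apply/eqP => H.
  have FE : F x = rc pi * ii * ((-1) ^+ sg * n%:R) by rewrite -H /F2 mulVKf.
  have := HF x xr; rewrite FE ccosh_pi => E; have [] := f1 x xr; rewrite -E.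
  by rewrite -signr_odd; case: odd; rewrite ?expr1 ?expr0 eqxx.
have [|G [hG Gc HG]] := hol_arccosh r0 hF2.
  move=> x xr; have := Fn x 1%N false xr; have := Fn x 1%N true xr.
  by rewrite expr0 expr1 !mulr1.
have Gomit x : m|x - c| < r / 2 -> forall w0, exists2 w, m|w - w0| < 6 &
    forall z, disc x (r / 2) z -> G z != w.
  move=> xr w0; have [a aw [n [sg Ha]]] := ccosh_integer_dense w0.
  exists a => // u ux; have ur : disc c r u.
    by rewrite /disc /= (splitr r); apply: le_lt_trans (modulus_tri x _ _) _; apply: ltrD.
  by apply: contraNneq (Fn u n sg ur) => Gu; rewrite -HG// Gu Ha.
have dG x : m|x - c| < r / 2 -> m|cder G x| <= 512 * 6 / (r / 2).
  move=> xr; apply: bloch => //; last exact: Gomit.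
  move=> u ux; apply: hG; rewrite /disc /= (splitr r).
  by apply: le_lt_trans (modulus_tri x _ _) _; apply: ltrD.
have c0' : disc c (r / 2) c by rewrite /disc /= subrr modulus0.
have Gz : m|G z - G c| <= 512 * 6.
  apply: (@le_trans _ _ (512 * 6 / (r / 2) * m|z - c|)).
    apply: (@mean_value _ _ (cder G)) => t It.
      by apply: (hol_cder_dif hG); apply: convex_disc.
    by apply: dG; exact: (convex_disc c0' zr It).
  have K0 : 0 <= 512 * 6 / (r / 2) :> R.
    by apply: divr_ge0; [apply: mulr_ge0; exact: ler0n|exact: ltW].
  apply: le_trans (ler_wpM2l K0 (ltW zr)) _; rewrite divfK//.
  by rewrite gt_eqF.
have F2c : m|F2 c| <= m|F c|.
  rewrite /F2 modulusM modulusV modulusM modulus_ii mulr1 modulus_rc ger0_norm ?pi_ge0//.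
  rewrite mulrC ler_pdivrMr ?pi_gt0// ler_peMr ?modulus_ge0//.
  by have := @pi_ge2 R; clear; lra.
have fc : m|f c| <= 2 * M + 1.
  rewrite /f; apply: le_trans (modulusD _ _) _.
  by rewrite modulusN modulus1 modulusM modulus_nat lerD2r ler_pM2l.
have Gz' : m|G z| <= 8 * M + (512 * 6 + 100).
  have := modulusD (G z - G c) (G c); rewrite subrK.
  by move: Gz Gc F2c Fc fc; clear; lra.
have F2z : m|F2 z| <= expR (8 * M + (512 * 6 + 100)).
  by rewrite -HG//; apply: le_trans (modulus_ccosh _) _; rewrite ler_expR.
have Fz : m|F z| <= 4 * expR (8 * M + (512 * 6 + 100)).
  have -> : F z = rc pi * ii * F2 z by rewrite /F2 mulVKf.
  rewrite modulusM (modulusM (rc pi)) modulus_ii mulr1 modulus_rc ger0_norm ?pi_ge0//.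
  apply: ler_pM; [exact: pi_ge0|exact: modulus_ge0| |exact: F2z].
  by have := @pihalf_lt2 R; clear; lra.
have fz : m|f z| <= schottky_bound M.
  by rewrite -HF//; apply: le_trans (modulus_ccosh _) _; rewrite ler_expR.
have S1 := schottky_bound_ge1 M.
have -> : h z = (f z + 1) / 2 by rewrite /f; field.
rewrite modulusM modulusV modulus_nat ler_pdivrMr//.
apply: le_trans (modulusD _ _) _; rewrite modulus1.
by move: fz S1; clear; lra.
Qed.

End SchottkyTheorem.

(** * Open mapping, maximum principle and Harnack's inequality *)

Section SchottkyConsequences.
Variable R : realType.
Local Notation ii := (@ii R).
Implicit Types (a c z w : C R) (f g h F : C R -> C R).

Lemma hol_on_affine (D : set (C R)) f (p q : C R) :
  hol_on D f -> hol_on D (fun z => p * (f z - q)).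
Proof.
by move=> hf z /hf[l Hl]; eexists; apply: difZ; apply: difB; [exact: Hl|exact: dif_cst].
Qed.

(* Two omitted values w1, w2 close to F a, with w2 much closer than w1, force F to be close
   to F a by Schottky's theorem applied to (F - w1) / (w2 - w1). *)
Lemma open_mapping a (r : R) F : 0 < r -> hol_on (disc a r) F ->
  nbhs (F a) (F @` disc a r) \/ forall z, m|z - a| < r / 2 -> F z = F a.
Proof.
move=> r0 hF; have a0 : disc a r a by rewrite /disc /= subrr modulus0.
have [H|H] := pselect (nbhs (F a) (F @` disc a r)); [by left|right].
have omit (d : R) : 0 < d -> exists2 w, m|w - F a| < d & ~ (F @` disc a r) w.
  move=> d0; apply: contrapT => H'; apply: H; apply/nbhs_modulusP; exists d => // w wd.
  by apply: contrapT => H''; apply: H'; exists w.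
move=> z zr; apply/eqP; rewrite -subr_eq0 -modulus_eq0 eq_le modulus_ge0 andbT.
apply/ler_addgt0Pr => e e0; rewrite add0r.
pose S := schottky_bound (2 : R).
have S1 : 1 <= S by exact: schottky_bound_ge1.
have d0 : 0 < e / (2 * S + 1).
  by rewrite divr_gt0//; move: S1; clear; lra.
have [w1 w1d w1F] := omit _ d0.
have w1a : 0 < m|w1 - F a|.
  by rewrite modulus_gt0 subr_eq0; apply/eqP => E; apply: w1F; exists a.
(* Taking [w2] within half the distance from [w1] to [F a] makes |w2 - w1| comparable with that
   distance, so h(a) is at most 2 and the factor w2 - w1 is small. *)
have [w2 w2d w2F] := omit _ (divr_gt0 w1a (ltr0n _ 2)).
have w21 : m|w1 - F a| / 2 <= m|w2 - w1|.
  by have := modulus_tri w2 w1 (F a); rewrite (modulusB w1 w2); move: w2d; clear; lra.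
have w21' : m|w2 - w1| <= 2 * m|w1 - F a|.
  by have := modulus_tri (F a) w2 w1; rewrite (modulusB (F a) w1); move: w2d w1a; clear; lra.
have w21n : w2 - w1 != 0.
  by rewrite -modulus_gt0 (lt_le_trans _ w21)// divr_gt0.
pose h z := (w2 - w1)^-1 * (F z - w1).
have hh : hol_on (disc a r) h by exact: hol_on_affine.
have h01 x : disc a r x -> h x != 0 /\ h x != 1.
  move=> xr; split.
    rewrite /h mulf_neq0 ?invr_eq0// subr_eq0; apply/eqP => E; apply: w1F; by exists x.
  apply/eqP => E; apply: w2F; exists x => //; apply/eqP; rewrite -subr_eq0.
  have : (w2 - w1) * h x = w2 - w1 by rewrite E mulr1.
  by rewrite /h mulVKf// => /eqP; rewrite -subr_eq0 opprB addrA subrK.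
have ha : m|h a| <= 2.
  rewrite /h modulusM modulusV mulrC ler_pdivrMr ?modulus_gt0// (modulusB _ w1).
  by move: w21; clear; lra.
have := schottky r0 hh h01 ha zr; rewrite -/S => hz.
have E : F z - F a = (w2 - w1) * h z + (w1 - F a) by rewrite /h mulVKf//; ring.
rewrite E; apply: le_trans (modulusD _ _) _; rewrite modulusM.
apply: (@le_trans _ _ (2 * m|w1 - F a| * S + m|w1 - F a|)).
  by rewrite lerD2r ler_pM ?modulus_ge0.
have -> : 2 * m|w1 - F a| * S + m|w1 - F a| = m|w1 - F a| * (2 * S + 1) by ring.
by rewrite -ler_pdivlMr ?ltW//; move: S1; clear; lra.
Qed.

Lemma hausdorffC : hausdorff_space (C R).
Proof. exact: norm_hausdorff. Qed.

(** Among the maximum points of |F| take one with the largest real part. If it had a disc as in the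
    hypothesis, an open image would contain larger moduli, and a constant [F] nearby would give
    maximum points further to the right. *)
Theorem maximum_principle (K : set (C R)) F (M : R) : compact K ->
  (forall z, K z -> {for z, continuous F}) ->
  (forall z, K z -> m|F z| <= M \/
    exists2 r : R, 0 < r & disc z r `<=` K /\ hol_on (disc z r) F) ->
  forall z, K z -> m|F z| <= M.
Proof.
move=> cK cF HK z Kz.
have cmF x : K x -> {for x, continuous (fun x => m|F x|)}.
  by move=> /cF H; apply: (continuous_comp H); exact: continuous_modulus.
have [||c Kc cmax] := @compact_max R K (fun x => m|F x|) _ cK.
- by exists z.
- exact: cmF.
apply: le_trans (cmax z Kz) _; rewrite leNgt; apply/negP => Mc.
pose S := [set x | K x /\ m|F x| = m|F c|].
have clS : closed S.
  move=> p clp; have Kp : K p.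
    apply: (compact_closed hausdorffC cK) => B /clp[x [[Kx _] Bx]]; by exists x.
  split => //; apply: contrapT => /eqP ne.
  have e0 : 0 < `| m|F p| - m|F c| | by rewrite normr_gt0 subr_eq0.
  have /(cvg_realP (nbhs_filter p)) /(_ _ e0) /clp [x [[Kx ->]]] := cmF p Kp.
  by rewrite distrC ltxx.
have cS : compact S by apply: (subclosed_compact clS cK) => x [].
have [||p [Kp pc] pmax] := @compact_max R S (@complex.Re R) _ cS.
- by exists c.
- by move=> x _; exact: continuous_Re.
have [|[r r0 [rK hr]]] := HK p Kp; first by rewrite pc leNgt Mc.
have [/nbhs_modulusP[d d0 Hd]|cst] := open_mapping r0 hr.
  have d20 : 0 < d / 2 by rewrite divr_gt0.
  have [u u1 Hu] : exists2 u : C R, m|u| = 1 & m|F p + rc (d / 2) * u| = m|F p| + d / 2.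
    have [Fp0|Fp0] := eqVneq (F p) 0.
      exists 1; first exact: modulus1.
      by rewrite Fp0 add0r mulr1 modulus0 add0r modulus_rc ger0_norm// ltW.
    have mFp : 0 < m|F p| by rewrite modulus_gt0.
    exists (F p / rc m|F p|).
      by rewrite modulusM modulusV modulus_rc ger0_norm ?modulus_ge0// divff// gt_eqF.
    have -> : F p + rc (d / 2) * (F p / rc m|F p|) = F p * rc (1 + d / 2 / m|F p|).
      by rewrite rcD rc1 (rcM _ m|F p|^-1) rcV; ring.
    rewrite modulusM modulus_rc ger0_norm ?mulrDr; last by rewrite addr_ge0// divr_ge0 ?modulus_ge0// ltW.
    by rewrite mulr1; congr (_ + _); field; rewrite gt_eqF.
  have [|x xr Fx] := Hd (F p + rc (d / 2) * u).
    rewrite addrAC subrr add0r modulusM u1 mulr1 modulus_rc ger0_norm; last exact: ltW.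
    by rewrite ltr_pdivrMr// ltr_pMr// ltr1n.
  have := cmax x (rK _ xr); rewrite Fx Hu pc gerDl leNgt d20; by [].
have r40 : 0 < r / 4 by rewrite divr_gt0.
have xp : m|p + rc (r / 4) - p| = r / 4.
  by rewrite addrAC subrr add0r modulus_rc ger0_norm// ltW.
have /pmax : S (p + rc (r / 4)).
  split; first by apply: rK; rewrite /disc /= xp; move: r0; clear; lra.
  by rewrite cst// xp; move: r0; clear; lra.
by rewrite ReD /= gerDl leNgt r40.
Qed.

Corollary maximum_disc c (r : R) F (M : R) : 0 < r -> (forall z, exists l, dif id F z l) ->
  (forall z, m|z - c| = r -> m|F z| <= M) -> forall z, m|z - c| <= r -> m|F z| <= M.
Proof.
move=> r0 hF HM; apply: maximum_principle.
- exact: closed_disc_compact.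
- by move=> z _; have [l Hl] := hF z; exact: (dif_cont (@continuous_idC R) Hl).
move=> z /=; rewrite le_eqVlt => /orP[/eqP/HM|zr]; [by left|right].
exists (r - m|z - c|); first by rewrite subr_gt0.
split => [w|w _]; last exact: hF.
rewrite /disc /= => wz; apply: le_trans (modulus_tri z _ _) _.
by rewrite -lerBrDr ltW.
Qed.

(* F - F a vanishes near a, so (F - F a) / (z - a)^m obeys the maximum principle on annuli for every m. *)
Lemma identity_theorem a (r : R) F : 0 < r -> (forall z, exists l, dif id F z l) ->
  (forall z, disc a r z -> F z = F a) -> forall z, F z = F a.
Proof.
move=> r0 hF Fr z; have [zr|zr] := ltP m|z - a| r; first exact: Fr.
set s := m|z - a| in zr; have s0 : 0 < s := lt_le_trans r0 zr.
pose H w := F w - F a.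
have cH w : {for w, continuous H}.
  apply: continuousB; last exact: cst_continuous.
  by have [l Hl] := hF w; exact: (dif_cont (@continuous_idC R) Hl).
have [||b b2 bmax] := @compact_max R [set w | m|w - a| <= 2 * s] (fun w => m|H w|) _ (@closed_disc_compact R a (2 * s)).
- by exists a; rewrite /= subrr modulus0 mulr_ge0// ltW.
- by move=> w _; apply: (continuous_comp (cH w)); exact: continuous_modulus.
set M := m|H b| in bmax.
have M0 : 0 <= M by exact: modulus_ge0.
(* On the annulus between the radii r / 2 and 2 s the quotient of [H] by the n-th power is at most M
   / (2 s)^n; [z] lies on the circle of radius s, which leaves M / 2^n. *)
have key n : m|H z| <= M / 2 ^+ n.
  pose K := [set w | r / 2 <= m|w - a|] `&` [set w | m|w - a| <= 2 * s].
  pose G w := H w * (w - a)^-1 ^+ n.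
  have r20 : 0 < r / 2 by rewrite divr_gt0.
  have nz w : r / 2 <= m|w - a| -> w - a != 0.
    by move=> H1; rewrite -modulus_gt0 (lt_le_trans r20).
  have hG w : w - a != 0 -> exists l, dif id G w l.
    move=> wa; have [l Hl] := hF w; eexists; apply: (difM (@continuous_idC R)).
      by apply: (difB (f := F) (h := fun=> F a)); [exact: Hl|exact: dif_cst].
    apply: (difX (@continuous_idC R) (f := fun s => (s - a)^-1)).
    apply: (difV (@continuous_idC R) (f := fun s => s - a) wa).
    by apply: difB; [exact: dif_iota|exact: dif_cst].
  have cK : compact K.
    apply: (@closed_bounded_compact R _ (2 * s + m|a|)).
      apply: closedI; last exact: closed_disc_closed.
      apply: (@preimage_closed _ _ (fun w => m|w - a|) [set x | r / 2 <= x]).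
        move=> w _; apply: continuous_distance; exact: (fun U HU => HU).
      exact: closed_ge.
    move=> w [_ /= wa]; rewrite -(subrK a w); apply: le_trans (modulusD _ _) _.
    by rewrite lerD2r.
  have HG : m|G z| <= M * (2 * s)^-1 ^+ n.
    apply: (maximum_principle cK) => [w [/nz wa _]|w [/= w1 w2]|].
    - by have [l Hl] := hG w wa; exact: (dif_cont (@continuous_idC R) Hl).
    - have [E|ne1] := eqVneq m|w - a| (r / 2).
        left; rewrite /G /H Fr; first by rewrite subrr mul0r modulus0 mulr_ge0// exprn_ge0// invr_ge0 mulr_ge0// ltW.
        by rewrite /disc /= E; move: r0; clear; lra.
      have [E|ne2] := eqVneq m|w - a| (2 * s).
        left; rewrite /G modulusM modulusX modulusV E ler_wpM2r//.
          by rewrite exprn_ge0// invr_ge0 mulr_ge0// ltW.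
        by apply: bmax; rewrite /= E.
      right; have l1 : r / 2 < m|w - a| by rewrite lt_neqAle eq_sym ne1.
      have l2 : m|w - a| < 2 * s by rewrite lt_neqAle ne2.
      exists (Num.min (m|w - a| - r / 2) (2 * s - m|w - a|)).
        by rewrite lt_min !subr_gt0 l1.
      have inK x : disc w (Num.min (m|w - a| - r / 2) (2 * s - m|w - a|)) x -> K x.
        rewrite /disc /= lt_min => /andP[d1 d2]; split => /=.
          have := modulus_tri x w a; rewrite (modulusB w x); move: d1; clear; lra.
        have := modulus_tri w x a; move: d2; clear; lra.
      by split => // x /inK [/nz xa _]; exact: hG.
    - by split; rewrite /= -/s; move: zr s0 r0; clear; lra.
  move: HG; rewrite /G modulusM modulusX modulusV -/s invfM exprMn.
  rewrite (mulrA M) ler_pM2r ?exprn_gt0 ?invr_gt0//.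
  by rewrite exprVn.
apply/eqP; rewrite -subr_eq0 -modulus_eq0 eq_le modulus_ge0 andbT.
apply/ler_addgt0Pr => e e0; rewrite add0r.
pose n := (Num.truncn (M / e)).+1.
apply: le_trans (key n) _; rewrite ler_pdivrMr ?exprn_gt0// mulrC -ler_pdivrMr//.
apply/ltW/(lt_le_trans (truncnS_gt _)).
by rewrite -natrX ler_nat ltnW// ltn_expl.
Qed.

(** A logarithm of [h] has positive real part. Shifted to be real at [a] and divided by minus its
    value there, it becomes [om], with negative real part and [om a] = -1; so [om] omits 0 and 1 and
    Schottky's theorem bounds it. *)
Lemma harnack a (r : R) h : 0 < r -> hol_on (disc a r) h ->
  (forall z, disc a r z -> 1 < m|h z|) -> forall z, m|z - a| < r / 2 ->
  ln m|h z| <= schottky_bound 1 * ln m|h a|.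
Proof.
move=> r0 hh h1 z zr; have a0 : disc a r a by rewrite /disc /= subrr modulus0.
have h0 x : disc a r x -> h x != 0.
  by move=> /h1 H; rewrite -modulus_gt0 (lt_trans ltr01).
have [v Hv [vRe _]] := clog_exists (h0 a a0).
have [phi [hphi pa Hphi]] := hol_log r0 hh h0 Hv.
have RE x : disc a r x -> Re (phi x) = ln m|h x|.
  by move=> xr; rewrite -Hphi// modulus_cexp expRK.
have lh x : disc a r x -> 0 < ln m|h x| by move=> /h1 H; exact: ln_gt0.
pose x0 := ln m|h a|; have x00 : 0 < x0 by exact: lh.
pose t : C R := ii * rc (Im v).
have va : v - t = rc x0 by rewrite {1}(cexp_re_im v) vRe /t; ring.
pose om x := (- rc x0)^-1 * (phi x - t).
have rx0 : - rc x0 != 0 by rewrite oppr_eq0 rc_eq0 gt_eqF.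
have hom : hol_on (disc a r) om by exact: hol_on_affine.
have tRe : Re t = 0 by rewrite /t /=; ring.
have omE x : phi x - t = - rc x0 * om x by rewrite /om mulVKf.
have ReE x : Re (phi x) = - x0 * Re (om x).
  have := congr1 (@complex.Re R) (omE x); rewrite ReB tRe subr0 => ->.
  by rewrite -rcN; case: (om x) => p q /=; ring.
have om01 x : disc a r x -> om x != 0 /\ om x != 1.
  move=> xr; have := lh x xr; rewrite -RE// ReE => H; split; apply/eqP => E; move: H; rewrite E /=.
    by rewrite mulr0 ltxx.
  by rewrite mulr1 oppr_gt0 ltNge ltW.
have oma : m|om a| <= 1.
  by rewrite /om pa va invrN mulNr mulVf ?rc_eq0 ?gt_eqF// modulusN modulus1.
have zr' : disc a r z by rewrite /disc /=; move: zr r0; clear; lra.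
have := schottky r0 hom om01 oma zr => Hz.
rewrite -RE// ReE mulNr -mulrN mulrC ler_wpM2r//; first exact: ltW.
by apply: le_trans Hz; rewrite -ReN; apply: le_trans (ler_norm _) _; rewrite -(modulusN (om z)) ler_Re.
Qed.

(** The shift by 2 keeps the value at least ln 2, so that quotients of two values are meaningful for
    small moduli too. *)
Definition logsize w : R := ln (2 + m|w|).

Lemma logsize_ge w : ln 2 <= logsize w.
Proof. by rewrite ler_ln ?posrE ?lerDl ?modulus_ge0// ltr_wpDr// modulus_ge0. Qed.

Lemma ln2_gt0 : 0 < ln 2 :> R. Proof. by rewrite ln_gt0// ltr1n. Qed.

Lemma logsize_gt0 w : 0 < logsize w.
Proof. by rewrite (lt_le_trans ln2_gt0)// logsize_ge. Qed.

(** The 5 is for moduli at most 20, since 22 <= 2^5; the factor 2 before Harnack's constant is for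
    moduli above 2, where 2 + x <= x^2. *)
Definition compare_const : R := 2 * schottky_bound 1 + 5.

(** The two alternatives are those of [normal_dichotomy]. In the second, points of the disc of
    radius r / 8 are less than r / 4 apart, so Harnack's inequality applies on the disc of radius r
    / 2 about either of them. *)
Lemma logsize_compare a (r : R) h : 0 < r -> hol_on (disc a r) h ->
  (forall z, disc a r z -> m|h z| <= 20) \/ (forall z, disc a r z -> 2 < m|h z|) ->
  forall z w, disc a (r / 8) z -> disc a (r / 8) w ->
  logsize (h z) <= compare_const * logsize (h w).
Proof.
move=> r0 hh H z w zr wr; have S1 : 1 <= schottky_bound (1 : R) by exact: schottky_bound_ge1.
have in8 x : disc a (r / 8) x -> disc a r x by rewrite /disc /=; move: r0; clear; lra.
case: H => H.
  apply: (@le_trans _ _ (5 * ln 2)).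
    apply: (@le_trans _ _ (ln (2 ^+ 5))).
      rewrite ler_ln ?posrE ?exprn_gt0//; last by rewrite ltr_wpDr// modulus_ge0.
      have -> : (2 : R) ^+ 5 = 32 by rewrite -natrX.
      have := H z (in8 z zr); clear; lra.
    by rewrite lnXn// mulr_natl.
  apply: ler_pM => //; [by rewrite ltW// ln2_gt0| |exact: logsize_ge].
  by rewrite /compare_const lerDr mulr_ge0// (le_trans ler01).
have r20 : 0 < r / 2 by rewrite divr_gt0.
have sub x : disc w (r / 2) x -> disc a r x.
  rewrite /disc /= => xw; have := modulus_tri w x a; move: xw wr; rewrite /disc /=; move: r0; clear; lra.
have hz := H z (in8 z zr); have hw := H w (in8 w wr).
have : ln m|h z| <= schottky_bound 1 * ln m|h w|.
  apply: (harnack r20) => [x /sub|x /sub /H|].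
  - exact: hh.
  - by apply: lt_trans; rewrite ltr1n.
  - have := modulus_tri a z w; rewrite (modulusB a w); move: zr wr; rewrite /disc /=.
    by move: r0; clear; lra.
move=> Hln; apply: (@le_trans _ _ (2 * ln m|h z|)).
  rewrite mulr_natl mulr2n -lnM ?posrE; last 2 first.
  - by rewrite (lt_trans _ hz).
  - by rewrite (lt_trans _ hz).
  rewrite ler_ln ?posrE; last 2 first.
  - by rewrite ltr_wpDr// modulus_ge0.
  - by rewrite mulr_gt0// (lt_trans _ hz).
  apply: (@le_trans _ _ (2 * m|h z|)); first by move: hz; clear; lra.
  by rewrite ler_pM2r ?(ltW hz)// (lt_trans _ hz).
apply: (@le_trans _ _ (2 * schottky_bound 1 * logsize (h w))).
  rewrite -mulrA ler_pM2l//; apply: le_trans Hln _; rewrite ler_pM2l ?(lt_le_trans ltr01 S1)//.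
  rewrite ler_ln ?posrE; last 2 first.
  - by rewrite (lt_trans _ hw).
  - by rewrite ltr_wpDr// modulus_ge0.
  by rewrite lerDr.
by rewrite ler_pM2r ?logsize_gt0// /compare_const lerDl.
Qed.

End SchottkyConsequences.

(** * Growth of iterates *)

Section IterateGrowth.
Variable R : realType.
Implicit Types (a c z w : C R) (f g h F : C R -> C R).

(* Otherwise f omits a value on each of the circles of radius rho and 2 rho. *)
Lemma covered_circle f (r rho : R) : 0 < r -> 0 < rho -> (forall z, exists l, dif id f z l) ->
  m|f 0| <= rho ->
  (exists2 z, m|z| < r / 2 & rho * (1 + 3 * schottky_bound 2) < m|f z|) ->
  exists2 s, rho <= s & forall w, m|w| = s -> exists2 z, m|z| < r & f z = w.
Proof.
move=> r0 rho0 hf f0 [z zr Hz].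
have [H1|/existsNP[w1 /not_implyP[w1r H1]]] :=
  pselect (forall w, m|w| = rho -> exists2 z, m|z| < r & f z = w); first by exists rho.
have [H2|/existsNP[w2 /not_implyP[w2r H2]]] :=
  pselect (forall w, m|w| = 2 * rho -> exists2 z, m|z| < r & f z = w).
  by exists (2 * rho) => //; move: rho0; clear; lra.
exfalso; have w21 : rho <= m|w2 - w1|.
  by have := ler_modulusB w2 w1; rewrite w1r w2r; clear; lra.
have w21' : m|w2 - w1| <= 3 * rho.
  by apply: le_trans (modulusD _ _) _; rewrite modulusN w1r w2r; clear; lra.
have w21n : w2 - w1 != 0 by rewrite -modulus_gt0 (lt_le_trans rho0).
pose h z := (w2 - w1)^-1 * (f z - w1).
have hh : hol_on (disc 0 r) h by apply: hol_on_affine => x _; exact: hf.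
have h01 x : disc 0 r x -> h x != 0 /\ h x != 1.
  rewrite /disc /= subr0 => xr; split.
    by rewrite /h mulf_neq0 ?invr_eq0// subr_eq0; apply/eqP => E; apply: H1; exists x.
  apply/eqP => E; apply: H2; exists x => //; apply/eqP; rewrite -subr_eq0.
  have : (w2 - w1) * h x = w2 - w1 by rewrite E mulr1.
  by rewrite /h mulVKf// => /eqP; rewrite -subr_eq0 opprB addrA subrK.
have h0 : m|h 0| <= 2.
  rewrite /h modulusM modulusV mulrC ler_pdivrMr ?(lt_le_trans rho0)//.
  apply: le_trans (modulusD _ _) _; rewrite modulusN w1r.
  by move: f0 w21; clear; lra.
have := schottky r0 hh h01 h0 (z := z); rewrite subr0 => /(_ zr) hz.
have E : f z = (w2 - w1) * h z + w1 by rewrite /h mulVKf//; ring.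
move: Hz; rewrite E ltNge => /negP; apply; apply: le_trans (modulusD _ _) _.
rewrite modulusM w1r mulrDr mulr1 addrC lerD2l mulrA [rho * 3]mulrC.
by apply: ler_pM; rewrite ?modulus_ge0.
Qed.

Lemma dif_iter f k : (forall z, exists l, dif id f z l) -> forall z, exists l, dif id (iter k f) z l.
Proof.
move=> hf; elim: k => [|k IH] z; first by exists 1; exact: dif_iota.
have [l Hl] := IH z; have [q Hq] := hf (iter k f z).
by exists (q * l); apply: (dif_comp (@continuous_idC R) (F := f) (f := iter k f)).
Qed.

Lemma entire_dif f : entire f -> forall z, exists l, dif id f z l.
Proof. by move=> ef z; apply: derivable_dif; exact: ef. Qed.

(* That is, the maximum of f^(k+1) on the disc of radius r is at least the maximum of f^k on the
   disc of radius r^(N+1). *)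
Lemma iterate_bound_step f (N : nat) : transcendental_entire f ->
  exists2 r0 : R, 2 <= r0 & forall r k (B : R), r0 <= r ->
    (forall z, m|z| <= r -> m|iter k.+1 f z| <= B) ->
    forall z, m|z| <= r ^+ N.+1 -> m|iter k f z| <= B.
Proof.
move=> tf; have hf := entire_dif tf.1.
(* One power beyond r^(N+1) is asked for, so that the spare factor r absorbs the constants of
   [covered_circle]. *)
have [r1 Hr1] := transcendental_growth N.+2 tf.
pose S := schottky_bound (2 : R).
have S1 : 1 <= S by exact: schottky_bound_ge1.
have P1 : 0 <= 4 ^+ N.+2 * (1 + 3 * S).
  by rewrite mulr_ge0 ?exprn_ge0// addr_ge0// mulr_ge0// (le_trans ler01).
(* The summands ensure in turn r >= 2, r / 4 > r1, |f 0| <= r, and that (r / 4)^(N+2) is at least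
   r^(N+1) (1 + 3 S). *)
exists (2 + (4 * `|r1| + (m|f 0| + 4 ^+ N.+2 * (1 + 3 * S)))).
  rewrite lerDl; apply: addr_ge0; first exact: mulr_ge0.
  by apply: addr_ge0; [exact: modulus_ge0|exact: P1].
move=> r k B rr HB.
have f00 := modulus_ge0 (f 0); have r10 := normr_ge0 r1.
have r2 : 2 <= r by move: rr P1 f00 r10; clear; lra.
have r0 : 0 < r by move: r2; clear; lra.
have rN : r <= r ^+ N.+1 by rewrite exprS ler_pMr// exprn_ege1// (le_trans _ r2)// ler1n.
have rho0 : 0 < r ^+ N.+1 by rewrite exprn_gt0.
have [||s rs Hs] := covered_circle r0 rho0 hf.
- by apply: le_trans rN; move: rr P1 f00 r10; clear; lra.
- have [|z zr Hz] := Hr1 (r / 4).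
    by have := ler_norm r1; move: rr P1 f00 r10; clear; lra.
  exists z; first by apply: le_lt_trans zr _; move: r0; clear; lra.
  apply: le_lt_trans Hz; rewrite expr_div_n ler_pdivlMr ?exprn_gt0// (exprSr r N.+1) -mulrA.
  rewrite ler_pM2l// mulrC -/S; by move: rr P1 f00 r10; clear; lra.
have s0 : 0 < s by apply: lt_le_trans rs.
move=> z zr; apply: (@maximum_disc R 0 s (iter k f) B s0 (dif_iter k hf)) => [w|].
  rewrite subr0 => /Hs[x xr <-]; rewrite -iterSr; apply: HB; exact: ltW.
by rewrite subr0 (le_trans zr).
Qed.

Lemma iterate_growth f : transcendental_entire f ->
  exists r1 : R, forall A K : R, exists n z, m|z| <= r1 /\ A * K ^+ n < logsize (iter n f z).
Proof.
move=> tf; have [r1 r12 H1] := iterate_bound_step 1 tf.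
have r10 : 0 < r1 by rewrite (lt_le_trans _ r12).
exists r1 => A0 K0; apply: contrapT => noz.
pose A := `|A0| + 1; pose K := `|K0| + 1.
have A1 : 1 <= A by rewrite lerDr.
have K1 : 1 <= K by rewrite lerDr.
have bound n z : m|z| <= r1 -> logsize (iter n f z) <= A * K ^+ n.
  move=> zr; rewrite leNgt; apply/negP => H; apply: noz; exists n, z; split => //.
  apply: le_lt_trans H; apply: le_trans (ler_norm _) _; rewrite normrM normrX.
  apply: ler_pM; rewrite ?exprn_ge0 ?normr_ge0 ?lerDl//.
  by rewrite lerXn2r ?nnegrE ?normr_ge0 ?addr_ge0// lerDl.
pose N := (Num.truncn (2 * K)).
have KN : 2 * K <= N.+1%:R by rewrite ltW// truncnS_gt.
have [r2 r22 H2] := iterate_bound_step N tf.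
pose m := (Num.truncn r2).+1.
(* Once the radius has grown to r2, at the cost of m iterations, N can be taken as large as
   needed to beat K. *)
have up k j (B : R) : (forall z, m|z| <= r1 -> m|iter (k + j) f z| <= B) ->
    forall z, m|z| <= 2 ^+ j * r1 -> m|iter k f z| <= B.
  elim: j k => [|j IH] k HB; first by rewrite expr0 addn0 in HB *; rewrite mul1r.
  have HB' z : m|z| <= 2 ^+ j * r1 -> m|iter k.+1 f z| <= B.
    by apply: IH => x; rewrite addSnnS; exact: HB.
  have r1j : r1 <= 2 ^+ j * r1 by rewrite ler_peMl ?(ltW r10)// exprn_ege1// ler1n.
  move=> z zj; apply: (H1 (2 ^+ j * r1) k B r1j HB'); apply: le_trans zj _.
  rewrite exprS -mulrA expr2 ler_wpM2r//; first by rewrite mulr_ge0 ?exprn_ge0// ltW.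
  exact: le_trans r12 r1j.
(* Each step removes one iteration and raises the radius to the power N + 1; after k steps the
   identity map remains, and it attains the radius itself. *)
have down k (r B : R) : r2 <= r -> (forall z, m|z| <= r -> m|iter k f z| <= B) ->
    r ^+ (N.+1 ^ k) <= B.
  elim: k r => [|k IH] r rr HB.
    rewrite expn0 expr1; have := HB (rc r); rewrite modulus_rc ger0_norm; first exact.
    by rewrite (le_trans _ rr)// (le_trans _ r22).
  have r1' : 1 <= r by rewrite (le_trans _ rr)// (le_trans _ r22)// ler1n.
  rewrite expnS exprM; apply: IH; last exact: H2.
  by apply: le_trans rr _; rewrite exprS ler_peMr ?(le_trans ler01 r1')// exprn_ege1.
have r2m : r2 <= 2 ^+ m * r1.
  apply: (@le_trans _ _ (2 ^+ m)); last by rewrite ler_peMr ?exprn_ge0// (le_trans _ r12)// ler1n.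
  apply/ltW/(lt_le_trans (truncnS_gt _)); rewrite -natrX ler_nat ltnW// ltn_expl//.
have main k : 2 ^+ (N.+1 ^ k) <= expR (A * K ^+ (k + m)).
  apply: (@le_trans _ _ ((2 ^+ m * r1) ^+ (N.+1 ^ k))).
    rewrite lerXn2r ?nnegrE ?mulr_ge0 ?exprn_ge0 ?(ltW r10)//.
    exact: le_trans r22 r2m.
  apply: down => // z; apply: up => x xr; have := bound (k + m)%N x xr.
  rewrite /logsize -ler_expR lnK ?posrE ?ltr_wpDr ?modulus_ge0// => Hb.
  by apply: le_trans Hb; rewrite lerDr.
(* As (N + 1)^k is at least (2 K)^k, division by K^k leaves 2^k ln 2 below a quantity independent of
   k. *)
have main2 k : 2 ^+ k * ln 2 <= A * K ^+ m.
  have := main k; rewrite -{1}(@lnK R 2) ?posrE// -expRM_natl ler_expR => Hk.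
  have K0' : 0 < K ^+ k by rewrite exprn_gt0// (lt_le_trans ltr01).
  have E : A * K ^+ (k + m) = A * K ^+ m * K ^+ k by rewrite exprD; ring.
  rewrite -(ler_pM2r K0') -E; apply: le_trans Hk.
  rewrite mulrAC -exprMn natrX; apply: ler_wpM2r; first exact: ltW (ln2_gt0 R).
  by rewrite lerXn2r ?nnegrE ?mulr_ge0// (le_trans ler01 K1).
pose n := (Num.truncn (A * K ^+ m / ln 2)).+1.
have := main2 n; rewrite leNgt => /negP; apply.
rewrite -ltr_pdivrMr ?ln2_gt0//; apply: lt_le_trans (truncnS_gt _) _.
by rewrite -natrX ler_nat ltnW// ltn_expl.
Qed.

(** By the identity theorem [iter k f] would be constant on the plane. A bound for an iterate on the
    whole plane passes to the preceding one by [iterate_bound_step], in the end to the identity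
    map. *)
Lemma iterate_nonconstant f k a (r : R) : transcendental_entire f -> 0 < r ->
  ~ (forall z, m|z - a| < r -> iter k f z = iter k f a).
Proof.
move=> tf r0 H; have hf := entire_dif tf.1.
have Hk : forall z, iter k f z = iter k f a.
  by apply: (identity_theorem r0 (dif_iter k hf)) => z; exact: H.
have [r1 r12 H1] := iterate_bound_step 0 tf.
pose B := m|iter k f a|.
have HB z : m|iter k f z| <= B by rewrite Hk.
clearbody B; clear H Hk; elim: k HB => [|k IH] HB.
  have B0 : 0 <= B by apply: le_trans (HB 0); exact: modulus_ge0.
  have := HB (rc (B + 1)); rewrite modulus_rc ger0_norm ?addr_ge0//.
  by rewrite gerDl ler10.
apply: IH => z; apply: (H1 (Num.max r1 m|z|)).
- by rewrite le_max lexx.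
- by move=> x _; exact: HB.
- by rewrite expr1 le_max lexx orbT.
Qed.

End IterateGrowth.

(** * Comparability of orbits in the Fatou set *)

Section Comparability.
Variable R : realType.
Implicit Types (a c z w : C R) (f g h F : C R -> C R).

(* Half the chordal distance to infinity; it is 1-Lipschitz for the chordal distance. *)
Definition height (p : sphere R) : R :=
  if p is Some z then (Num.sqrt (1 + m|z| ^+ 2))^-1 else 0.

Let root z := Num.sqrt (1 + m|z| ^+ 2).

Lemma root_ge1 z : 1 <= root z.
Proof. by rewrite -[leLHS]sqrtr1 ler_wsqrtr// lerDl sqr_ge0. Qed.

Lemma root_lip z w : `|root z - root w| <= m|z - w|.
Proof.
have rz0 : 0 < root z := lt_le_trans ltr01 (root_ge1 z).
have rw0 : 0 < root w := lt_le_trans ltr01 (root_ge1 w).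
have rr0 : 0 < root z + root w by rewrite addr_gt0.
have r2 x : root x ^+ 2 = 1 + m|x| ^+ 2 by rewrite sqr_sqrtr// addr_ge0// sqr_ge0.
have rm x : m|x| <= root x.
  by rewrite -[leLHS]ger0_norm ?modulus_ge0// -sqrtr_sqr ler_wsqrtr// lerDr.
rewrite -(ler_pM2r rr0) -{1}(gtr0_norm rr0) -normrM -subr_sqr !r2 opprD addrACA subrr add0r.
rewrite subr_sqr normrM; apply: ler_pM; rewrite ?normr_ge0//.
  by rewrite ler_norml lerNl opprB {1}modulusB !ler_modulusB.
by rewrite ger0_norm ?addr_ge0 ?modulus_ge0// lerD.
Qed.

Lemma height_lip z (q : sphere R) : `|height (Some z) - height q| <= chordal (Some z) q.
Proof.
have rz0 : 0 < root z := lt_le_trans ltr01 (root_ge1 z).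
case: q => [w|] /=; rewrite -!/(root _).
  have rw0 : 0 < root w := lt_le_trans ltr01 (root_ge1 w).
  have -> : (root z)^-1 - (root w)^-1 = (root w - root z) / (root z * root w).
    by field; rewrite !gt_eqF.
  rewrite normrM normfV (gtr0_norm (mulr_gt0 rz0 rw0)) ler_pM2r ?invr_gt0 ?mulr_gt0//.
  rewrite distrC; apply: le_trans (root_lip z w) _.
  by rewrite ler_peMl ?modulus_ge0// ler1n.
rewrite subr0 ger0_norm ?invr_ge0 ?(ltW rz0)//.
by rewrite ler_peMl ?invr_ge0 ?(ltW rz0)// ler1n.
Qed.

Lemma chordal_le z w : chordal (Some z) (Some w) <= 2 * m|z - w|.
Proof.
rewrite /= -!/(root _); have r1 : 1 <= root z * root w by rewrite mulr_ege1// root_ge1.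
rewrite ler_pdivrMr ?(lt_le_trans ltr01 r1)// ler_peMr// mulr_ge0//; exact: modulus_ge0.
Qed.

Lemma chordal_infty_lt z (M : R) : 0 < M -> M < m|z| -> chordal (Some z) None < 2 / M.
Proof.
move=> M0 Mz; rewrite /= -/(root z) ltr_pM2l// ltf_pV2 ?posrE ?(lt_le_trans ltr01 (root_ge1 z))//.
have lt : M ^+ 2 < 1 + m|z| ^+ 2.
  by rewrite (@le_lt_trans _ _ (m|z| ^+ 2)) ?ltrDr// lerXn2r ?nnegrE ?modulus_ge0 ?ltW.
by rewrite -(ger0_norm (ltW M0)) -sqrtr_sqr ltr_sqrt// (le_lt_trans (sqr_ge0 _) lt).
Qed.

Lemma height_small z : 20 < m|z| -> height (Some z) <= 1 / 20.
Proof.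
move=> z20; rewrite /= -/(root z) div1r lef_pV2 ?posrE ?(lt_le_trans ltr01 (root_ge1 z))//.
rewrite -(ger0_norm (ler0n R 20)) -sqrtr_sqr ler_wsqrtr// ler_wpDl// lerXn2r ?nnegrE ?modulus_ge0//.
exact: ltW.
Qed.

Lemma height_large z : m|z| <= 2 -> 2 / 5 <= height (Some z).
Proof.
move=> z2; rewrite /= -/(root z) -[2 / 5]invrK lef_pV2 ?posrE ?invr_gt0 ?divr_gt0 ?(lt_le_trans ltr01 (root_ge1 z))//.
have h0 : 0 <= (2 / 5)^-1 :> R by rewrite invr_ge0 divr_ge0.
rewrite -(ger0_norm h0) -sqrtr_sqr ler_wsqrtr//.
have : m|z| ^+ 2 <= 2 ^+ 2 by rewrite lerXn2r ?nnegrE ?modulus_ge0.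
have -> : (2 / 5 : R)^-1 ^+ 2 = 25 / 4 by field.
rewrite (_ : 2 ^+ 2 = 4); last by rewrite -natrX.
by clear; lra.
Qed.

(** Otherwise there are iterates f^k taking, at points tending to [z0], both a value of modulus
    above 20 and one of modulus at most 2. A limit function is not known to be continuous, so a
    subsequence is compared through it with one fixed iterate, which is continuous at [z0]. *)
Lemma normal_dichotomy f (U : set (C R)) z0 : (forall z, exists l, dif id f z l) ->
  open_nbhs z0 U -> normal_family U (iterates f) ->
  exists2 d : R, 0 < d & disc z0 d `<=` U /\ forall k, (0 < k)%N ->
    (forall z, disc z0 d z -> m|iter k f z| <= 20) \/
    (forall z, disc z0 d z -> 2 < m|iter k f z|).
Proof.
move=> hf [oU Uz0] nf.
have /nbhs_modulusP[d0 d00 Hd0] : nbhs z0 U by exact: open_nbhs_nbhs.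
apply: contrapT => noz.
have bad (n : nat) : exists t : nat * (C R * C R), [/\ (0 < t.1)%N,
    m|t.2.1 - z0| < n.+1%:R^-1, m|t.2.2 - z0| < n.+1%:R^-1,
    20 < m|iter t.1 f t.2.1| & m|iter t.1 f t.2.2| <= 2].
  apply: contrapT => nt; apply: noz; exists (Num.min d0 n.+1%:R^-1).
    by rewrite lt_min d00 invr_gt0 ltr0n.
  split => [z|k k0]; first by rewrite /disc /= lt_min => /andP[/Hd0].
  have [H|/existsNP[z /not_implyP[zd Hz]]] := pselect (forall z, disc z0 (Num.min d0 n.+1%:R^-1) z -> m|iter k f z| <= 20).
    by left.
  right => w wd; rewrite ltNge; apply/negP => Hw; apply: nt; exists (k, (z, w)).
  move: zd wd; rewrite /disc /= !lt_min => /andP[_ zd] /andP[_ wd]; split => //=.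
  by rewrite ltNge; apply/negP.
have [t Ht] := choice bad.
pose s n := iter (t n).1 f.
have [|phi phi_inc [g Hg]] := nf s.
  by move=> n; exists (t n).1 => //; have [] := Ht n.
have [V [[oV Vz0] HV]] := Hg z0 Uz0.
(* The errors add up to less than 6 e = 3/10, while the two heights differ by at least 2/5 - 1/20 =
   7/20. *)
pose e : R := 1 / 20; have e0 : 0 < e by rewrite divr_gt0.
have [N _ HN] := HV e e0.
have cN : {for z0, continuous (s (phi N))}.
  by have [l Hl] := dif_iter (t (phi N)).1 hf z0; exact: (dif_cont (@continuous_idC R) Hl).
have e20 : 0 < e / 2 by rewrite divr_gt0.
have /(cvg_modulusP (nbhs_filter z0)) /(_ _ e20) N1 := cN.
have N2 : nbhs z0 V by exact: open_nbhs_nbhs.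
have N3 : nbhs z0 U by exact: open_nbhs_nbhs.
have [d dp Hd] := (nbhs_modulusP _ _).1 (filterI N1 (filterI N2 N3)).
pose n := maxn N (Num.truncn d^-1).
have phi_ge k : (k <= phi k)%N.
  by elim: k => [//|k IH]; apply: leq_ltn_trans IH _; exact: phi_inc.
have nd : (phi n).+1%:R^-1 < d.
  rewrite invf_plt ?posrE//; apply: lt_le_trans (truncnS_gt _) _.
  by rewrite ler_nat ltnS (leq_trans (leq_maxr N _))// phi_ge.
have [_ zn wn zb wb] := Ht (phi n).
have := Hd _ (lt_trans zn nd); have := Hd _ (lt_trans wn nd).
set z := (t (phi n)).2.1 in zn zb *; set w := (t (phi n)).2.2 in wn wb *.
move=> [wN [Vw Uw]] [zN [Vz Uz]].
have Nn : (N <= n)%N by rewrite leq_maxl.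
have A1 := le_lt_trans (height_lip _ _) (HN n Nn z (conj Uz Vz)).
have A2 := le_lt_trans (height_lip _ _) (HN n Nn w (conj Uw Vw)).
have A3 := le_lt_trans (height_lip _ _) (HN N (leqnn N) z (conj Uz Vz)).
have A4 := le_lt_trans (height_lip _ _) (HN N (leqnn N) w (conj Uw Vw)).
have A5 := le_trans (height_lip _ _) (chordal_le (s (phi N) z) (s (phi N) w)).
have A6 : m|s (phi N) z - s (phi N) w| < e.
  apply: le_lt_trans (modulus_tri (s (phi N) z0) _ _) _.
  by rewrite (splitr e) ltrD// modulusB.
have A7 := height_small zb; have A8 := height_large wb.
move: A1 A2 A3 A4 A5 A6 A7 A8; rewrite -/(s (phi n)) /comp !ltr_norml ler_norml.
have eE : e = 1 / 20 by []. clearbody e.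
move: (height (Some (s (phi n) z))) (height (Some (s (phi n) w))) (height (g z)) (height (g w)).
move: (height (Some (s (phi N) z))) (height (Some (s (phi N) w))) (m|s (phi N) z - s (phi N) w|).
move=> a1 a2 a3 a4 a5 a6 a7; move: eE; clear; move=> eE /andP[? ?] /andP[? ?] /andP[? ?] /andP[? ?] /andP[? ?].
by lra.
Qed.

Definition orbit_union f (U : set (C R)) : set (C R) :=
  \bigcup_(k in [set k | (0 < k)%N]) (iter k f @` U).

Lemma orbit_union_forward f U z : orbit_union f U z -> orbit_union f U (f z).
Proof. by move=> [k k0 [x Ux <-]]; exists k.+1 => //; exists x. Qed.

(** With y = f^k(x), a disc about y is covered by f^k of a disc about x, because f^k is open there;
    the j-th iterate at y is the (j+k)-th at x, so the dichotomy at x gives a constant independent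
    of y and j. *)
Lemma locally_comparable f U y : transcendental_entire f -> open U ->
  normal_family U (iterates f) -> orbit_union f U y ->
  exists2 d : R, 0 < d & disc y d `<=` orbit_union f U /\
    forall z w, disc y d z -> disc y d w -> forall k,
      logsize (iter k f z) <= compare_const R * logsize (iter k f w).
Proof.
move=> tf oU nf [k k0 [x Ux <-]]; have hf := entire_dif tf.1.
have [d d0 [dU Hd]] := normal_dichotomy hf (conj oU Ux) nf.
have d80 : 0 < d / 8 by rewrite divr_gt0.
have sub8 : disc x (d / 8) `<=` disc x d.
  by move=> z; rewrite /disc /= => zd; apply: lt_trans zd _; move: d0; clear; lra.
have [|/nbhs_modulusP[e e0 He]|cst] := @open_mapping R x (d / 8) (iter k f) d80.
- by move=> z _; exact: dif_iter.
- exists e => //; split.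
    by move=> z /He[u /sub8 /dU Uu <-]; exists k => //; exists u.
  move=> z w /He[u ud <-] /He[v vd <-] j; rewrite -!iterD.
  have kj : (0 < j + k)%N by rewrite addn_gt0 k0 orbT.
  apply: (@logsize_compare R x d (iter (j + k) f) d0 _ (Hd _ kj) u v ud vd).
  by move=> q _; exact: dif_iter.
- by exfalso; apply: (@iterate_nonconstant R f k x (d / 8 / 2)) => //; rewrite divr_gt0.
Qed.

Section Chains.
Variables (f : C R -> C R) (O : set (C R)) (K : R).
Hypotheses (K1 : 1 <= K)
  (loc : forall y, O y -> exists2 d : R, 0 < d & disc y d `<=` O /\
    forall z w, disc y d z -> disc y d w -> forall k,
      logsize (iter k f z) <= K * logsize (iter k f w)).

Definition comparable z w := exists A : R, forall k,
  logsize (iter k f z) <= A * logsize (iter k f w).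

Lemma comparable_trans y z w : comparable z y -> comparable y w -> comparable z w.
Proof.
move=> [A HA] [B HB]; exists (`|A| * B) => k; apply: le_trans (HA k) _.
apply: (@le_trans _ _ (`|A| * logsize (iter k f y))).
  by rewrite ler_wpM2r ?ler_norm// ltW// logsize_gt0.
by rewrite -mulrA ler_wpM2l ?normr_ge0.
Qed.

(** Compactness of [0, 1] gives a common step length; finitely many local comparisons are then
    composed. *)
Lemma comparable_seg a b : (forall t : R, 0 <= t <= 1 -> O (seg a b t)) ->
  comparable a b /\ comparable b a.
Proof.
move=> Oab.
pose P (d t : R) := forall s, `|s - t| < d -> comparable (seg a b s) (seg a b t) /\
  comparable (seg a b t) (seg a b s).
have H : \forall d \near (0 : R)^'+, `[0, 1]%classic `<=` P d.
  apply: ((compact_near_coveringP _).1 (@segment_compact R 0 1)) => x xI.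
  have Ix : 0 <= x <= 1 by move: xI; rewrite /= in_itv.
  have [d d0 [_ Hd]] := loc (Oab x Ix).
  have /(cvg_modulusP (nbhs_filter x)) /(_ _ d0) := @continuous_seg R a b x.
  move=> /nbhs_normP[e /= e0 He].
  have e20 : 0 < e / 2 by rewrite divr_gt0.
  exists ([set t | `|t - x| < e / 2], [set s | s < e / 2]) => /=.
    by split; [exact: near_real|exact: nbhs_right_lt].
  move=> [t s] /= [tx se] u ut.
  have tx' : disc (seg a b x) d (seg a b t).
    by apply: He; rewrite /= distrC (lt_trans tx)// ltr_pdivrMr// ltr_pMr// ltr1n.
  have ux' : disc (seg a b x) d (seg a b u).
    apply: He; rewrite /= distrC -(subrK t u) -addrA; apply: le_lt_trans (ler_normD _ _) _.
    by rewrite (splitr e) ltrD// (lt_trans ut).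
  by split; exists K; exact: Hd.
have [d [d0 Hd]] := filter_ex (filterI (nbhs_right_gt (0 : R)) H).
pose n := (Num.truncn d^-1).+1.
have n0 : 0 < n%:R :> R by rewrite ltr0n.
have step k : (k <= n)%N -> comparable (seg a b (k%:R / n%:R)) a /\
    comparable a (seg a b (k%:R / n%:R)).
  elim: k => [_|k IH kn]; first by rewrite mul0r seg0; split; exists 1 => k; rewrite mul1r.
  have [H1 H2] := IH (ltnW kn).
  have kI : `[0, 1]%classic (k%:R / n%:R : R).
    by rewrite /= in_itv /= divr_ge0 ?ler0n//= ler_pdivrMr// mul1r ler_nat ltnW.
  have [|H3 H4] := Hd _ kI (k.+1%:R / n%:R).
    rewrite -mulrBl -natrB// subSnn mul1r ger0_norm ?invr_ge0 ?ler0n//.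
    by rewrite invf_plt ?posrE// truncnS_gt.
  by split; [exact: comparable_trans H3 H1|exact: comparable_trans H2 H4].
by have := step n (leqnn n); rewrite divff ?gt_eqF// seg1 => -[].
Qed.

(** Each point has its own constant against [p]; near the point the local factor [K] spreads it, and
    compactness makes the constant common. *)
Lemma comparable_uniform (S : set (C R)) p : compact S -> S `<=` O ->
  (forall z, O z -> comparable z p) -> exists A : R, forall z, S z -> forall k,
    logsize (iter k f z) <= A * logsize (iter k f p).
Proof.
move=> cS SO Hp; have K0 : 0 <= K by exact: le_trans ler01 K1.
pose P (A : R) z := forall k, logsize (iter k f z) <= A * logsize (iter k f p).
have H : \forall A \near +oo, S `<=` P A.
  apply: ((compact_near_coveringP _).1 cS) => x Sx.
  have [d d0 [_ Hd]] := loc (SO x Sx); have [A HA] := Hp x (SO x Sx).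
  exists ([set z | m|z - x| < d], [set B | K * A <= B]) => /=.
    by split; [exact: near_complex|apply: nbhs_pinfty_ge; exact: num_real].
  move=> [z B] /= [zd AB] k; apply: (@le_trans _ _ (K * A * logsize (iter k f p))).
    rewrite -mulrA; apply: (@le_trans _ _ (K * logsize (iter k f x))).
      by apply: Hd => //; rewrite /disc /= subrr modulus0.
    by rewrite ler_wpM2l.
  by rewrite ler_wpM2r// ltW// logsize_gt0.
have [A HA] := filter_ex H.
by exists A.
Qed.

Hypotheses (fO : forall z, O z -> O (f z))
  (vline : forall x y : R, x < y -> exists2 t : R, x < t < y & forall s, O (Complex t s))
  (hline : forall x y : R, x < y -> exists2 t : R, x < t < y & forall s, O (Complex s t)).

Lemma seg_vertical (x y1 y2 t : R) : exists s, seg (Complex x y1) (Complex x y2) t = Complex x s.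
Proof.
exists (y1 + t * (y2 - y1)); apply/eqP; rewrite /seg eq_complex /=.
by apply/andP; split; apply/eqP; ring.
Qed.

Lemma seg_horizontal (x1 x2 y t : R) : exists s, seg (Complex x1 y) (Complex x2 y) t = Complex s y.
Proof.
exists (x1 + t * (x2 - x1)); apply/eqP; rewrite /seg eq_complex /=.
by apply/andP; split; apply/eqP; ring.
Qed.

(** The path from z makes a local jump to a vertical line in [O] close to z, follows it to height
    [y0], and then follows the horizontal line to the target. *)
Lemma all_comparable (x0 y0 : R) : (forall s, O (Complex x0 s)) -> (forall s, O (Complex s y0)) ->
  forall z, O z -> comparable z (Complex x0 y0).
Proof.
move=> V0 H0 z Oz; have [d d0 [_ Hd]] := loc Oz.
have [|t /andP[t1 t2] Vt] := @vline (Re z) (Re z + d); first by rewrite ltrDl.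
apply: (@comparable_trans (Complex t (Im z))).
  exists K; apply: Hd; rewrite /disc /= ?subrr ?modulus0//.
  apply: le_lt_trans (modulus_le _) _; rewrite ReB ImB /= subrr normr0 addr0.
  by rewrite ger0_norm ?subr_ge0 ?ltW// ltrBlDl.
apply: (@comparable_trans (Complex t y0)).
  by apply: (comparable_seg _).1 => s _; have [q ->] := seg_vertical t (Im z) y0 s; exact: Vt.
by apply: (comparable_seg _).1 => s _; have [q ->] := seg_horizontal t x0 y0 s; exact: H0.
Qed.

Definition rectangle (x1 x2 y1 y2 : R) : set (C R) :=
  [set z | x1 <= Re z <= x2 /\ y1 <= Im z <= y2].

Lemma iterate_slow (r : R) : (forall z, exists l, dif id f z l) ->
  exists A B : R, forall n z, m|z| <= r -> logsize (iter n f z) <= A * B ^+ n.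
Proof.
move=> hf; pose r' := `|r| + 1.
have [|x1 /andP[_ x1r] V1] := @vline (- r' - 1) (- r'); first by rewrite gtrBl.
have [|x2 /andP[x2r _] V2] := @vline r' (r' + 1); first by rewrite ltrDl.
have [|y1 /andP[_ y1r] H1] := @hline (- r' - 1) (- r'); first by rewrite gtrBl.
have [|y2 /andP[y2r _] H2] := @hline r' (r' + 1); first by rewrite ltrDl.
(* [p] is a corner of the rectangle; comparing it with [f p] makes [logsize] grow at most by the
   factor [A] with each iteration. *)
pose p := (Complex x1 y1 : C R); have Op : O p by exact: V1.
have allp z : O z -> comparable z p by exact: all_comparable.
have [A HA] := allp (f p) (fO Op).
have A0 : 0 <= A.
  have := HA 0%N => /= H; rewrite leNgt; apply/negP => An.
  have := lt_le_trans (logsize_gt0 _) H; rewrite ltNge => /negP; apply.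
  by rewrite mulr_le0_ge0 ?(ltW An)// ltW// logsize_gt0.
have Hp k : logsize (iter k f p) <= A ^+ k * logsize p.
  elim: k => [|k IH]; first by rewrite expr0 mul1r.
  by rewrite iterSr; apply: le_trans (HA k) _; rewrite exprS -mulrA ler_wpM2l.
pose Q := rectangle x1 x2 y1 y2.
(* [bd] consists of the four complete lines; its part inside [Q] is the boundary of the
   rectangle. *)
pose bd : set (C R) := [set z | Re z = x1 \/ Re z = x2 \/ Im z = y1 \/ Im z = y2].
have bdO : bd `<=` O.
  by move=> z; case: z => a b; rewrite /bd /= => -[->|[->|[->|->]]]; [exact: V1|exact: V2|exact: H1|exact: H2].
have clQ : closed Q.
  have cl (g : C R -> R) (a b : R) : continuous g -> closed [set z | a <= g z <= b].
    move=> cg; rewrite (_ : [set z | _] = g @^-1` [set x | a <= x] `&` g @^-1` [set x | x <= b]); last first.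
      by apply/seteqP; split => z /=; [move/andP|move=> [-> ->]].
    by apply: closedI; apply: (@preimage_closed _ _ g); [move=> ? _; exact: cg|exact: closed_ge|move=> ? _; exact: cg|exact: closed_le].
  by apply: closedI; apply: cl; [exact: continuous_Re|exact: continuous_Im].
have bQ z : Q z -> m|z| <= (`|x1| + `|x2|) + (`|y1| + `|y2|).
  move=> [/andP[a1 a2] /andP[b1 b2]]; apply: le_trans (modulus_le _) _.
  have nb (u v w : R) : u <= w -> w <= v -> `|w| <= `|u| + `|v|.
    move=> uw wv; have := ler_norm v; have := ler_norm (- u); rewrite normrN.
    have := normr_ge0 u; have := normr_ge0 v; rewrite ler_norml; move: uw wv; clear => *.
    by apply/andP; split; lra.
  by rewrite lerD// nb.
have cQ : compact Q by exact: closed_bounded_compact clQ bQ.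
have clbd : closed bd.
  have cl (g : C R -> R) (a : R) : continuous g -> closed [set z | g z = a].
    by move=> cg; apply: (@preimage_closed _ _ g [set x | x = a]); [move=> ? _; exact: cg|exact: closed_eq].
  rewrite (_ : bd = [set z | Re z = x1] `|` ([set z | Re z = x2] `|` ([set z | Im z = y1] `|` [set z | Im z = y2]))) //.
  by apply: closedU; [|apply: closedU; [|apply: closedU]]; apply: cl; [exact: continuous_Re|exact: continuous_Re|exact: continuous_Im|exact: continuous_Im].
have cbd : compact (Q `&` bd).
  by apply: (subclosed_compact _ cQ) => [|z []//]; exact: closedI.
have [B HB] := comparable_uniform cbd (fun z '(conj _ H) => bdO z H) allp.
exists (`|B| * logsize p), A => n z zr.
(* Subtracting 2 undoes the shift in [logsize], so that the maximum principle is applied to the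
   modulus itself. *)
have bound w : Q w -> m|iter n f w| <= expR (`|B| * logsize p * A ^+ n) - 2.
  apply: (maximum_principle cQ) => [x _|x Qx].
    by have [l Hl] := dif_iter n hf x; exact: (dif_cont (@continuous_idC R) Hl).
  have [bx|bx] := pselect (bd x).
    left; rewrite lerBrDl -[leLHS]lnK ?posrE ?ltr_wpDr ?modulus_ge0// ler_expR -/(logsize _).
    apply: le_trans (HB x (conj Qx bx) n) _.
    apply: (@le_trans _ _ (`|B| * logsize (iter n f p))).
      by rewrite ler_wpM2r ?ler_norm// ltW// logsize_gt0.
    by rewrite -mulrA ler_wpM2l// [leRHS]mulrC.
  right; have [/andP[a1 a2] /andP[b1 b2]] := Qx.
  have ne : [/\ Re x != x1, Re x != x2, Im x != y1 & Im x != y2].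
    by split; apply/eqP => E; apply: bx; rewrite /bd /= E; tauto.
  case: ne => n1 n2 n3 n4.
  pose e := Num.min (Num.min (Re x - x1) (x2 - Re x)) (Num.min (Im x - y1) (y2 - Im x)).
  exists e; first by rewrite /e !lt_min !subr_gt0 !lt_neqAle a1 a2 b1 b2 n2 n4 !(eq_sym x1) !(eq_sym y1) n1 n3.
  split => [v|v _]; last exact: dif_iter.
  rewrite /disc /e /= !lt_min => /andP[/andP[c1 c2] /andP[c3 c4]].
  have := ler_Re (v - x); have := ler_Im (v - x); rewrite ReB ImB !ler_norml.
  move: c1 c2 c3 c4; rewrite /Q /rectangle /=; clear => c1 c2 c3 c4 /andP[? ?] /andP[? ?].
  by split; apply/andP; split; lra.
have Qz : Q z.
  have := ler_Re z; have := ler_Im z; rewrite !ler_norml.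
  have rr : r <= r' by rewrite /r' (le_trans (ler_norm r))// lerDl.
  move: zr x1r x2r y1r y2r; rewrite /Q /rectangle /= => ? ? ? ? ? /andP[? ?] /andP[? ?].
  by split; apply/andP; split; lra.
have := bound z Qz; rewrite lerBrDl /logsize => H.
by rewrite -ler_expR lnK// posrE ltr_wpDr ?modulus_ge0.
Qed.

End Chains.

Lemma no_lines f U : transcendental_entire f -> open U -> normal_family U (iterates f) ->
  (forall x y : R, x < y -> exists2 t : R, x < t < y & forall s, orbit_union f U (Complex t s)) ->
  (forall x y : R, x < y -> exists2 t : R, x < t < y & forall s, orbit_union f U (Complex s t)) ->
  False.
Proof.
move=> tf oU nf vl hl; have [r1 Hr1] := iterate_growth tf.
have K1 : 1 <= compare_const R.
  by rewrite /compare_const; have := schottky_bound_ge1 (1 : R); clear; lra.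
have [A [B HAB]] := iterate_slow K1 (fun y => @locally_comparable f U y tf oU nf)
  (@orbit_union_forward f U) vl hl r1 (entire_dif tf.1).
have [n [z [zr Hz]]] := Hr1 A B.
by move: Hz; rewrite ltNge HAB.
Qed.

End Comparability.

(** * Sets of capacity zero *)

Section NullProjections.
Variable R : realType.
Local Notation mu := (@lebesgue_measure R).

(** The sigma-algebra is the product one; an open set belongs to it as a countable union of squares
    with rational centres and sides 2 / (n + 1). *)
Lemma open_measurable_plane (W : set (R * R)) : open W ->
  measurable (W : set (measurableTypeR R * measurableTypeR R)).
Proof.
move=> oW; pose rect (i : rat * rat * nat) : set (R * R) :=
  `]ratr i.1.1 - i.2.+1%:R^-1, ratr i.1.1 + i.2.+1%:R^-1[%classic `*`
  `]ratr i.1.2 - i.2.+1%:R^-1, ratr i.1.2 + i.2.+1%:R^-1[%classic.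
have -> : W = \bigcup_i (if `[< rect i `<=` W >] then rect i else set0).
  apply/seteqP; split; last by move=> p [i _]; case: asboolP => // H; exact: H.
  move=> [x y] Wxy; have [[P Q] /= [Px Qy] PQW] : nbhs (x, y) W by exact: open_nbhs_nbhs.
  have [e1 /= e10 H1] := (nbhs_normP _ _).1 Px; have [e2 /= e20 H2] := (nbhs_normP _ _).1 Qy.
  pose e := Num.min e1 e2; have e0 : 0 < e by rewrite lt_min e10.
  pose n := Num.truncn (2 / e); pose d : R := n.+1%:R^-1.
  have d0 : 0 < d by rewrite invr_gt0 ltr0n.
  have de : 2 * d < e.
    by rewrite /d ltr_pdivrMr ?ltr0n// mulrC -ltr_pdivrMr// truncnS_gt.
  have lt_d (t : R) : t - d < t by rewrite gtrBl.
  have [q1 Hq1] := rat_in_itvoo (lt_d x); have [q2 Hq2] := rat_in_itvoo (lt_d y).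
  move: Hq1 Hq2; rewrite !in_itv /= => /andP[a1 a2] /andP[b1 b2].
  have sub : rect (q1, q2, n) `<=` W.
    move=> [u v] /= []; rewrite /= !in_itv /= -/d => /andP[u1 u2] /andP[v1 v2].
    apply: PQW; split => /=; [apply: H1|apply: H2] => /=.
      have : e <= e1 by rewrite ge_min lexx.
      by move: de a1 a2 u1 u2; clear => *; rewrite ltr_norml; apply/andP; split; lra.
    have : e <= e2 by rewrite ge_min lexx orbT.
    by move: de b1 b2 v1 v2; clear => *; rewrite ltr_norml; apply/andP; split; lra.
  exists (q1, q2, n) => //; case: asboolP => // _.
  by rewrite /rect /= !in_itv /= -/d; move: a1 a2 b1 b2 d0; clear => *; split; apply/andP; split; lra.
apply: countable_bigcupT_measurable => // i; case: asboolP => // _.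
by apply: measurableX; exact: measurable_itv.
Qed.

Lemma continuous_measurable_plane (w : R * R -> R) : continuous w ->
  measurable_fun setT (w : measurableTypeR R * measurableTypeR R -> R).
Proof.
move=> cw; apply: (measurability _ (RGenOpens.measurableE R)).
move=> _ [_ [a [b ->] <-]]; rewrite setTI; apply: open_measurable_plane.
apply: open_comp; first by move=> x _; exact: cw.
exact: interval_open.
Qed.

Lemma derivable_LRcontinuous (F : R -> R) (a b : R) : a < b ->
  (forall t, a <= t <= b -> derivable F t 1) -> derivable_oo_LRcontinuous F a b.
Proof.
move=> ab dF; have cF t : a <= t <= b -> {for t, continuous F}.
  by move=> /dF H; apply/differentiable_continuous/derivable1_diffP.
split.
- by move=> t; rewrite in_itv /= => /andP[t1 t2]; apply: dF; rewrite !ltW.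
- by apply: cvg_at_right_filter; apply: cF; rewrite lexx ltW.
- by apply: cvg_at_left_filter; apply: cF; rewrite lexx ltW.
Qed.

(* A drop of height 1 over a length at most 2 L costs energy at least 1 / (2 L); the
   Cauchy-Schwarz inequality enters as L v^2 + v + 1 / (4 L) >= 0. *)
Lemma line_energy (h v : R -> R) (y0 L : R) : 0 < L -> - L <= y0 < L ->
  (forall y : R, is_derive y 1 h (v y)) -> continuous v -> 1 <= h y0 -> h L = 0 ->
  ((2 * L)^-1%:E <= \int[mu]_y ((v y) ^+ 2)%:E)%E.
Proof.
move=> L0 /andP[y0L yL] dh cv h1 hL.
have cv2 : continuous (fun y => v y ^+ 2).
  by move=> y; apply: continuousM; exact: cv.
have [W dW] := @continuous_primitive R (fun y => v y ^+ 2) y0 L cv2.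
have dWW t : y0 <= t <= L -> derivable W t 1 by move=> /dW[].
have int : (\int[mu]_(x in `[y0, L]) (v x ^+ 2)%:E = (W L)%:E - (W y0)%:E)%E.
  apply: continuous_FTC2 => //.
  - exact: continuous_subspaceT.
  - exact: derivable_LRcontinuous.
  - move=> t; rewrite in_itv /= => /andP[t1 t2]; rewrite derive1E.
    by have [_ ->] := dW t (introT andP (conj (ltW t1) (ltW t2))).
(* L W + h + t / (4 L) is nondecreasing, its derivative being L (v + 1 / (2 L))^2. Between [y0] and
   [L] the middle term loses at least 1 and the last gains at most 1/2, so the first gains at least
   1/2. *)
have mono : 1 / 2 <= L * (W L - W y0).
  have dk t : y0 <= t <= L -> is_derive t 1 (fun t => L * W t + h t + (4 * L)^-1 * t)
      (L * v t ^+ 2 + v t + (4 * L)^-1 * 1).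
    move=> It; have ? := dW t It; have ? := dh t.
    by apply: is_deriveD.
  have [||c cI Hc] := @MVT R (fun t => L * W t + h t + (4 * L)^-1 * t)
     (fun t => L * v t ^+ 2 + v t + (4 * L)^-1 * 1) y0 L yL.
  - by move=> t; rewrite in_itv /= => /andP[t1 t2]; apply: dk; rewrite !ltW.
  - apply: derivable_within_continuous => t; rewrite in_itv /= => It.
    by have [] := dk t It.
  have sq : 0 <= L * v c ^+ 2 + v c + (4 * L)^-1 * 1.
    have -> : L * v c ^+ 2 + v c + (4 * L)^-1 * 1 = L * (v c + (2 * L)^-1) ^+ 2.
      by field; rewrite gt_eqF.
    by rewrite mulr_ge0 ?sqr_ge0// ltW.
  have : 0 <= (L * v c ^+ 2 + v c + (4 * L)^-1 * 1) * (L - y0).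
    by rewrite mulr_ge0// subr_ge0 ltW.
  rewrite -Hc hL addr0.
  have q : (4 * L)^-1 * L - (4 * L)^-1 * y0 <= 1 / 2.
    rewrite -mulrBr mulrC ler_pdivrMr ?mulr_gt0//; move: y0L; clear; lra.
  by move: q h1; rewrite mulrBr; clear; lra.
apply: (@le_trans _ _ (\int[mu]_(x in `[y0, L]) (v x ^+ 2)%:E)%E).
  rewrite int -EFinB lee_fin -(ler_pM2l L0); apply: le_trans mono.
  by rewrite le_eqVlt; apply/orP; left; apply/eqP; field; rewrite gt_eqF.
apply: ge0_subset_integral => //.
- apply/measurable_EFinP; exact: continuous_measurable_fun.
- by move=> x _; rewrite lee_fin sqr_ge0.
Qed.

(** The boolean names the coordinate that receives [x], so that one argument treats both
    projections; [y] runs along the line. *)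
Definition plane_point (b : bool) (x y : R) : R * R := if b then (y, x) else (x, y).
Definition coordinate (b : bool) (p : R * R) : R := if b then p.2 else p.1.

Lemma continuous_plane_point b x : continuous (plane_point b x).
Proof.
case: b => y; rewrite /plane_point.
  move=> W [[P Q] /= [Py Qx] PQ]; apply: filterS Py => s Ps.
  by apply: PQ; split => //; exact: nbhs_singleton Qx.
move=> W [[P Q] /= [Px Qy] PQ]; apply: filterS Qy => s Qs.
by apply: PQ; split => //; exact: nbhs_singleton Px.
Qed.

Lemma is_derive_line (b : bool) (u : R * R -> R) x y :
  derivable u (plane_point b x y) (basis_vec R (~~ b)) ->
  is_derive y 1 (fun y => u (plane_point b x y)) (partial (~~ b) u (plane_point b x y)).
Proof.
move=> du; set hh := fun y => _.
have E : (fun h : R => h^-1 *: ((hh \o shift y) (h *: 1) - hh y)) =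
   (fun h : R => h^-1 *: ((u \o shift (plane_point b x y)) (h *: basis_vec R (~~ b)) - u (plane_point b x y))).
  apply/funext => h; congr (_ *: (u _ - _)); rewrite /hh /plane_point /basis_vec /=.
  by case: b {du hh} => /=; rewrite /shift; congr (_, _); rewrite /= -[_ *: _]/(_ * _) ?mulr0 ?mulr1 ?add0r.
by apply: DeriveDef; rewrite /derivable /partial /derive E.
Qed.

Lemma partial_off_support (u : R * R -> R) i p : ~ closure [set p | u p != 0] p ->
  u p = 0 /\ partial i u p = 0.
Proof.
move=> np; have near0 : \forall q \near p, u q = 0.
  have : nbhs p (~` closure [set p | u p != 0]).
    by apply: open_nbhs_nbhs; split => //; apply: closed_openC; exact: closed_closure.
  apply: filterS => q nq; apply: contrapT => /eqP uq; apply: nq; exact: subset_closure.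
split; first exact: (nbhs_singleton near0).
rewrite /partial (@near_eq_derive _ _ _ _ (cst 0)); first exact: derive_cst.
exact: near0.
Qed.

Lemma bounded_compact_plane (E : set (R * R)) (M : R) : closed E ->
  (forall p, E p -> `|p.1| <= M /\ `|p.2| <= M) -> compact E.
Proof.
move=> clE bE; apply: (subclosed_compact clE (compact_setX (@segment_compact R (- M) M) (@segment_compact R (- M) M))).
by move=> p /bE[p1 p2]; split; rewrite /= in_itv /= -ler_norml.
Qed.

Lemma bounded_set_plane (E : set (R * R)) : bounded_set E ->
  exists2 M : R, 0 < M & forall p, E p -> `|p.1| < M /\ `|p.2| < M.
Proof.
move=> [M [_ HM]]; exists (`|M| + 2); first by rewrite ltr_wpDl.
move=> p /(HM (`|M| + 1) _) H; have {}H : `|p| <= `|M| + 1.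
  by apply: H; rewrite (le_lt_trans (ler_norm M))// ltrDl.
move: H; rewrite prod_normE ge_max => /andP[p1 p2].
have l2 : `|M| + 1 < `|M| + 2 by rewrite ltrD2l ltr1n.
by split; [exact: le_lt_trans p1 l2|exact: le_lt_trans p2 l2].
Qed.

Lemma fubini_lines (b : bool) (w : R * R -> R) : continuous w -> (forall p, 0 <= w p) ->
  let G x := (\int[mu]_y (w (plane_point b x y))%:E)%E in
  measurable_fun setT G /\ (\int[(mu \x mu)%E]_p (w p)%:E = \int[mu]_x G x)%E.
Proof.
move=> cw w0; have mw : measurable_fun setT (EFin \o w : measurableTypeR R * measurableTypeR R -> \bar R).
  by apply/measurable_EFinP; exact: continuous_measurable_plane.
have w0' p : (0 <= (EFin \o w) p)%E by rewrite lee_fin.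
case: b; split.
- exact: (@measurable_fun_fubini_tonelli_G _ _ _ _ _ mu (EFin \o w) mw w0').
- exact: (@fubini_tonelli2 _ _ _ _ _ mu mu (EFin \o w) mw w0').
- exact: (@measurable_fun_fubini_tonelli_F _ _ _ _ _ mu (EFin \o w) mw w0').
- exact: (@fubini_tonelli1 _ _ _ _ _ mu mu (EFin \o w) mw w0').
Qed.

(** Over each point of the projection the line meets [K], so by [line_energy] a test function spends
    at least 1 / (2 L) along it. By Fubini the total energy is at least the measure of the
    projection divided by 2 L, while the infimum of the energies is 0. *)
Lemma compact_cap_zero_null (K : set (R * R)) (b : bool) : compact K -> compact_cap_zero K ->
  mu.-negligible (coordinate b @` K).
Proof.
move=> cK [->|[A [oA bA KA cap0]]]; first by rewrite image_set0; exact: negligible_set0.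
have [L L0 HL] := bounded_set_plane bA.
pose P := coordinate b @` K.
have cP : compact P.
  apply: continuous_compact => //; apply: continuous_subspaceT => p.
  by case: b {P}; rewrite /coordinate; [exact: cvg_snd|exact: cvg_fst].
have mP : measurable P by exact: compact_measurable.
have L20 : 0 < (2 * L)^-1 by rewrite invr_gt0 mulr_gt0.
have key (e : R) : 0 < e -> ((2 * L)^-1%:E * mu P <= e%:E)%E.
  move=> e0; have : (capacity A K < e%:E)%E by rewrite cap0 lte_fin.
  move=> /ereal_inf_lt[_ [u [[su _ suppA] u0 u1] <-]] ue.
  have cu : continuous u by have [] := su [::].
  have du p i : derivable u p (basis_vec R i) by have [_] := su [::]; exact.
  have cpu i : continuous (partial i u) by have [] := su [:: i].
  pose w p := partial (~~ b) u p ^+ 2.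
  have cw : continuous w by move=> p; apply: continuousM; exact: cpu.
  have w0 p : ~ A p -> w p = 0.
    move=> nA; have [|_ E] := @partial_off_support u (~~ b) p; first by move=> /suppA.
    by rewrite /w E expr0n.
  have mw : measurable_fun setT (EFin \o w : measurableTypeR R * measurableTypeR R -> \bar R).
    by apply/measurable_EFinP; exact: continuous_measurable_plane.
  have gw p : w p <= grad_norm u p ^+ 2.
    rewrite /grad_norm sqr_sqrtr ?addr_ge0 ?sqr_ge0// /w.
    by case: b {w cw w0 mw P cP mP}; rewrite /= ?lerDl ?lerDr sqr_ge0.
  have mA : measurable (A : set (measurableTypeR R * measurableTypeR R)) by exact: open_measurable_plane.
  have wA : (\int[(mu \x mu)%E]_p (w p)%:E <= \int[(mu \x mu)%E]_(p in A) (grad_norm u p ^+ 2)%:E)%E.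
    have -> : (\int[(mu \x mu)%E]_p (w p)%:E = \int[(mu \x mu)%E]_(p in A) (w p)%:E)%E.
      rewrite [RHS]integral_mkcond; apply: eq_integral => p _.
      rewrite patchE; case: ifPn => //; rewrite notin_setE => /w0 ->; by [].
    apply: ge0_le_integral => //.
    - by move=> p _; rewrite lee_fin sqr_ge0.
    - exact: measurable_funTS.
    - apply/measurable_EFinP/measurable_funTS.
      rewrite (_ : (fun _ => _) = (fun p => partial false u p ^+ 2 + partial true u p ^+ 2)); last first.
        by apply/funext => p; rewrite /grad_norm sqr_sqrtr// addr_ge0// sqr_ge0.
      apply: continuous_measurable_plane => p.
      have H : {for p, continuous (fun p => partial false u p ^+ 2 + partial true u p ^+ 2)}.
        by apply: continuousD; apply: continuousM; exact: cpu.
      exact: H.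
    - by move=> p _; rewrite lee_fin.
  pose G x := (\int[mu]_y (w (plane_point b x y))%:E)%E.
  have [mG intG] := fubini_lines b cw (fun p => sqr_ge0 _).
  have G0 x : (0 <= G x)%E by apply: integral_ge0 => y _; rewrite lee_fin sqr_ge0.
  have GP x : P x -> ((2 * L)^-1%:E <= G x)%E.
    move=> [p Kp px]; pose y0 := coordinate (~~ b) p.
    have pE : p = plane_point b x y0.
      by rewrite -px /plane_point /y0 /coordinate; case: (p) => ? ?; case: (b).
    have [p1 p2] := HL p (KA _ Kp).
    have y0L : `|y0| < L by rewrite /y0 /coordinate; case: (~~ b).
    (* The point of [K], where [u] is at least 1, is compared with the point at height [L], which
       lies outside [A] because [L] exceeds all coordinates occurring in [A]. *)
    apply: (@line_energy (fun y => u (plane_point b x y)) (fun y => partial (~~ b) u (plane_point b x y)) y0) => //.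
    - by move: y0L; rewrite ltr_norml => /andP[/ltW -> ->].
    - by move=> y; exact: is_derive_line.
    - by move=> y; apply: (continuous_comp (@continuous_plane_point b x y)); exact: cpu.
    - by rewrite -pE; exact: u1.
    - apply: (partial_off_support true _).1 => /suppA /HL [].
      by rewrite /plane_point; case: (b) => /= h1 h2; [move: h1|move: h2]; rewrite gtr0_norm// ltxx.
  apply: le_trans (ltW ue); apply: le_trans wA; rewrite intG.
  rewrite -integral_cst//; apply: (@le_trans _ _ (\int[mu]_(x in P) G x)%E).
    apply: ge0_le_integral => //.
    - by move=> x _; rewrite lee_fin ltW.
    - exact: measurable_funTS.
  exact: ge0_subset_integral.
suff E0 : mu P = 0%E by exists P; split.
apply/eqP; rewrite eq_le measure_ge0 andbT; apply/lee_addgt0Pr => e e0; rewrite add0e.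
have := key (e / (2 * L)) (divr_gt0 e0 (mulr_gt0 (ltr0n _ 2) L0)).
rewrite EFinM muleC lee_pmul2r//.
Qed.

(** The projection is a countable union of null sets, so it cannot cover an interval. *)
Lemma cap_zero_lines (E : set (R * R)) (b : bool) x y : cap_zero E -> x < y ->
  exists2 t, x < t < y & forall p, E p -> coordinate b p != t.
Proof.
move=> [clE cap1 cap2] xy.
pose K n : set (R * R) := E `&` [set p | `|p.1| <= n%:R /\ `|p.2| <= n%:R].
have cK n : compact (K n).
  apply: (@bounded_compact_plane _ n%:R); last by move=> p [].
  apply: closedI => //; apply: closedI.
    apply: (@closed_comp _ _ (fun p : R * R => `|p.1|) [set s | s <= n%:R]); last exact: closed_le.
    by move=> p _; apply: (continuous_comp (@cvg_fst _ _ _ _ _) (@norm_continuous _ _ _)).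
  apply: (@closed_comp _ _ (fun p : R * R => `|p.2|) [set s | s <= n%:R]); last exact: closed_le.
  by move=> p _; apply: (continuous_comp (@cvg_snd _ _ _ _ _) (@norm_continuous _ _ _)).
have KE n : K n `<=` E by move=> p [].
have nullK n : mu.-negligible (coordinate b @` K n).
  (* A bounded [E] is compact and contains [K n]; for an unbounded one the definition speaks about
     the compact sets [K n] directly. *)
  have [bE|nbE] := pselect (bounded_set E); last first.
    by apply: compact_cap_zero_null => //; exact: cap2.
  have [M M0 HM] := bounded_set_plane bE.
  have cE : compact E.
    by apply: (@bounded_compact_plane _ M) => // p /HM[/ltW p1 /ltW p2].
  apply: negligibleS (compact_cap_zero_null b cE (cap1 bE)).
  exact: image_subset.
have null := negligible_bigcup nullK.
apply: contrapT => /forall2NP H.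
have sub : `]x, y[ `<=` \bigcup_n (coordinate b @` K n).
  move=> t; rewrite /= in_itv /= => It; have [//|/existsNP[p /not_implyP[Ep /negP]]] := H t.
  rewrite negbK => /eqP pt.
  pose M := Num.max `|p.1| `|p.2|.
  exists (Num.truncn M).+1 => //; exists p => //; split => //=.
  have /ltW := truncnS_gt M; rewrite /M ge_max => /andP[]; by [].
have [B [mB B0 NB]] := null.
have : (mu `]x, y[ <= mu B)%E.
  by apply: le_measure; rewrite ?inE//; apply: subset_trans NB.
rewrite B0 lebesgue_measure_itv /= lte_fin xy -EFinB lee_fin subr_le0.
by rewrite leNgt xy.
Qed.

End NullProjections.

(** * Montel's theorem *)

Section Montel.
Variable R : realType.
Implicit Types (a b c z w : C R) (U : set (C R)).

(** Schottky's bound after the affine map that takes [a], [b] to 0, 1, transported back. *)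
Definition omitting_bound (a b : C R) (M : R) : R :=
  m|a| + m|b - a| * schottky_bound ((M + m|a|) / m|b - a|).

Lemma schottky_omitting a b c (r M : R) h : a != b -> 0 < r -> hol_on (disc c r) h ->
  (forall z, disc c r z -> h z != a /\ h z != b) -> m|h c| <= M ->
  forall z, m|z - c| < r / 2 -> m|h z| <= omitting_bound a b M.
Proof.
move=> ab r0 hh hab hM z zr; have ba : b - a != 0 by rewrite subr_eq0 eq_sym.
have ba0 : 0 < m|b - a| by rewrite modulus_gt0.
pose k z := (b - a)^-1 * (h z - a).
have hE x : h x = a + (b - a) * k x by rewrite /k mulrA mulfV// mul1r addrC subrK.
have kM : m|k c| <= (M + m|a|) / m|b - a|.
  rewrite modulusM modulusV mulrC ler_pM2r ?invr_gt0//.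
  by rewrite (le_trans (modulusD _ _))// modulusN lerD2r.
have k01 x : disc c r x -> k x != 0 /\ k x != 1.
  move=> /hab[xa xb]; split; first by rewrite mulf_neq0 ?invr_eq0// subr_eq0.
  by apply: contraNneq xb => E; rewrite hE E mulr1 addrC subrK.
have := schottky r0 (hol_on_affine _ _ hh) k01 kM zr; rewrite -/k => H.
by rewrite hE (le_trans (modulusD _ _))// lerD2l modulusM ler_pM2l.
Qed.

Lemma lipschitz_of_bounded c (r M : R) h : 0 < r -> hol_on (disc c r) h ->
  (forall z, disc c r z -> m|h z| <= M) ->
  forall z, m|z - c| < r / 2 -> m|h z - h c| <= 8 * M / r * m|z - c|.
Proof.
move=> r0 hh hM z zr; have r20 : 0 < r / 2 by rewrite divr_gt0.
apply: (@mean_value _ _ (cder h)) => t It.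
  apply: hol_cder_dif hh _; rewrite /disc /=.
  by apply: le_lt_trans (modulus_seg_le _ _ It) _; apply: lt_trans zr _; move: r0; clear; lra.
have sub w : disc (seg c z t) (r / 2) w -> disc c r w.
  rewrite /disc /= => wz; apply: le_lt_trans (modulus_tri (seg c z t) _ _) _.
  by have := modulus_seg_le c z It; move: wz zr; clear; lra.
have -> : 8 * M / r = 4 * M / (r / 2) by field; rewrite gt_eqF.
apply: cauchy_estimate => // w /sub; [exact: hh|exact: hM].
Qed.

Lemma ultra_limit (F : set_system nat) (u : nat -> C R) (M : R) : UltraFilter F ->
  (\forall n \near F, m|u n| <= M) -> exists l : C R, u @ F --> l.
Proof.
move=> UF uM; have FF : ProperFilter F by exact: ultra_proper.
have [|l [_ lcl]] := @closed_disc_compact R 0 M (u @ F) (fmap_proper_filter u FF).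
  by apply: filterS uM => n; rewrite /= subr0.
exists l => V nV; have [//|FV] := in_ultra_setVsetC (u @^-1` V) UF.
by have [y [nVy Vy]] := lcl (~` V) V FV nV.
Qed.

Section Limit.
Variables (U : set (C R)) (s : nat -> C R -> C R) (a b : C R) (F : set_system nat).
Hypotheses (oU : open U) (ab : a != b) (hs : forall n, hol_on U (s n))
  (omits : forall n z, U z -> s n z != a /\ s n z != b) (UF : UltraFilter F).

Let bounded_at z := exists M : R, \forall n \near F, m|s n z| <= M.

(* Along an ultrafilter every bounded sequence converges, so a pointwise limit exists without
   extracting subsequences; Schottky's theorem makes it locally uniform. *)
Let lim z : sphere R :=
  if pselect (bounded_at z) then Some (xget 0 [set l | s ^~ z @ F --> l]) else None.

Let FF : ProperFilter F := ultra_proper.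

Let lim_bounded z : bounded_at z -> exists2 l, lim z = Some l & s ^~ z @ F --> l.
Proof.
rewrite /lim; case: pselect => // bz [M zM]; eexists; first reflexivity.
have [l Hl] := @ultra_limit F (s ^~ z) M UF zM.
by apply: (@xgetPex _ 0 [set l : C R | s ^~ z @ F --> l]); exists l.
Qed.

Let disc_in_U z : U z -> exists2 r : R, 0 < r & disc z r `<=` U.
Proof.
move=> Uz; have /nbhs_modulusP[r r0 H] : nbhs z U by exact: open_nbhs_nbhs.
by exists r.
Qed.

Let bound z w (r M : R) n : 0 < r -> disc z r `<=` U -> m|s n z| <= M -> m|w - z| < r / 2 ->
  m|s n w| <= omitting_bound a b M.
Proof.
move=> r0 zU zM wz; apply: (schottky_omitting ab r0 _ _ zM wz) => v /zU; [exact: hs|exact: omits].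
Qed.

Let bounded_near z (r : R) w : 0 < r -> disc z r `<=` U -> bounded_at z -> m|w - z| < r / 2 ->
  bounded_at w.
Proof.
move=> r0 zU [M zM] wz; exists (omitting_bound a b M).
by apply: filterS zM => n nM; exact: bound r0 zU nM wz.
Qed.

(** Where the values stay bounded, Schottky's and Cauchy's bounds make the functions uniformly
    Lipschitz near z. Elsewhere the Schottky bound is read backwards: a bound at a nearby w would
    give one at z, so the values tend to infinity uniformly. *)
Let locally_uniform z (e : R) : U z -> 0 < e ->
  exists2 r : R, 0 < r & \forall n \near F, forall w, disc z r w -> chordal (Some (s n w)) (lim w) < e.
Proof.
move=> Uz e0; have [r r0 zU] := disc_in_U Uz.
have [bz|nbz] := pselect (bounded_at z); last first.
  pose M := 2 / e; have M0 : 0 < M by rewrite divr_gt0.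
  exists (r / 4); first by rewrite divr_gt0.
  have near_w (w : C R) : disc z (r / 4) w -> disc w (r * (3 / 4)) `<=` U.
    move=> wz v vw; apply: zU; move: wz vw; rewrite /disc /= => wz vw.
    by apply: le_lt_trans (modulus_tri w _ _) _; move: wz vw; lra.
  have r34 : 0 < r * (3 / 4) by move: r0; lra.
  have zw (w : C R) : disc z (r / 4) w -> m|z - w| < r * (3 / 4) / 2.
    by rewrite /disc /= modulusB => wz; move: wz r0; lra.
  (* An ultrafilter decides whether |s n z| exceeds the Schottky bound for [K]; a negative answer
     would make the values at z bounded. *)
  have large K : \forall n \near F, forall w, disc z (r / 4) w -> K < m|s n w|.
    have [H|H] := in_ultra_setVsetC [set n | m|s n z| <= omitting_bound a b K] UF.
      by exfalso; apply: nbz; exists (omitting_bound a b K).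
    apply: filterS H => n H w wz; rewrite ltNge; apply/negP => wK; apply: H => /=.
    exact: bound r34 (near_w w wz) wK (zw w wz).
  have limN w : disc z (r / 4) w -> lim w = None.
    move=> wz; rewrite /lim; case: pselect => // bw; exfalso; apply: nbz.
    exact: bounded_near r34 (near_w w wz) bw (zw w wz).
  apply: filterS (large M) => n H w wz; rewrite limN//.
  by apply: lt_le_trans (chordal_infty_lt M0 (H w wz)) _; rewrite /M invf_div mulrC divfK// gt_eqF.
have [M zM] := bz; set M' := omitting_bound a b M.
have [l lz Hl] := lim_bounded bz.
pose L := 16 * `|M'| / r; have L0 : 0 <= L by rewrite mulr_ge0 ?mulr_ge0 ?invr_ge0// ltW.
have lip n w : m|s n z| <= M -> m|w - z| < r / 4 -> m|s n w - s n z| <= L * m|w - z|.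
  move=> nM wz; have -> : L = 8 * `|M'| / (r / 2) by rewrite /L; field; rewrite gt_eqF.
  apply: lipschitz_of_bounded; first by rewrite divr_gt0.
  - move=> v vz; apply: hs; apply: zU; apply: lt_trans vz _; move: r0; lra.
  - by move=> v vz; apply: le_trans (ler_norm _); exact: bound r0 zU nM vz.
  - by move: wz; lra.
pose d := Num.min (r / 4) (e / (16 * (L + 1))).
have d0 : 0 < d by rewrite lt_min !divr_gt0// mulr_gt0// ltr_wpDl.
have Ld w : disc z d w -> L * m|w - z| <= e / 16.
  rewrite /disc /= lt_min => /andP[_ H].
  have : (L + 1) * m|w - z| <= e / 16.
    rewrite mulrC -ler_pdivlMr ?ltr_wpDl//; apply: le_trans (ltW H) _.
    by rewrite invfM mulrA.
  by apply: le_trans; rewrite ler_wpM2r ?modulus_ge0// lerDl.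
exists d => //; have e16 : 0 < e / 16 by rewrite divr_gt0.
have Hl8 := (cvg_modulusP FF _ _).1 Hl _ e16.
apply: filterS (filterI zM Hl8) => n [nM nl] w wd.
have wr : m|w - z| < r / 4 by move: wd; rewrite /disc /= lt_min => /andP[].
have bw : bounded_at w.
  by apply: (bounded_near r0 zU bz); apply: lt_trans wr _; move: (r0); lra.
have [lw -> Hlw] := lim_bounded bw.
(* The index [k] is close to the limits at z and at w simultaneously. Passing from s n w over s n z,
   the limit at z, s k z and s k w to the limit at w costs at most five times e / 16, less than e /
   2. *)
have [k [kM kl kw]] : exists k, [/\ m|s k z| <= M, m|s k z - l| < e / 16 & m|s k w - lw| < e / 16].
  have Hlw8 := (cvg_modulusP FF _ _).1 Hlw _ e16.
  by have [k [[k1 k2] k3]] := filter_ex (filterI (filterI zM Hl8) Hlw8); exists k.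
apply: le_lt_trans (chordal_le _ _) _; rewrite -ltr_pdivlMl//.
have lipn := le_trans (lip n w nM wr) (Ld w wd).
have lipk := le_trans (lip k w kM wr) (Ld w wd).
have t1 := modulus_tri (s n z) (s n w) lw.
have t2 := modulus_tri l (s n z) lw.
have t3 := modulus_tri (s k z) l lw.
have t4 := modulus_tri (s k w) (s k z) lw.
move: nl kl kw lipn lipk t1 t2 t3 t4 e0; rewrite (modulusB l (s k z)) (modulusB (s k z) (s k w)).
lra.
Qed.

(** The distance to the complement is expressed point by point: the set is visibly closed, and the
    case of the whole plane needs no separate treatment. *)
Let exhaustion (m : nat) : set (C R) :=
  [set z | m|z - 0| <= m%:R /\ forall w, ~ U w -> m.+1%:R^-1 <= m|z - w|].

Let exhaustion_compact m : compact (exhaustion m).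
Proof.
apply: (subclosed_compact _ (@closed_disc_compact R 0 m%:R)); last by move=> z [].
apply: closedI; first exact: closed_disc_closed.
apply: (@closed_bigI _ _ (~` U) (fun w => [set z | m.+1%:R^-1 <= m|z - w|])) => w _.
apply: (@preimage_closed _ _ (fun z => m|z - w|) [set x | m.+1%:R^-1 <= x]); last exact: closed_ge.
move=> z _; apply: (@continuous_comp _ _ _ (fun z => z - w) (@modulus R)).
  by apply: continuousB; [exact: (fun U HU => HU)|exact: cst_continuous].
exact: continuous_modulus.
Qed.

Let exhaustion_sub m : exhaustion m `<=` U.
Proof.
move=> z [_ H]; apply: contrapT => /H; rewrite subrr modulus0 leNgt.
by rewrite invr_gt0 ltr0n.
Qed.

Let exhaustion_absorbs z : U z -> exists2 r : R, 0 < r &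
  \forall m \near \oo, disc z r `<=` exhaustion m.
Proof.
move=> Uz; have [r r0 zU] := disc_in_U Uz; exists (r / 2); first by rewrite divr_gt0.
have n1 : \forall m \near \oo, m|z| + r <= m%:R by exact: nbhs_infty_ger.
have n2 : \forall m \near \oo, 2 / r <= m%:R by exact: nbhs_infty_ger.
apply: filterS (filterI n1 n2) => m [m1 m2] v vz; split.
  rewrite subr0; apply: le_trans m1; rewrite -(subrK z v) (le_trans (modulusD _ _))// addrC lerD2l.
  by move: vz r0; rewrite /disc /=; lra.
move=> w nUw; have rw : r <= m|w - z| by rewrite leNgt; apply/negP => /zU.
have vw : r / 2 <= m|v - w|.
  have := modulus_tri v w z; rewrite (modulusB w v); move: vz rw; rewrite /disc /=; lra.
apply: le_trans vw; rewrite -[leRHS]invrK lef_pV2 ?posrE ?ltr0n ?invr_gt0 ?divr_gt0//.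
by rewrite invf_div (le_trans m2)// ler_nat.
Qed.

Let uniform_on_compacts (K : set (C R)) (e : R) : compact K -> K `<=` U -> 0 < e ->
  \forall n \near F, forall w, K w -> chordal (Some (s n w)) (lim w) < e.
Proof.
move=> /compact_near_coveringP cK KU e0.
apply: (cK _ F (fun n w => chordal (Some (s n w)) (lim w) < e)) => z /KU Uz.
have [r r0 H] := locally_uniform Uz e0.
exists (disc z r, [set n | forall w, disc z r w -> chordal (Some (s n w)) (lim w) < e]).
  by split => //; apply: near_disc; rewrite /disc /= subrr modulus0.
by move=> [w n] /= [wz]; exact.
Qed.

(** The k-th index is chosen with error below 1 / (k + 1) on the k-th compact set, so no diagonal
    extraction is needed. Indices can be taken increasing because [F] contains all cofinite sets. *)
Lemma ultra_subsequence : \oo `<=` F -> exists2 phi : nat -> nat,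
  {homo phi : m n / (m < n)%N} & exists g, locally_uniform_cvg U (s \o phi) g.
Proof.
move=> FN; pose good k n := forall w, exhaustion k w -> chordal (Some (s n w)) (lim w) < k.+1%:R^-1.
have /choice[pick Hpick] (kN : nat * nat) : exists n, (kN.2 <= n)%N /\ good kN.1 n.
  have goodF : \forall n \near F, good kN.1 n.
    by apply: uniform_on_compacts; [exact: exhaustion_compact|exact: exhaustion_sub|rewrite invr_gt0 ltr0n].
  have ge : \forall n \near F, (kN.2 <= n)%N by apply: FN; exact: nbhs_infty_ge.
  exact: filter_ex (filterI ge goodF).
pose phi := fix phi k := if k is k'.+1 then pick (k, (phi k').+1) else pick (0, 0)%N.
have goodphi k : good k (phi k) by case: k => [|k]; [exact: (Hpick (0, 0)%N).2|exact: (Hpick (k.+1, (phi k).+1)).2].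
exists phi; first by apply: homo_ltn => [? ? ?|k]; [exact: ltn_trans|exact: (Hpick (k.+1, (phi k).+1)).1].
exists lim => z Uz; have [r r0 Hr] := exhaustion_absorbs Uz.
exists (disc z r); split.
  by split; [exact: open_disc|rewrite /disc /= subrr modulus0].
move=> e e0; have n2 : \forall k \near \oo, e^-1 <= k%:R by exact: nbhs_infty_ger.
apply: filterS (filterI Hr n2) => k [Hk ke] w [_ /Hk wk].
apply: lt_le_trans (goodphi k w wk) _.
rewrite -[leRHS]invrK lef_pV2 ?posrE ?ltr0n ?invr_gt0//.
by rewrite (le_trans ke)// ler_nat.
Qed.

End Limit.

Theorem montel U (H : set (C R -> C R)) a b : open U -> a != b ->
  (forall h, H h -> hol_on U h) -> (forall h z, H h -> U z -> h z != a /\ h z != b) ->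
  normal_family U H.
Proof.
move=> oU ab holH omH s sH; have [F [UF FN]] := @ultraFilterLemma nat \oo _.
by apply: (@ultra_subsequence U s a b F) => // n *; [exact: holH|exact: omH].
Qed.

End Montel.

(** * Smooth bumps and the capacity of a point *)

Section SingletonCapacity.
Variable R : realType.
Local Notation mu := (@lebesgue_measure R).

(** The powers of 1 / t are included to make the family closed under differentiation, up to linear
    combinations. *)
Definition flat (n : nat) (t : R) : R := if 0 < t then t^-1 ^+ n * expR (- t^-1) else 0.

Lemma flat_ge0 n t : 0 <= flat n t.
Proof.
by rewrite /flat; case: ifPn => // t0; rewrite mulr_ge0 ?expR_ge0// exprn_ge0// invr_ge0 ltW.
Qed.

Lemma flat_eq0 n t : t <= 0 -> flat n t = 0.
Proof. by rewrite /flat ltNge => ->. Qed.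

(** exp(-1/t) is at most (m t)^m by 1 + x <= e^x; with m = n + k this beats t^-n and leaves t^k. *)
Lemma flat_le n k t : 0 < t -> flat n t <= (n + k)%:R ^+ (n + k) * t ^+ k.
Proof.
move=> t0; rewrite /flat t0; set m := (n + k)%N.
have ti : 0 < t^-1 by rewrite invr_gt0.
have E : expR (- t^-1) <= (m%:R * t) ^+ m.
  have [->|m0] := posnP m; first by rewrite expr0 -expR0 ler_expR oppr_le0 ltW.
  have mt : 0 < m%:R * t by rewrite mulr_gt0// ltr0n.
  rewrite expRN -[leRHS]invrK lef_pV2 ?posrE ?expR_gt0 ?invr_gt0 ?exprn_gt0// -exprVn.
  have -> : t^-1 = m%:R * (m%:R * t)^-1 by rewrite invfM mulrA mulfV ?mul1r// pnatr_eq0 -lt0n.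
  rewrite expRM_natl lerXn2r ?nnegrE ?expR_ge0 ?invr_ge0 ?(ltW mt)//.
  by apply: le_trans (expR_ge1Dx _); rewrite lerDr.
apply: (@le_trans _ _ (t^-1 ^+ n * (m%:R * t) ^+ m)).
  by rewrite ler_wpM2l// exprn_ge0// ltW.
rewrite exprMn mulrCA ler_wpM2l ?exprn_ge0// /m exprD mulrA -exprMn mulVf ?gt_eqF//.
by rewrite expr1n mul1r.
Qed.

Lemma flat0_le1 t : flat 0 t <= 1.
Proof.
have [t0|t0] := leP t 0; first by rewrite flat_eq0.
by have := flat_le 0 0 t0; rewrite addn0 !expr0 mulr1.
Qed.

Lemma flat2_le4 t : flat 2 t <= 4.
Proof.
have [t0|t0] := leP t 0; first by rewrite flat_eq0.
by have := flat_le 2 0 t0; rewrite expr0 mulr1 expr2 -natrM.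
Qed.

Definition flat' n t : R := flat n.+2 t - n%:R * flat n.+1 t.

Lemma is_derive_flat n (t : R) : is_derive t 1 (flat n) (flat' n t).
Proof.
have [t0|t0|t0] := ltgtP t 0.
- apply: (@near_eq_is_derive _ _ _ (cst 0)).
    near=> s; rewrite flat_eq0//; apply: ltW; near: s; exact: lt_nbhsl.
  by rewrite /flat' !flat_eq0 ?(ltW t0)// mulr0 subr0; exact: is_derive_cst.
- have dinv : is_derive t 1 (fun s : R => s^-1) (- t ^- 2 *: 1).
    by apply: is_deriveV; rewrite ?gt_eqF.
  apply: (@near_eq_is_derive _ _ _ (fun s : R => s^-1 ^+ n * expR (- s^-1))).
    by near=> s; rewrite /flat ifT//; near: s; exact: lt_nbhsr.
  have dg : is_derive (t^-1) 1 (fun y : R => y ^+ n * expR (- y))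
      (t^-1 ^+ n * (- expR (- t^-1)) + expR (- t^-1) * (n%:R * t^-1 ^+ n.-1)).
    have d1 : is_derive (t^-1) 1 (fun y : R => y ^+ n) (n%:R * t^-1 ^+ n.-1).
      have -> : (fun y : R => y ^+ n) = id ^+ n by apply/funext => y; rewrite exprfctE.
      by apply: is_derive_eq; rewrite -[_ *: 1]/(_ * 1) mulr1.
    have d2 : is_derive (t^-1) 1 (fun y : R => expR (- y)) (- expR (- t^-1)).
      rewrite -[- expR _]mulrN1; apply: (@is_derive1_comp _ expR (fun y : R => - y)).
    exact: is_deriveM.
  have := @is_derive1_comp _ (fun y : R => y ^+ n * expR (- y)) (fun s : R => s^-1) t _ _ dg dinv.
  move=> [H1 H2]; apply: DeriveDef; [exact: H1|rewrite [LHS]H2].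
  rewrite /flat' /flat t0 -[_ *: 1]/(_ * 1) mulr1.
  case: (n) => [|k]; rewrite -?exprVn /= ?mul0r ?mulr0 ?addr0 ?subr0 ?expr0 ?mul1r.
    by rewrite mulrNN mulrC.
  by rewrite !exprS; ring.
(* At 0 the difference quotient of [flat n] is [flat n.+1], which tends to 0 by [flat_le]. *)
- rewrite t0; have E s : flat n s = flat n.+1 s * s.
    rewrite /flat; case: ifPn => s0; last by rewrite mul0r.
    by rewrite exprS mulrAC [_ * s]mulrAC mulVf ?gt_eqF// mul1r.
  have -> : flat' n 0 = flat n.+1 0 by rewrite /flat' !flat_eq0// mulr0 subr0.
  apply: slope_derive; last by apply: (@filterE _ (nbhs (0 : R))) => s; rewrite [flat n 0]flat_eq0// add0r subr0.
  apply/(cvg_realP (nbhs_filter 0)) => e e0; rewrite [flat _ 0]flat_eq0//.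
  pose C : R := (n.+1 + 1)%:R ^+ (n.+1 + 1).
  have C0 : 0 < C by rewrite exprn_gt0// addn1 ltr0n.
  apply: filterS (near_real 0 (divr_gt0 e0 C0)) => s; rewrite !subr0 => se.
  rewrite ger0_norm ?flat_ge0//; have [s0|s0] := leP s 0; first by rewrite flat_eq0.
  apply: le_lt_trans (flat_le n.+1 1 s0) _; rewrite -/C expr1 mulrC -ltr_pdivlMr//.
  by rewrite -(gtr0_norm s0).
Unshelve. all: by end_near. Qed.

Lemma is_derive_affine (h h' : R -> R) (c d e : R) (p w : R * R) :
  (forall t : R, is_derive t 1 h (h' t)) ->
  is_derive p w (fun q : R * R => h (c * q.1 + d * q.2 + e))
    ((c * w.1 + d * w.2) * h' (c * p.1 + d * p.2 + e)).
Proof.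
move=> dh; set m := c * w.1 + d * w.2; set l := c * p.1 + d * p.2 + e.
pose g (t : R) := l + m * t.
have dg : is_derive (0 : R) 1 g m.
  by rewrite -[m]add0r -[X in _ + X]mulr1; apply: is_deriveD.
have [H1 H2] : is_derive (0 : R) 1 (h \o g) (h' l * m).
  by apply: is_derive1_comp; rewrite /g mulr0 addr0.
have E : (fun t : R => t^-1 *: ((h \o g \o shift (0 : R)) (t *: 1) - (h \o g) 0)) =
   (fun t : R => t^-1 *: (((fun q : R * R => h (c * q.1 + d * q.2 + e)) \o shift p) (t *: w)
      - h l)).
  apply/funext => t; congr (_ *: (h _ - h _)); rewrite /g /shift /= -?[_ *: _]/(_ * _) /m /l; ring.
by apply: DeriveDef; rewrite /derivable /derive -E // mulrC -H2.
Qed.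

(* A class of smooth functions that contains the bumps and is stable under partial derivatives. *)
Inductive elementary : (R * R -> R) -> Prop :=
| elementary_flat n c d e : elementary (fun p => flat n (c * p.1 + d * p.2 + e))
| elementary_cst c : elementary (fun=> c)
| elementary_add u v : elementary u -> elementary v -> elementary (fun p => u p + v p)
| elementary_mul u v : elementary u -> elementary v -> elementary (fun p => u p * v p).

Lemma elementary_continuous u : elementary u -> continuous u.
Proof.
elim=> [n c d e|c|{}u v _ cu _ cv|{}u v _ cu _ cv] p.
- have H : {for p, continuous (fun q : R * R => c * q.1 + d * q.2 + e)}.
    apply: continuousD; last exact: cst_continuous.
    by apply: continuousD; apply: continuousM; [exact: cst_continuous|exact: cvg_fst|
      exact: cst_continuous|exact: cvg_snd].
  apply: (continuous_comp H); have [/derivable1_diffP d1 _] := is_derive_flat n (c * p.1 + d * p.2 + e).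
  exact: differentiable_continuous.
- exact: cst_continuous.
- have H : {for p, continuous (fun q => u q + v q)} by apply: continuousD; [exact: cu|exact: cv].
  exact: H.
- have H : {for p, continuous (fun q => u q * v q)} by apply: continuousM; [exact: cu|exact: cv].
  exact: H.
Qed.

Lemma elementary_derive u i : elementary u ->
  exists2 v, elementary v & forall p, is_derive p (basis_vec R i) u (v p).
Proof.
elim=> [n c d e|c|{}u v eu [du edu Hu] ev [dv edv Hv]|{}u v eu [du edu Hu] ev [dv edv Hv]].
- pose m := c * (basis_vec R i).1 + d * (basis_vec R i).2.
  exists (fun p => m * (flat n.+2 (c * p.1 + d * p.2 + e) + - n%:R * flat n.+1 (c * p.1 + d * p.2 + e))).
    apply: elementary_mul; first exact: elementary_cst.
    apply: elementary_add; first exact: elementary_flat.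
    by apply: elementary_mul; [exact: elementary_cst|exact: elementary_flat].
  move=> p; rewrite mulNr; exact: (is_derive_affine c d e p _ (is_derive_flat n)).
- by exists (fun=> 0); [exact: elementary_cst|move=> p; exact: is_derive_cst].
- exists (fun p => du p + dv p); first exact: elementary_add.
  by move=> p; apply: is_deriveD.
- exists (fun p => u p * dv p + v p * du p).
    by apply: elementary_add; apply: elementary_mul.
  by move=> p; apply: is_deriveM.
Qed.

Lemma elementary_partial u i : elementary u -> elementary (partial i u).
Proof.
move=> /(elementary_derive i)[v ev Hv]; suff -> : partial i u = v by [].
by apply/funext => p; have [] := Hv p.
Qed.

Lemma elementary_smooth u : elementary u -> smooth u.
Proof.
move=> eu s; have es : elementary (foldr (@partial R) u s).
  by elim: s => [|i s IH] //=; exact: elementary_partial.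
split; first exact: elementary_continuous.
by move=> p i; have [v _ /(_ p)[]] := elementary_derive i es.
Qed.

Definition bump (s : R) : R := flat 0 (1 - s) * flat 0 (1 + s).
Definition bump' (s : R) : R := flat 0 (1 - s) * flat 2 (1 + s) - flat 0 (1 + s) * flat 2 (1 - s).

Lemma bump_ge0 s : 0 <= bump s. Proof. by rewrite mulr_ge0 ?flat_ge0. Qed.

Lemma bump_le1 s : bump s <= 1.
Proof. by rewrite mulr_ile1 ?flat_ge0 ?flat0_le1. Qed.

Lemma bump0_gt0 : 0 < bump 0.
Proof. by rewrite /bump /flat subr0 addr0 ltr01 mulr_gt0// mulr_gt0 ?expR_gt0// exprn_gt0// invr1. Qed.

Lemma bump_out s : 1 < `|s| -> bump s = 0 /\ bump' s = 0.
Proof.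
rewrite lter_normr /bump /bump' => /orP[] s1.
  by rewrite [flat 0 (1 - s)]flat_eq0 ?[flat 2 (1 - s)]flat_eq0 ?mul0r ?mulr0 ?subr0// subr_le0 ltW.
have s0 : 1 + s <= 0 by rewrite -lerBrDr sub0r ltW.
by rewrite [flat 0 (1 + s)]flat_eq0// [flat 2 (1 + s)]flat_eq0// ?mul0r ?mulr0 ?subr0.
Qed.

Lemma bump'_le s : `|bump' s| <= 8.
Proof.
have b t : 0 <= flat 0 (1 - t) * flat 2 (1 + t) <= 4.
  rewrite mulr_ge0 ?flat_ge0//= -[4]mul1r ler_pM ?flat_ge0 ?flat0_le1 ?flat2_le4//.
have := b (- s); rewrite opprK; have := b s; rewrite /bump' => /andP[a1 a2] /andP[b1 b2].
by rewrite ler_norml; apply/andP; split; move: a1 a2 b1 b2; clear; lra.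
Qed.

Lemma is_derive_bump (s : R) : is_derive s 1 bump (bump' s).
Proof.
have d1 : is_derive s 1 (fun s : R => flat 0 (1 - s)) (- flat 2 (1 - s)).
  have [H1 H2] : is_derive s 1 (flat 0 \o (fun s : R => 1 - s)) (flat' 0 (1 - s) * (0 - 1)).
    by apply: is_derive1_comp; exact: is_derive_flat.
  by apply: DeriveDef; [exact: H1|rewrite [LHS]H2 /flat' mul0r subr0 sub0r mulrN1].
have d2 : is_derive s 1 (fun s : R => flat 0 (1 + s)) (flat 2 (1 + s)).
  have [H1 H2] : is_derive s 1 (flat 0 \o (fun s : R => 1 + s)) (flat' 0 (1 + s) * (0 + 1)).
    by apply: is_derive1_comp; exact: is_derive_flat.
  by apply: DeriveDef; [exact: H1|rewrite [LHS]H2 /flat' mul0r subr0 add0r mulr1].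
rewrite /bump' -mulrN; exact: is_deriveM.
Qed.

Lemma elementary_bump c d e : elementary (fun p => bump (c * p.1 + d * p.2 + e)).
Proof.
suff -> : (fun p : R * R => bump (c * p.1 + d * p.2 + e)) =
    (fun p => flat 0 (- c * p.1 + - d * p.2 + (1 - e)) * flat 0 (c * p.1 + d * p.2 + (1 + e))).
  by apply: elementary_mul; exact: elementary_flat.
by apply/funext => p; rewrite /bump; congr (flat _ _ * flat _ _); ring.
Qed.

(** The earlier terms sum to less than the next power of 2, so in the square the new term y
    contributes at most 2 y^2 + y^2: the mixed terms cost only the factor 3. *)
Lemma sum_pow2_sq n (b : nat -> bool) :
  (\sum_(j < n) 2 ^+ j * (b j)%:R) ^+ 2 <= 3 * \sum_(j < n) 4 ^+ j * (b j)%:R :> R.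
Proof.
have ub m : \sum_(j < m) 2 ^+ j * (b j)%:R <= 2 ^+ m - 1 :> R.
  elim: m => [|m IH]; first by rewrite big_ord0 expr0 subrr.
  rewrite big_ord_recr /= exprS; have : (b m)%:R <= 1 :> R by case: (b m).
  have : 0 <= 2 ^+ m :> R by rewrite exprn_ge0.
  move: IH; move: (\sum_(_ < _) _) ((b m)%:R : R) (2 ^+ m : R) => s x y; clear; nra.
elim: n => [|n IH]; first by rewrite !big_ord0 expr0n mulr0.
rewrite !big_ord_recr /=; have -> : 4 ^+ n = (2 ^+ n) ^+ 2 :> R.
  by rewrite -exprM mulnC exprM; congr (_ ^+ _); rewrite expr2 -natrM.
have : 0 <= 2 ^+ n :> R by rewrite exprn_ge0.
move: IH (ub n); move: (\sum_(_ < _) _) (\sum_(_ < _) _) (2 ^+ n : R) => s t y.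
by case: (b n); rewrite ?mulr1 ?mulr0 ?addr0//; clear; nra.
Qed.

Section Dyadic.
Variable q : R * R.

Let slope j (k i : bool) : R := if k == i then 2 ^+ j else 0.
(** The dilation by 2^j about [q], written as an affine form to match [elementary_bump] and
    [is_derive_affine]; [argE] gives the readable form. *)
Let arg j k (p : R * R) : R :=
  slope j k false * p.1 + slope j k true * p.2 + - 2 ^+ j * coordinate k q.

Let argE j k p : arg j k p = 2 ^+ j * (coordinate k p - coordinate k q).
Proof. by rewrite /arg /slope; case: k => /=; ring. Qed.

Let dyadic_bump j p : R := bump (arg j false p) * bump (arg j true p).

Let square j : set (R * R) :=
  `[q.1 - 2 ^- j, q.1 + 2 ^- j]%classic `*` `[q.2 - 2 ^- j, q.2 + 2 ^- j]%classic.

Let outside_square j p : ~ square j p -> exists k, 1 < `|arg j k p|.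
Proof.
move=> np; apply: contrapT => /forallNP H; apply: np.
have {}H k : `|coordinate k p - coordinate k q| <= 2 ^- j.
  have /negP := H k; rewrite -leNgt argE normrM ger0_norm ?exprn_ge0//.
  by rewrite mulrC -ler_pdivlMr ?exprn_gt0// div1r.
have /= := H false; have /= := H true; rewrite !ler_norml => /andP[a1 a2] /andP[b1 b2].
by split; rewrite /= in_itv /=; apply/andP; split; move: a1 a2 b1 b2; lra.
Qed.

Let dyadic_bump' j i p : R := bump (arg j false p) * (slope j true i * bump' (arg j true p)) +
  bump (arg j true p) * (slope j false i * bump' (arg j false p)).

Let is_derive_dyadic_bump j i p :
  is_derive p (basis_vec R i) (dyadic_bump j) (dyadic_bump' j i p).
Proof.
have d k : is_derive p (basis_vec R i) (fun p => bump (arg j k p)) (slope j k i * bump' (arg j k p)).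
  have H := is_derive_affine (slope j k false) (slope j k true) (- 2 ^+ j * coordinate k q) p
    (basis_vec R i) is_derive_bump.
  suff -> : slope j k i = slope j k false * (basis_vec R i).1 + slope j k true * (basis_vec R i).2.
    exact: H.
  by rewrite /basis_vec; case: i {H} => /=; rewrite mulr0 mulr1 ?addr0 ?add0r.
exact: is_deriveM.
Qed.

Let dyadic_bump_out j i p : ~ square j p -> dyadic_bump j p = 0 /\ dyadic_bump' j i p = 0.
Proof.
move=> /outside_square[[] /bump_out[E1 E2]]; rewrite /dyadic_bump /dyadic_bump' E1 E2.
  by rewrite !mulr0 mul0r addr0.
by rewrite !mulr0 !mul0r addr0.
Qed.

Let dyadic_bump'_le j i p : `|dyadic_bump' j i p| <= 8 * (2 ^+ j * (`[< square j p >])%:R).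
Proof.
case: asboolP => [_|np]; last by rewrite (dyadic_bump_out i np).2 normr0 !mulr0.
rewrite mulr1 /dyadic_bump' /slope; have j0 : 0 <= 2 ^+ j :> R by rewrite exprn_ge0.
have le k k' : `|bump (arg j k p) * (2 ^+ j * bump' (arg j k' p))| <= 8 * 2 ^+ j.
  rewrite normrM (ger0_norm (bump_ge0 _)) -[leRHS]mul1r ler_pM ?bump_ge0 ?bump_le1//.
  by rewrite normrM (ger0_norm j0) mulrC ler_wpM2r// bump'_le.
by case: i => /=; rewrite !mul0r mulr0 ?addr0 ?add0r; exact: le.
Qed.

Let sum_bump n p : R := \sum_(j < n) dyadic_bump j p.

Let elementary_sum_bump n : elementary (sum_bump n).
Proof.
elim: n => [|n IH].
  rewrite (_ : sum_bump 0 = fun=> 0); first exact: elementary_cst.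
  by apply/funext => p; rewrite /sum_bump big_ord0.
rewrite (_ : sum_bump n.+1 = fun p => sum_bump n p + dyadic_bump n p).
  by apply: elementary_add => //; apply: elementary_mul; exact: elementary_bump.
by apply/funext => p; rewrite /sum_bump big_ord_recr.
Qed.

Let is_derive_sum_bump n i p :
  is_derive p (basis_vec R i) (sum_bump n) (\sum_(j < n) dyadic_bump' j i p).
Proof.
elim: n => [|n IH].
  rewrite big_ord0 (_ : sum_bump 0 = fun=> 0); first exact: is_derive_cst.
  by apply/funext => x; rewrite /sum_bump big_ord0.
rewrite (_ : sum_bump n.+1 = fun p => sum_bump n p + dyadic_bump n p).
  by rewrite big_ord_recr; apply: is_deriveD.
by apply/funext => x; rewrite /sum_bump big_ord_recr.
Qed.

(** At [q] each of the n bumps equals [bump 0 ^+ 2], so this factor makes the average exactly 1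
    there. *)
Let weight n : R := (bump 0 ^+ 2 * n%:R)^-1.

(* The gradients of the n bumps have comparable energies and are almost orthogonal
   (sum_pow2_sq), so the average has energy O(1/n). *)
Let potential n p : R := weight n * sum_bump n p.

Let weight_ge0 n : 0 <= weight n.
Proof. by rewrite invr_ge0 mulr_ge0// sqr_ge0. Qed.

(** 192 is 3 times 8^2: a partial derivative of the j-th bump is at most 8 times 2^j and vanishes
    off [square j]. *)
Let partial_potential n i p :
  partial i (potential n) p ^+ 2 <=
  weight n ^+ 2 * (192 * \sum_(j < n) 4 ^+ j * (`[< square j p >])%:R).
Proof.
have -> : partial i (potential n) p = weight n * \sum_(j < n) dyadic_bump' j i p.
  have [_ E] : is_derive p (basis_vec R i) (weight n *: sum_bump n)
      (weight n *: \sum_(j < n) dyadic_bump' j i p) by apply: is_deriveZ.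
  exact: E.
rewrite exprMn ler_wpM2l ?sqr_ge0//.
have -> : 192 * \sum_(j < n) 4 ^+ j * (`[< square j p >])%:R =
  64 * (3 * \sum_(j < n) 4 ^+ j * (`[< square j p >])%:R) :> R by rewrite mulrA -natrM.
apply: le_trans (ler_wpM2l (ler0n _ 64) (sum_pow2_sq n (fun j => `[< square j p >]))).
rewrite -real_normK ?num_real//; have -> : 64 = 8 ^+ 2 :> R by rewrite expr2 -natrM.
rewrite -exprMn lerXn2r ?nnegrE ?normr_ge0//.
  by rewrite mulr_ge0// sumr_ge0// => j _; rewrite mulr_ge0 ?exprn_ge0.
by apply: le_trans (ler_norm_sum _ _ _) _; rewrite mulr_sumr ler_sum.
Qed.

Let measurable_square j : measurable (square j : set (measurableTypeR R * measurableTypeR R)).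
Proof. by apply: measurableX; exact: measurable_itv. Qed.

Let measure_square j : ((mu \x mu) (square j) = (4 * 4 ^- j)%:E)%E.
Proof.
have j0 : 0 < 2 ^- j :> R by rewrite invr_gt0 exprn_gt0.
transitivity (mu `[(q.1 - 2 ^- j)%R, (q.1 + 2 ^- j)%R] * mu `[(q.2 - 2 ^- j)%R, (q.2 + 2 ^- j)%R])%E.
  by apply: product_measure1E; exact: measurable_itv.
rewrite !lebesgue_measure_itv /= !lte_fin.
have lt (x : R) : x - 2 ^- j < x + 2 ^- j by rewrite ltrD2l gtrN.
rewrite !lt -!EFinB -EFinM; congr (_%:E).
have -> : 4 ^- j = 2 ^- j * 2 ^- j :> R by rewrite -invfM -exprMn -natrM.
ring.
Qed.

Let A : set (R * R) := [set p | `|p.1 - q.1| < 2 /\ `|p.2 - q.2| < 2].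

Let oA : open A.
Proof.
apply: openI.
  apply: (@open_comp _ _ (fun p : R * R => `|p.1 - q.1|) [set s | s < 2]); last exact: open_lt.
  move=> p _; have H : {for p, continuous (fun p : R * R => p.1 - q.1)}.
    by apply: continuousB; [exact: cvg_fst|exact: cst_continuous].
  exact: (continuous_comp H (@norm_continuous _ _ _)).
apply: (@open_comp _ _ (fun p : R * R => `|p.2 - q.2|) [set s | s < 2]); last exact: open_lt.
move=> p _; have H : {for p, continuous (fun p : R * R => p.2 - q.2)}.
  by apply: continuousB; [exact: cvg_snd|exact: cst_continuous].
exact: (continuous_comp H (@norm_continuous _ _ _)).
Qed.

Let bA : bounded_set A.
Proof.
exists (2 + `|q.1| + `|q.2|); split; first exact: num_real.
move=> M /ltW HM p [p1 p2]; apply: le_trans HM; rewrite prod_normE ge_max.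
have := ler_normD (p.1 - q.1) q.1; have := ler_normD (p.2 - q.2) q.2; rewrite !subrK => h2 h1.
have := normr_ge0 q.1; have := normr_ge0 q.2; move: p1 p2 h1 h2; move=> p1 p2 h1 h2 a b.
by apply/andP; split; lra.
Qed.

Let support_potential n : closure [set p | potential n p != 0] `<=` square 0.
Proof.
have clS : closed (square 0).
  have cl1 : closed [set p : R * R | `[q.1 - 2 ^- 0, q.1 + 2 ^- 0]%classic p.1].
    by apply: (@closed_comp _ _ (@fst R R)); [move=> p _; exact: cvg_fst|exact: interval_closed].
  have cl2 : closed [set p : R * R | `[q.2 - 2 ^- 0, q.2 + 2 ^- 0]%classic p.2].
    by apply: (@closed_comp _ _ (@snd R R)); [move=> p _; exact: cvg_snd|exact: interval_closed].
  exact: closedI cl1 cl2.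
rewrite [X in _ `<=` X](closure_id _).1//; apply: closure_subset => p /=.
apply: contraNP => np; apply/eqP; rewrite /potential /sum_bump big1 ?mulr0// => j _.
apply: (dyadic_bump_out false _).1 => -[p1 p2]; apply: np.
have j1 : 2 ^- j <= 2 ^- 0 :> R.
  by rewrite lef_pV2 ?posrE ?exprn_gt0// expr0 exprn_ege1// ler1n.
move: p1 p2; rewrite /= !in_itv /= => /andP[a1 a2] /andP[b1 b2].
by split; rewrite /= in_itv /=; apply/andP; split; move: j1 a1 a2 b1 b2; lra.
Qed.

Let potential_test n : test_function A (potential n).
Proof.
have sub := @support_potential n; split.
- apply: elementary_smooth; apply: elementary_mul; first exact: elementary_cst.
  exact: elementary_sum_bump.
- apply: (@subclosed_compact _ _ (square 0)); [exact: closed_closure| |exact: sub].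
  by apply: compact_setX; exact: segment_compact.
- move=> p /sub[]; rewrite /= !in_itv /= expr0 invr1 => /andP[a1 a2] /andP[b1 b2].
  by split; rewrite ltr_norml; apply/andP; split; move: a1 a2 b1 b2; lra.
Qed.

(** [square j] has area 4 times 4^-j, so every scale contributes the same amount; 1536 = 2 * 192 *
    4, the 2 counting the partial derivatives. As [weight n] is of order 1 / n, the total is of
    order 1 / n. *)
Let energy n : (\int[(mu \x mu)%E]_(p in A) (grad_norm (potential n) p ^+ 2)%:E <=
  (1536 * weight n ^+ 2 * n%:R)%:E)%E.
Proof.
have mA : measurable (A : set (measurableTypeR R * measurableTypeR R)) by exact: open_measurable_plane.
have [su _ _] := potential_test n.
have cp i : continuous (partial i (potential n)) by have [] := su [:: i].
have gE p : grad_norm (potential n) p ^+ 2 =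
    partial false (potential n) p ^+ 2 + partial true (potential n) p ^+ 2.
  by rewrite /grad_norm sqr_sqrtr// addr_ge0// sqr_ge0.
pose k := 384 * weight n ^+ 2; have k0 : 0 <= k by rewrite mulr_ge0// sqr_ge0.
pose F j p := ((k * 4 ^+ j)%:E * (\1_(square j) p)%:E)%E.
have F0 j p : (0 <= F j p)%E by rewrite mule_ge0// lee_fin ?mulr_ge0// exprn_ge0.
have mF j D : measurable_fun D (F j : measurableTypeR R * measurableTypeR R -> \bar R).
  apply: measurable_funeM; apply/measurable_EFinP; apply: measurable_funTS.
  exact: measurable_indic.
apply: (@le_trans _ _ (\int[(mu \x mu)%E]_(p in A) \sum_(j < n) F j p)%E).
  apply: ge0_le_integral => //.
  - by move=> p _; rewrite lee_fin sqr_ge0.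
  - apply/measurable_EFinP/measurable_funTS; rewrite (funext gE).
    apply: continuous_measurable_plane => p.
    have H : {for p, continuous (fun p => partial false (potential n) p ^+ 2 + partial true (potential n) p ^+ 2)}.
      by apply: continuousD; apply: continuousM; exact: cp.
    exact: H.
  - exact: emeasurable_sum.
  - move=> p _; rewrite gE.
    rewrite (_ : (\sum_(j < n) F j p)%E = (k * \sum_(j < n) 4 ^+ j * (`[< square j p >])%:R)%:E).
      rewrite lee_fin; apply: le_trans (lerD (partial_potential n false p) (partial_potential n true p)) _.
      by rewrite /k; move: (\sum_(_ < _) _) => s; lra.
    rewrite mulr_sumr -sumEFin; apply: eq_bigr => j _.
    rewrite /F -EFinM mulrA indicE; case: asboolP => H; first by rewrite mem_set.
    by rewrite memNset.
rewrite ge0_integral_sum//.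
apply: (@le_trans _ _ (\sum_(j < n) (4 * k)%:E)%E).
  apply: lee_sum => j _; rewrite ge0_integralZl_EFin//; last 2 first.
  - by apply/measurable_EFinP; apply: measurable_funTS; exact: measurable_indic.
  - by rewrite mulr_ge0// exprn_ge0.
  rewrite integral_indic//.
  apply: (@le_trans _ _ ((k * 4 ^+ j)%:E * (mu \x mu) (square j))%E).
    apply: lee_wpmul2l; first by rewrite lee_fin mulr_ge0// exprn_ge0.
    by apply: le_measure; rewrite ?inE//; exact: measurableI.
  rewrite measure_square -EFinM lee_fin le_eqVlt; apply/orP; left; apply/eqP.
  by field; rewrite expf_neq0.
by rewrite sumEFin lee_fin sumr_const card_ord -mulr_natr /k le_eqVlt; apply/orP; left; apply/eqP; ring.
Qed.

Lemma compact_cap_zero_point : compact_cap_zero [set q].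
Proof.
right; exists A; split; [exact: oA|exact: bA|by move=> _ ->; split; rewrite subrr normr0|].
apply/eqP; rewrite eq_le; apply/andP; split; last first.
  apply: le_ereal_inf_tmp => _ [u _ <-]; apply: integral_ge0 => p _.
  by rewrite lee_fin sqr_ge0.
have b0 := bump0_gt0; apply/lee_addgt0Pr => e e0; rewrite add0e.
pose n := (Num.truncn (1536 / bump 0 ^+ 4 / e)).+1.
have n0 : 0 < n%:R :> R by rewrite ltr0n.
apply: (@le_trans _ _ (1536 * weight n ^+ 2 * n%:R)%:E); last first.
  rewrite lee_fin; have -> : 1536 * weight n ^+ 2 * n%:R = 1536 / bump 0 ^+ 4 / n%:R.
    by rewrite /weight; field; rewrite !gt_eqF.
  rewrite ler_pdivrMr// -ler_pdivrMl// [leLHS]mulrC; exact: ltW (truncnS_gt _).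
apply: le_trans (energy n); apply: ereal_inf_lbound; exists (potential n) => //; split => //.
- move=> p; rewrite mulr_ge0// sumr_ge0// => j _; by rewrite mulr_ge0 ?bump_ge0.
- move=> _ ->; rewrite /potential /sum_bump (eq_bigr (fun=> bump 0 ^+ 2)).
    by rewrite sumr_const card_ord -mulr_natr /weight mulVf// mulf_neq0// gt_eqF// exprn_gt0.
  by move=> j _; rewrite /dyadic_bump !argE !subrr mulr0.
Qed.

End Dyadic.

End SingletonCapacity.

(** * The two inclusions *)

Section Main.
Variable R : realType.
Implicit Types (f : C R -> C R) (U : set (C R)).

Lemma cap_zero_point (q : R * R) (E : set (R * R)) : E `<=` [set q] -> cap_zero E.
Proof.
move=> Eq; have EP : E = set0 \/ E = [set q].
  have [->|/set0P[p Ep]] := eqVneq E set0; [by left|right].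
  by apply/seteqP; split => // _ ->; rewrite -(Eq p Ep).
have cE : compact_cap_zero E by case: EP => ->; [left|exact: compact_cap_zero_point].
have bE : bounded_set E.
  exists `|q|; split; first exact: num_real.
  by move=> M /ltW HM p /Eq ->.
split; [|by []|by []].
by case: EP => ->; [exact: closed0|exact: accessible_closed_set1 (hausdorff_accessible (@norm_hausdorff _ _)) _].
Qed.

(** All iterates map [U] into the union of its images; two points missed by the union would be two
    values omitted by the whole family, and Montel's theorem would make it normal on [U]. *)
Lemma julia_omits f x U : transcendental_entire f -> classical_julia f x -> open_nbhs x U ->
  exists q, (@toC R @^-1` (~` orbit_union f U)) `<=` [set q].
Proof.
move=> tf Jx [oU Ux]; apply: contrapT => /forallNP H.
have two (q : R * R) : exists2 p, ~ orbit_union f U (toC p) & p != q.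
  have /existsNP[p /not_implyP[np pq]] := H q.
  by exists p => //; apply/eqP => E; exact: pq.
have [a na _] := two 0; have [b nb ba] := two a.
apply: Jx; exists U; split => //; apply: (@montel R U _ (toC a) (toC b)) => //.
- apply: contraNneq ba => -[E1 E2]; apply/eqP.
  by case: a b E1 E2 {na nb} => ? ? [? ?] /= -> ->.
- by move=> _ [k _ <-] z _; exact: dif_iter (entire_dif tf.1) z.
- move=> _ z [k k0 <-] Uz; have Uk : orbit_union f U (iter k f z) by exists k => //; exists z.
  by split; [apply: contra_notN na|apply: contra_notN nb] => /eqP <-.
Qed.

End Main.

Theorem theorem1p2 (R : realType) (f : C R -> C R) :
  transcendental_entire f -> classical_julia f = cap_julia f.
Proof.
move=> tf; apply/seteqP; split=> x.
  move=> Jx U oxU; have [q Hq] := julia_omits tf Jx oxU; exact: cap_zero_point Hq.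
move=> Jx [U [[oU Ux] nU]]; have cap := Jx U (conj oU Ux).
apply: (no_lines tf oU nU) => a b ab.
  have [t It Ht] := cap_zero_lines false cap ab; exists t => // s; apply: contrapT => H.
  by have := Ht (t, s) H; rewrite eqxx.
have [t It Ht] := cap_zero_lines true cap ab; exists t => // s; apply: contrapT => H.
by have := Ht (s, t) H; rewrite eqxx.
Qed.
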